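(* Let $f\colon M^n(0)\to\mathbb{R}^{2n}$ be a Lagrangian isometric immersion of a flat Riemannian manifold with index of relative nullity $\nu_f\equiv0$ and let $P$ be an endomorphism of a Euclidean vector space $V$ such that $\sigma(P)\cap(-\sigma(P))=\emptyset$. Fix $x_0\in M^n$ and let $\varphi_0\in V$ and $\omega_0\in T^*_{x_0}M\otimes V$ be such that $\ker(P^c-\alpha I)\cap\ker(\omega_0^t)^c=\{0\}$ for any eigenvalue $\alpha$ of $P^c$. Then there exist an open neighborhood $U$ of $x_0$ and a unique $P$-transform $\tilde f=\mathcal{R}_{\varphi,\beta,\Omega,P}(f|_U)$ of $f|_U$ such that $\varphi(x_0)=\varphi_0$ and $d\varphi(x_0)=\omega_0$.
   Context: $\mathbb{R}^{2n}\cong\mathbb{C}^n$ with complex structure $J$. An isometric immersion $f\colon M^n\to\mathbb{C}^n$ is Lagrangian if $J$ carries each tangent space of $M^n$ onto the corresponding normal space. $\nu_f(x)$ is the dimension of the kernel of the second fundamental form of $f$ at $x$. $N_fM$, $\nabla^\perp$, $\alpha$, $A_\xi$ denote the normal bundle, normal connection, second fundamental form and shape operators of $f$. The superscript $t$ denotes transpose and the superscript $c$ on a linear map denotes its complexification (on $V^c=V\otimes\mathbb{C}$). Vectorial Ribaucour transform. Let $V$ be a (finite-dimensional) Euclidean vector space, identified with the trivial bundle $M\times V$ with its flat connection; $V^*\otimes V$ is identified with the endomorphisms of $V$. Let $\varphi\colon M\to V$ be smooth, $\omega=d\varphi$, $\langle\omega^t(v),X\rangle=\langle v,\omega(X)\rangle$,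 and let $\beta\in\Gamma(V^*\otimes N_fM)$ satisfy $\alpha(X,\omega^t(v))+(\nabla_X\beta)v=0$ (with $(\nabla_X\beta)v=\nabla^\perp_X(\beta(v))-\beta(\nabla_Xv)$) and $[\Phi_u,\Phi_v]=0$ for all $X,u,v$, where $\Phi_vX=\Phi(X)(v)=(\nabla_X\omega^t)v-A_{\beta(v)}X$. Put $\mathcal{F}=f_*\omega^t+\beta$ and let $\Omega\in\Gamma(V^*\otimes V)$ be everywhere invertible with $d\Omega=\mathcal{F}^td\mathcal{F}$ and $\Omega+\Omega^t=\mathcal{F}^t\mathcal{F}$. Then $\tilde f=\mathcal{R}_{\varphi,\beta,\Omega}(f)=f-\mathcal{F}\Omega^{-1}\varphi$, defined on the set $\tilde M^n$ of its regular points with the induced metric, is the vectorial Ribaucour transform of $f$ determined by $(\varphi,\beta,\Omega)$. $P$-transform. For $f$ Lagrangian with flat $M^n(0)$, $\tilde f=\mathcal{R}_{\varphi,\beta,\Omega}(f)$ is a $P$-transform of $f$, written $\mathcal{R}_{\varphi,\beta,\Omega,P}(f)$, if $P\in V^*\otimes V$ satisfies $\sigma(P)\cap(-\sigma(P))=\emptyset$ ($\sigma(P)$ the set of complex eigenvalues of $P$), $\beta=Jf_*\omega^tP$ and $\Omega^tP+P^t\Omega^t+T\rho=0$, where $T=-P^t-(P^t)^{-1}$ and $\rho=P^t\omega\omega^tP$. *)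

(* Defs.v *)
(* MathComp / MathComp-Analysis. *)
From mathcomp Require Import all_boot all_order all_algebra.
From mathcomp Require Import all_classical all_reals all_analysis.
From mathcomp Require Import complex.
Set Implicit Arguments.
Unset Strict Implicit.
Unset Printing Implicit Defensive.
Import Order.TTheory GRing.Theory Num.Theory.
Import numFieldNormedType.Exports.
Local Open Scope classical_set_scope.
Local Open Scope ring_scope.

(* Conventions: smooth means C^oo; vectors of R^k are columns and a linear map
   is identified with its matrix acting on the left; the Euclidean space V is
   R^m with its standard inner product, so that the transpose of an
   endomorphism of V is the matrix transpose. *)

Fixpoint Ck_on (R : realType) (n p q : nat) (k : nat) (W : set 'cV[R]_n)
    (h : 'cV[R]_n -> 'M[R]_(p, q)) : Prop :=
  match k with
  | 0%N => forall y, W y -> {for y, continuous h}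
  | k'.+1 => (forall y v, W y -> derivable h y v) /\
             (forall v, Ck_on k' W ('D_v h))
  end.

(* C^oo on an open set W. *)
Definition smooth_on (R : realType) (n p q : nat) (W : set 'cV[R]_n)
    (h : 'cV[R]_n -> 'M[R]_(p, q)) : Prop :=
  forall k, Ck_on k W h.

Definition ebasis (R : realType) (n : nat) (i : 'I_n) : 'cV[R]_n :=
  delta_mx i 0.

Definition jac (R : realType) (n p : nat) (h : 'cV[R]_n -> 'cV[R]_p)
    (y : 'cV[R]_n) : 'M[R]_(p, n) :=
  \matrix_(k, i) ('D_(ebasis R i) h y) k 0.

(* The inverse chart is a total function whose values outside the image of the
   chart are irrelevant. *)
Record chart (R : realType) (n : nat) (M : topologicalType) := Chart {
  chart_dom : set M;
  chart_fun :> M -> 'cV[R]_n;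
  chart_inv : 'cV[R]_n -> M }.

Definition chart_axiom (R : realType) (n : nat) (M : topologicalType)
    (c : chart R n M) : Prop :=
  [/\ open (chart_dom c),
      open (c @` chart_dom c),
      forall x, chart_dom c x -> chart_inv c (c x) = x,
      forall x, chart_dom c x -> {for x, continuous c} &
      forall x, chart_dom c x -> {for c x, continuous (chart_inv c)}].

Record smooth_manifold (R : realType) (n : nat) := SmoothManifold {
  manifold_sort :> topologicalType;
  atlas : set (chart R n manifold_sort);
  manifold_hausdorff : hausdorff_space manifold_sort;
  manifold_second_countable : @second_countable manifold_sort;
  atlas_chart : forall c, atlas c -> chart_axiom c;
  atlas_cover : forall x, exists2 c, atlas c & chart_dom c x;
  atlas_smooth : forall c d, atlas c -> atlas d ->
    smooth_on (c @` (chart_dom c `&` chart_dom d)) (d \o chart_inv c) }.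

Definition local_expr (R : realType) (n : nat) (M : topologicalType)
    (T : Type) (c : chart R n M) (h : M -> T) : 'cV[R]_n -> T :=
  h \o chart_inv c.

(* Only the values of h on the open set U matter. *)
Definition smooth_map (R : realType) (n p q : nat) (M : smooth_manifold R n)
    (U : set M) (h : M -> 'M[R]_(p, q)) : Prop :=
  forall c, atlas c -> smooth_on (c @` (chart_dom c `&` U)) (local_expr c h).

(* [metric_mx c x] is the Gram matrix at x of the coordinate frame of c. *)
Record riemannian_metric (R : realType) (n : nat) (M : smooth_manifold R n) :=
  RiemannianMetric {
  metric_mx : chart R n M -> M -> 'M[R]_n;
  metric_sym : forall c x, atlas c -> chart_dom c x ->
    (metric_mx c x)^T = metric_mx c x;
  metric_pos : forall c x, atlas c -> chart_dom c x ->
    forall X : 'cV[R]_n, X != 0 -> 0 < (X^T *m metric_mx c x *m X) 0 0;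
  metric_smooth : forall c, atlas c ->
    smooth_on (c @` chart_dom c) (local_expr c (metric_mx c));
  metric_change : forall c d x, atlas c -> atlas d ->
    chart_dom c x -> chart_dom d x ->
    let A := jac (d \o chart_inv c) (c x) in
    metric_mx c x = A^T *m metric_mx d x *m A }.

Definition local_metric (R : realType) (n : nat) (M : smooth_manifold R n)
    (g : riemannian_metric M) (c : chart R n M) : 'cV[R]_n -> 'M[R]_n :=
  local_expr c (metric_mx g c).

(* Coordinate expressions in a fixed chart: g is the matrix of the metric, f
   the immersion, and a vector X : 'cV_n is also regarded as the vector field with
   constant components X. *)

Definition christoffel (R : realType) (n : nat) (g : 'cV[R]_n -> 'M[R]_n)
    (y : 'cV[R]_n) (i j k : 'I_n) : R :=
  2^-1 * \sum_l invmx (g y) k l *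
    (('D_(ebasis R i) g y) j l + ('D_(ebasis R j) g y) i l
     - ('D_(ebasis R l) g y) i j).

(* Levi-Civita derivative; the q columns of Y are vector fields, so Y is also
   a section of Hom(R^q, TM) for the flat connection of the trivial bundle. *)
Definition covd (R : realType) (n q : nat) (g : 'cV[R]_n -> 'M[R]_n)
    (X : 'cV[R]_n) (Y : 'cV[R]_n -> 'M[R]_(n, q)) (y : 'cV[R]_n) :
    'M[R]_(n, q) :=
  'D_X Y y +
  (\matrix_(k, j) \sum_i X i 0 * christoffel g y i j k) *m Y y.

(* Constant coordinate fields commute, whence no bracket term. *)
Definition curvature (R : realType) (n : nat) (g : 'cV[R]_n -> 'M[R]_n)
    (X Y Z : 'cV[R]_n) (y : 'cV[R]_n) : 'cV[R]_n :=
  covd g X (covd g Y (fun=> Z)) y - covd g Y (covd g X (fun=> Z)) y.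

(* Gauss formula: alpha(X, Y) = D_X f_*Y - f_* nabla_X Y. *)
Definition sff (R : realType) (n p : nat) (g : 'cV[R]_n -> 'M[R]_n)
    (f : 'cV[R]_n -> 'cV[R]_p) (X Y : 'cV[R]_n) (y : 'cV[R]_n) : 'cV[R]_p :=
  'D_X (fun z => jac f z *m Y) y - jac f y *m covd g X (fun=> Y) y.

(* <A_xi X, Y> = <alpha(X, Y), xi>. *)
Definition shape_op (R : realType) (n p : nat) (g : 'cV[R]_n -> 'M[R]_n)
    (f : 'cV[R]_n -> 'cV[R]_p) (y : 'cV[R]_n) (xi : 'cV[R]_p) : 'M[R]_n :=
  invmx (g y) *m
  \matrix_(i, j) ((sff g f (ebasis R i) (ebasis R j) y)^T *m xi) 0 0.

(* The rows u with u *m A = 0, for A the matrix below, are the (transposed)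
   vectors X such that alpha(X, Y) = 0 for all Y. *)
Definition relative_nullity (R : realType) (n p : nat)
    (g : 'cV[R]_n -> 'M[R]_n) (f : 'cV[R]_n -> 'cV[R]_p) (y : 'cV[R]_n) : nat :=
  \rank (kermx (\matrix_(i < n)
    mxvec (\matrix_(k < p, j < n) (sff g f (ebasis R i) (ebasis R j) y) k 0))).

(* Orthogonal projection onto the normal space when g is induced by f. *)
Definition normal_proj (R : realType) (n p : nat) (g : 'cV[R]_n -> 'M[R]_n)
    (f : 'cV[R]_n -> 'cV[R]_p) (y : 'cV[R]_n) : 'M[R]_p :=
  1%:M - jac f y *m invmx (g y) *m (jac f y)^T.

(* Normal connection; V = R^m carries the standard flat connection, so this is
   nabla_X beta for a section beta of Hom(V, N_f M). *)
Definition normal_covd (R : realType) (n p m : nat) (g : 'cV[R]_n -> 'M[R]_n)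
    (f : 'cV[R]_n -> 'cV[R]_p) (X : 'cV[R]_n)
    (beta : 'cV[R]_n -> 'M[R]_(p, m)) (y : 'cV[R]_n) : 'M[R]_(p, m) :=
  normal_proj g f y *m 'D_X beta y.

(* Adjoint V -> TM of a linear map TM -> V, for G the Gram matrix on TM. *)
Definition adjoint_mx (R : realType) (n m : nat) (G : 'M[R]_n)
    (w : 'M[R]_(m, n)) : 'M[R]_(n, m) :=
  invmx G *m w^T.

(* omega^t for omega = d phi. *)
Definition omegat (R : realType) (n m : nat) (g : 'cV[R]_n -> 'M[R]_n)
    (phi : 'cV[R]_n -> 'cV[R]_m) (y : 'cV[R]_n) : 'M[R]_(n, m) :=
  adjoint_mx (g y) (jac phi y).

Definition Phi_op (R : realType) (n p m : nat) (g : 'cV[R]_n -> 'M[R]_n)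
    (f : 'cV[R]_n -> 'cV[R]_p) (phi : 'cV[R]_n -> 'cV[R]_m)
    (beta : 'cV[R]_n -> 'M[R]_(p, m)) (y : 'cV[R]_n)
    (v : 'cV[R]_m) (X : 'cV[R]_n) : 'cV[R]_n :=
  covd g X (omegat g phi) y *m v - shape_op g f y (beta y *m v) *m X.

Definition calF (R : realType) (n p m : nat) (g : 'cV[R]_n -> 'M[R]_n)
    (f : 'cV[R]_n -> 'cV[R]_p) (phi : 'cV[R]_n -> 'cV[R]_m)
    (beta : 'cV[R]_n -> 'M[R]_(p, m)) (y : 'cV[R]_n) : 'M[R]_(p, m) :=
  jac f y *m omegat g phi y + beta y.

Record ribaucour_data_at (R : realType) (n p m : nat)
    (g : 'cV[R]_n -> 'M[R]_n) (f : 'cV[R]_n -> 'cV[R]_p)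
    (phi : 'cV[R]_n -> 'cV[R]_m) (beta : 'cV[R]_n -> 'M[R]_(p, m))
    (Omega : 'cV[R]_n -> 'M[R]_m) (y : 'cV[R]_n) : Prop := {
  rib_normal : (jac f y)^T *m beta y = 0;
  rib_codazzi : forall (X : 'cV[R]_n) (v : 'cV[R]_m),
    sff g f X (omegat g phi y *m v) y + normal_covd g f X beta y *m v = 0;
  rib_commute : forall (u v : 'cV[R]_m) (X : 'cV[R]_n),
    Phi_op g f phi beta y u (Phi_op g f phi beta y v X) =
    Phi_op g f phi beta y v (Phi_op g f phi beta y u X);
  rib_unit : Omega y \in unitmx;
  rib_dOmega : forall X : 'cV[R]_n,
    'D_X Omega y = (calF g f phi beta y)^T *m 'D_X (calF g f phi beta) y;
  rib_sym : Omega y + (Omega y)^T =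
    (calF g f phi beta y)^T *m calF g f phi beta y }.

Definition ribaucour_map (R : realType) (n p m : nat)
    (g : 'cV[R]_n -> 'M[R]_n) (f : 'cV[R]_n -> 'cV[R]_p)
    (phi : 'cV[R]_n -> 'cV[R]_m) (beta : 'cV[R]_n -> 'M[R]_(p, m))
    (Omega : 'cV[R]_n -> 'M[R]_m) (y : 'cV[R]_n) : 'cV[R]_p :=
  f y - calF g f phi beta y *m invmx (Omega y) *m phi y.

(* Multiplication by i on C^n = R^n + i R^n = R^(2n). *)
Definition Jmx (R : realType) (n : nat) : 'M[R]_(n + n) :=
  block_mx 0 (- 1%:M) 1%:M 0.

Definition P_condition_at (R : realType) (n m : nat)
    (g : 'cV[R]_n -> 'M[R]_n) (f : 'cV[R]_n -> 'cV[R]_(n + n)) (P : 'M[R]_m)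
    (phi : 'cV[R]_n -> 'cV[R]_m) (beta : 'cV[R]_n -> 'M[R]_(n + n, m))
    (Omega : 'cV[R]_n -> 'M[R]_m) (y : 'cV[R]_n) : Prop :=
  let T := - P^T - invmx P^T in
  let rho := P^T *m jac phi y *m omegat g phi y *m P in
  beta y = Jmx R n *m jac f y *m omegat g phi y *m P /\
  (Omega y)^T *m P + P^T *m (Omega y)^T + T *m rho = 0.

Definition complexify (R : realType) (p q : nat) (A : 'M[R]_(p, q)) :
    'M[complex R]_(p, q) :=
  map_mx (real_complex R) A.

(* [eigenvalue] refers to row vectors, whence the transpose. *)
Definition spectrum (R : realType) (m : nat) (P : 'M[R]_m) : set (complex R) :=
  [set a | eigenvalue (complexify P)^T a].

Definition spectrum_condition (R : realType) (m : nat) (P : 'M[R]_m) : Prop :=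
  spectrum P `&` [set - a | a in spectrum P] = set0.

Definition flat_metric (R : realType) (n : nat) (M : smooth_manifold R n)
    (g : riemannian_metric M) : Prop :=
  forall (c : chart R n M) (x : M), atlas c -> chart_dom c x ->
  forall X Y Z : 'cV[R]_n, curvature (local_metric g c) X Y Z (c x) = 0.

Definition isometric_immersion (R : realType) (n p : nat)
    (M : smooth_manifold R n) (g : riemannian_metric M) (f : M -> 'cV[R]_p) :
    Prop :=
  smooth_map setT f /\
  forall (c : chart R n M) (x : M), atlas c -> chart_dom c x ->
    let df := jac (local_expr c f) (c x) in
    \rank df = n /\ df^T *m df = metric_mx g c x.

Definition lagrangian (R : realType) (n : nat) (M : smooth_manifold R n)
    (f : M -> 'cV[R]_(n + n)) : Prop :=
  forall (c : chart R n M) (x : M), atlas c -> chart_dom c x ->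
  let df := jac (local_expr c f) (c x) in
  forall xi : 'cV[R]_(n + n),
    (exists X : 'cV[R]_n, xi = Jmx R n *m (df *m X)) <-> df^T *m xi = 0.

Definition zero_relative_nullity (R : realType) (n p : nat)
    (M : smooth_manifold R n) (g : riemannian_metric M) (f : M -> 'cV[R]_p) :
    Prop :=
  forall (c : chart R n M) (x : M), atlas c -> chart_dom c x ->
  relative_nullity (local_metric g c) (local_expr c f) (c x) = 0%N.

(* ft, with domain D, is the transform of f restricted to the open set U that
   is determined by (phi, beta, Omega) restricted to U.  Tensorial conditions
   are imposed in every chart; D is the set of regular points and it is not
   required to be nonempty. *)
Record vectorial_ribaucour (R : realType) (n p m : nat)
    (M : smooth_manifold R n) (g : riemannian_metric M) (f : M -> 'cV[R]_p)
    (U : set M) (phi : M -> 'cV[R]_m) (beta : M -> 'M[R]_(p, m))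
    (Omega : M -> 'M[R]_m) (D : set M) (ft : M -> 'cV[R]_p) : Prop := {
  vr_phi_smooth : smooth_map U phi;
  vr_beta_smooth : smooth_map U beta;
  vr_Omega_smooth : smooth_map U Omega;
  vr_data : forall (c : chart R n M) (x : M),
    atlas c -> chart_dom c x -> U x ->
    ribaucour_data_at (local_metric g c) (local_expr c f) (local_expr c phi)
      (local_expr c beta) (local_expr c Omega) (c x);
  vr_regular : D = [set x | U x /\
    forall c : chart R n M, atlas c -> chart_dom c x ->
    \rank (jac (ribaucour_map (local_metric g c) (local_expr c f)
      (local_expr c phi) (local_expr c beta) (local_expr c Omega)) (c x)) = n];
  vr_map : forall (c : chart R n M) (x : M), atlas c -> chart_dom c x -> D x ->
    ft x = ribaucour_map (local_metric g c) (local_expr c f)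
      (local_expr c phi) (local_expr c beta) (local_expr c Omega) (c x) }.

Record P_transform (R : realType) (n m : nat)
    (M : smooth_manifold R n) (g : riemannian_metric M)
    (f : M -> 'cV[R]_(n + n)) (U : set M) (P : 'M[R]_m)
    (phi : M -> 'cV[R]_m) (beta : M -> 'M[R]_(n + n, m))
    (Omega : M -> 'M[R]_m) (D : set M) (ft : M -> 'cV[R]_(n + n)) : Prop := {
  pt_ribaucour : vectorial_ribaucour g f U phi beta Omega D ft;
  pt_spectrum : spectrum_condition P;
  pt_condition : forall (c : chart R n M) (x : M),
    atlas c -> chart_dom c x -> U x ->
    P_condition_at (local_metric g c) (local_expr c f) P (local_expr c phi)
      (local_expr c beta) (local_expr c Omega) (c x) }.

(* Main.v *)
From HB Require Import structures.
Require Import Defs.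
From mathcomp Require Import all_boot all_order all_algebra.
From mathcomp Require Import all_classical all_reals all_analysis.
From mathcomp Require Import complex ring lra.
Set Implicit Arguments.
Unset Strict Implicit.
Unset Printing Implicit Defensive.
Import Order.TTheory GRing.Theory Num.Theory.
Import numFieldNormedType.Exports.
Local Open Scope classical_set_scope.
Local Open Scope ring_scope.

(** Why the theorem holds.  Let [J] be the complex structure, [Pi] the
    orthogonal projection onto the tangent spaces of [f], and put
    [E = df omega^t], a family of linear maps from V to R^(2n) with tangent
    values.  A P-transform is determined by E alone: [d phi = E^T df],
    [beta = J E P], [F = E + J E P], and the equation between P and Omega is a
    Sylvester equation for [Omega^T] whose right-hand side is linear in the
    Gram matrix [E^T E]; it has exactly one solution because the spectra of P
    and -P are disjoint ([sylvester_inj], [omega_sol]).  So the problem is to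
    find E.

    The Codazzi condition on beta says that the derivatives of F are tangent.
    As [J Pi = (1 - Pi) J] for a Lagrangian immersion, this amounts to
    [D_X E = (D_X Pi) E + J (D_X Pi) E P^-1] ([cod_variation],
    [variation_cod]), and for tangent E the right-hand side is
    [theta_X (J E - E P^-1)] with [theta_X = - J (D_X Pi) (2 Pi - 1)]
    ([theta_tangent]).  This linear total differential system is integrable:
    by the Gauss equation, flatness makes the [D_X Pi] commute with one another
    ([flat_comm_df], [lag_comm]), so that theta is closed, the [theta_X]
    commute with one another, and they commute with J as well.  Hence every
    Picard iterate is the primitive of a closed form, given by the Poincare
    lemma ([radial_primitive_derive]), and the iteration converges on a small
    ball ([linear_frobenius]).  The normal part of the solution obeys a
    homogeneous linear system ([normal_part_deriv]), so E stays tangent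
    ([solve_exists]); two solutions with the same initial value coincide
    ([solve_unique]).

    Given E, the form [E^T df] is closed because the second fundamental form is
    symmetric ([potential_form_closed]), and its primitive is phi.  The
    derivative of F is [J (D_X Pi) E (P^-1 + P)]; comparing it with the
    differentiated Sylvester equation gives [d Omega = F^T dF]
    ([cs_Om_derive]), and [Omega + Omega^T = F^T F] is another consequence of
    uniqueness in the Sylvester equation ([omega_sol_sym]).  The operators
    [Phi_v] commute because they are built from the commuting [D_X Pi]
    ([cs_Phi], [cs_Phi_comm]).  The hypothesis on the eigenspaces of P enters
    only in the invertibility of Omega at the base point: the kernel of
    [Omega] there is invariant under P and lies in the kernel of [omega_0^t],
    so that, if it were not zero, its complexification would contain an
    eigenvector of P ([omega_unitmx]).

    All this takes place in the chart [c0].  Since E, phi and Omega are then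
    functions on a region of the manifold, composition with the transition maps
    carries the equations to every other chart ([transport_chart_solution]).
    Conversely, the data of any P-transform, read in [c0], yield a solution E
    of the same system ([data_chart_solution]), whence uniqueness. *)

(** * Derivatives of matrix-valued maps *)

Section MatrixDerivatives.
Context {R : realType} {V : normedModType R}.

Lemma is_derive_mxP p q (h : V -> 'M[R]_(p, q)) (y v : V) dh :
  is_derive y v h dh <->
  forall i j, is_derive y v (fun z => h z i j) (dh i j).
Proof.
split=> [[hd <-] i j|H].
  have/derivable_mxP hij := hd.
  by split=> //; rewrite derive_mx// mxE.
have hd : derivable h y v by apply/derivable_mxP => i j; case: (H i j).
split=> //; rewrite derive_mx//; apply/matrixP => i j; rewrite mxE.
by case: (H i j).
Qed.

Lemma is_derive_bigsum (W : normedModType R) (I : Type) (r : seq I)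
    (h : I -> V -> W) (y v : V) (dh : I -> W) :
  (forall i, is_derive y v (h i) (dh i)) ->
  is_derive y v (fun z => \sum_(i <- r) h i z) (\sum_(i <- r) dh i).
Proof.
move=> H; elim: r => [|i r IH].
  rewrite big_nil (_ : (fun _ => _) = cst 0); first exact: is_derive_cst.
  by apply/funext => z; rewrite big_nil.
rewrite big_cons (_ : (fun _ => _) = h i + (fun z => \sum_(i <- r) h i z)).
  exact: is_deriveD.
by apply/funext => z; rewrite big_cons.
Qed.

Lemma is_derive_mulr (f g : V -> R) (y v : V) df dg :
  is_derive y v f df -> is_derive y v g dg ->
  is_derive y v (fun z => f z * g z) (df * g y + f y * dg).
Proof.
move=> Hf Hg; apply: (is_derive_eq (is_deriveM Hf Hg)).
by rewrite addrC /GRing.scale/= mulrC.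
Qed.

Lemma is_derive_mulmx p q s (A : V -> 'M[R]_(p, q)) (B : V -> 'M[R]_(q, s))
    (y v : V) dA dB :
  is_derive y v A dA -> is_derive y v B dB ->
  is_derive y v (fun z => A z *m B z) (dA *m B y + A y *m dB).
Proof.
move=> /is_derive_mxP HA /is_derive_mxP HB; apply/is_derive_mxP => i j.
rewrite (_ : (fun _ => _) = (fun z => \sum_k A z i k * B z k j)); last first.
  by apply/funext => z; rewrite mxE.
rewrite !mxE -big_split /=; apply: is_derive_bigsum => k.
exact: is_derive_mulr.
Qed.

Lemma is_derive_linear_mx p q p' q' (L : {linear 'M[R]_(p, q) -> 'M[R]_(p', q')})
   (h : V -> 'M[R]_(p, q)) (y v : V) dh :
  is_derive y v h dh -> is_derive y v (fun z => L (h z)) (L dh).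
Proof.
move=> H; apply/is_derive_mxP => a b.
have E A : L A a b = \sum_i \sum_j A i j * L (delta_mx i j) a b.
  rewrite {1}(matrix_sum_delta A) linear_sum summxE; apply: eq_bigr => i _.
  rewrite linear_sum summxE; apply: eq_bigr => j _.
  by rewrite linearZ mxE.
rewrite (_ : (fun _ => _) =
   (fun z => \sum_i \sum_j h z i j * L (delta_mx i j) a b)); last first.
  by apply/funext => z; rewrite E.
rewrite E; apply: is_derive_bigsum => i; apply: is_derive_bigsum => j.
have /is_derive_mxP/(_ i j) Hij := H.
apply: (is_derive_eq (is_derive_mulr Hij (is_derive_cst _ y v))).
by rewrite mulr0 addr0.
Qed.

End MatrixDerivatives.

Section SegmentMeanValue.
Context {R : realType} {V : normedModType R}.

Lemma is_derive_line (W : normedModType R) (h : V -> W) (y v : V) (t : R) :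
  derivable h (t *: v + y) v ->
  is_derive t (1 : R) (fun s : R => h (s *: v + y)) ('D_v h (t *: v + y)).
Proof.
have E : (fun s : R => s^-1 *: (((fun s : R => h (s *: v + y)) \o shift t) (s *: (1:R)) - h (t *: v + y)))
   = (fun s => s^-1 *: ((h \o shift (t *: v + y)) (s *: v) - h (t *: v + y))).
  apply/funext => s /=; congr (_ *: (h _ - _)).
  by rewrite [s *: 1]mulr1 scalerDl addrA.
by move=> H; split; [rewrite /derivable E|rewrite /derive E].
Qed.

Lemma is_derive_scale_dir (W : normedModType R) (h : V -> W) (y v : V) (a : R) d :
  is_derive y v h d -> is_derive y (a *: v) h (a *: d).
Proof.
have [->|a0] := eqVneq a 0; first by rewrite !scale0r => _; exact: is_derive0.
move=> [hd <-].
have H : (fun s : R => s * a) @ 0^' --> 0^'.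
  move=> A; rewrite !/nbhs/= => /(nbhs_ballP (0:R))[e /= e0 He].
  apply/(nbhs_ballP (0:R)); exists (e / `|a|) => /=; first by rewrite divr_gt0 ?normr_gt0.
  move=> s; rewrite /ball/= sub0r normrN ltr_pdivlMr ?normr_gt0// => sa s0 /=.
  apply: He; last by rewrite mulf_neq0.
  by rewrite /ball/= sub0r normrN normrM.
have E : (fun s : R => s^-1 *: ((h \o shift y) (s *: (a *: v)) - h y)) @ 0^'
    --> a *: 'D_v h y.
  have : (fun s : R => a *: (s^-1 *: ((h \o shift y) (s *: v) - h y))) @ 0^' --> a *: 'D_v h y.
    by apply: cvgZ => //; exact: cvg_cst.
  move=> /(cvg_comp _ _ H); apply: cvg_trans.
  apply: near_eq_cvg; near=> s => /=.
  rewrite !scalerA invfM mulrC -mulrA [a^-1 * a]mulVf// mulr1//.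
by split; [apply/cvg_ex; eexists; exact: E|apply: cvg_lim].
Unshelve. all: by end_near. Qed.

Lemma is_derive_scale_dirR (h : V -> R) (y v : V) (a : R) d :
  is_derive y v h d -> is_derive y (a *: v) h (a * d).
Proof. exact: is_derive_scale_dir. Qed.

Lemma is_derive_translate (W : normedModType R) (h : V -> W) (y v c : V) d :
  is_derive (c + y) v h d -> is_derive y v (fun z => h (c + z)) d.
Proof.
rewrite [c + y]addrC => -[Dd De].
have E : (fun s : R => s^-1 *: (((fun z => h (c + z)) \o shift y) (s *: v) - h (c + y)))
   = (fun s : R => s^-1 *: ((h \o shift (y + c)) (s *: v) - h (y + c))).
  apply/funext => x /=; rewrite [c + y]addrC.
  by congr (_ *: (h _ - _)); rewrite addrC -addrA.
by split; [rewrite /derivable E|rewrite /derive E; exact: De].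
Qed.

Lemma segment_MVT (h : V -> R) (y v : V) :
  (forall t, 0 <= t <= 1 -> derivable h (t *: v + y) v) ->
  exists2 t, 0 <= t <= 1 & h (v + y) - h y = 'D_v h (t *: v + y).
Proof.
move=> H.
have H' (t : R) : 0 <= t <= 1 -> is_derive t (1 : R)
    (fun s : R => h (s *: v + y)) ('D_v h (t *: v + y)).
  by move=> ?; apply/is_derive_line/H.
have [] := @MVT_segment R (fun s => h (s *: v + y))
    (fun s => 'D_v h (s *: v + y)) 0 1 ler01.
- by move=> x; rewrite in_itv/= => /andP[/ltW a /ltW b]; apply: H'; rewrite a.
- apply: derivable_within_continuous => t; rewrite in_itv/= => t01.
  by have [] := H' t t01.
move=> t; rewrite in_itv/= => t01; rewrite scale1r scale0r add0r subr0 mulr1.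
by exists t.
Qed.

End SegmentMeanValue.

Section MatrixNorm.
Context {R : realType}.

Lemma mx_norm_le p q (A : 'M[R]_(p, q)) (e : R) : 0 <= e ->
  (forall i j, `|A i j| <= e) -> `|A| <= e.
Proof.
move=> e0 H; rewrite /Num.Def.normr/= mx_normrE.
by apply: bigmax_le => //= -[i j] _; exact: H.
Qed.

Lemma entry_le_mx_norm p q (A : 'M[R]_(p, q)) i j : `|A i j| <= `|A|.
Proof.
rewrite [leRHS]/Num.Def.normr/= mx_normrE.
exact: (le_bigmax _ (fun k : 'I_p * 'I_q => `|A k.1 k.2|) (i, j)).
Qed.

Lemma mx_norm_mulmx p q s (A : 'M[R]_(p, q)) (B : 'M[R]_(q, s)) :
  `|A *m B| <= q%:R * `|A| * `|B|.
Proof.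
apply: mx_norm_le => [|i j]; first by rewrite !mulr_ge0.
rewrite mxE (le_trans (ler_norm_sum _ _ _))//.
rewrite -mulrA mulr_natl -[leRHS](_ : \sum_(k < q) `|A| * `|B| = _).
  by apply: ler_sum => k _; rewrite normrM ler_pM// entry_le_mx_norm.
by rewrite sumr_const card_ord.
Qed.

End MatrixNorm.

Section C1.
Context {R : realType} {n : nat}.
Local Notation V := 'cV[R]_n.

(** The vertices of a path from [y] to [z] along the coordinate directions. *)
Definition splice (y z : V) (k : nat) : V :=
  \col_i (if (i < k)%N then z i 0 else y i 0).

Lemma spliceS y z (k : 'I_n) :
  splice y z k.+1 = (z k 0 - y k 0) *: ebasis R k + splice y z k.
Proof.
apply/colP => i; rewrite !mxE eqxx andbT ltnS leq_eqVlt.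
case: (ltngtP i k) => [ik|ik|/val_inj ->].
- by rewrite (_ : (i == k) = false) ?mulr0 ?add0r// -val_eqE ltn_eqF.
- by rewrite (_ : (i == k) = false) ?mulr0 ?add0r// -val_eqE gtn_eqF.
- by rewrite eqxx mulr1 subrK.
Qed.

Lemma splice0 y z : splice y z 0 = y.
Proof. by apply/colP => i; rewrite !mxE. Qed.

Lemma splice_full y z : splice y z n = z.
Proof. by apply/colP => i; rewrite !mxE ltn_ord. Qed.

(** The mean value theorem on each step of the path of splices: a step changes one
    coordinate, so a single partial derivative, near its value at [y], enters. *)
Lemma C1_entry_approx (h : V -> R) (y : V) :
  (forall i : 'I_n, \forall z \near y, derivable h z (ebasis R i)) ->
  (forall i : 'I_n, {for y, continuous ('D_(ebasis R i) h)}) ->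
  forall e : R, 0 < e ->
  \forall z \near y,
    `|h z - h y - \sum_i (z - y) i 0 * 'D_(ebasis R i) h y| <= e * `|z - y|.
Proof.
move=> hd hc e e0.
(* n + 1 because n may be 0 *)
pose d := e / (n%:R + 1).
have d0 : 0 < d by rewrite divr_gt0// ltr_wpDl.
have : \forall z \near y, forall i : 'I_n,
   derivable h z (ebasis R i) /\ `|'D_(ebasis R i) h y - 'D_(ebasis R i) h z| <= d.
  apply: (@filter_forall V _ (fun i z => derivable h z (ebasis R i) /\
    `|'D_(ebasis R i) h y - 'D_(ebasis R i) h z| <= d) (nbhs y)) => i.
  apply: filterI; first exact: hd.
  by have /cvgrPdist_le/(_ _ d0) := hc i.
move=> /(nbhs_ballP y)[r /= r0 Hr]; apply/(nbhs_ballP y); exists r => // z.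
rewrite mx_norm_ball /ball_/= => zr.
have Hz w : (forall i, `|(y - w) i 0| <= `|(y - z) i 0|) -> ball y r w.
  move=> H; rewrite mx_norm_ball /ball_/= (le_lt_trans _ zr)//.
  apply: mx_norm_le => // i j; rewrite (ord1 j) (le_trans (H i))//.
  exact: entry_le_mx_norm.
have step (k : 'I_n) : `|h (splice y z k.+1) - h (splice y z k)
     - (z - y) k 0 * 'D_(ebasis R k) h y| <= d * `|z - y|.
  rewrite spliceS; set w := splice y z k; set a := z k 0 - y k 0.
  have Hb (t : R) : 0 <= t <= 1 -> ball y r (t *: (a *: ebasis R k) + w).
    move=> /andP[t0 t1]; apply: Hz => i; rewrite !mxE eqxx andbT.
    case: (eqVneq i k) => [->|ik].
      rewrite ltnn mulr1 opprD addrCA subrr addr0 normrN normrM ger0_norm//.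
      by rewrite [leRHS]distrC ler_piMl.
    by rewrite !mulr0 add0r; case: ifP; rewrite ?subrr ?normr0.
  have Dk x : ball y r x -> is_derive x (a *: ebasis R k) h (a *: 'D_(ebasis R k) h x).
    by move=> /Hr/(_ k)[dh _]; apply/is_derive_scale_dir/derivableP.
  have [t t01 ->] := @segment_MVT R V h w (a *: ebasis R k)
     (fun t t01 => @ex_derive _ _ _ _ _ _ _ (Dk _ (Hb t t01))).
  rewrite (@derive_val _ _ _ _ _ _ _ (Dk _ (Hb t t01))) !mxE -/a.
  rewrite -mulrBr normrM mulrC ler_pM//.
    by have [_] := Hr _ (Hb t t01) k; rewrite distrC.
  by rewrite /a (_ : _ - _ = (z - y) k 0) ?entry_le_mx_norm// !mxE.
have -> : h z - h y = \sum_(k < n) (h (splice y z k.+1) - h (splice y z k)).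
  rewrite -(big_mkord xpredT (fun k => h (splice y z k.+1) - h (splice y z k))).
  by rewrite telescope_sumr// splice_full splice0.
rewrite -sumrB (le_trans (ler_norm_sum _ _ _))//.
apply: (@le_trans _ _ (\sum_(k < n) d * `|z - y|)).
  by apply: ler_sum => k _; exact: step.
rewrite sumr_const card_ord -mulr_natl mulrA ler_wpM2r// /d mulrA.
by rewrite ler_pdivrMr ?ltr_wpDl// mulrC ler_wpM2l ?(ltW e0)// lerDl.
Qed.
End C1.

(** * Limits of matrices, and differentiability of C^1 maps *)

Section MatrixLimits.
Context {R : realType}.

Lemma cvg_mxP {T : Type} (F : set_system T) {FF : Filter F} p q
    (h : T -> 'M[R]_(p, q)) (l : 'M[R]_(p, q)) :
  h @ F --> l <-> forall i j, (fun z => h z i j) @ F --> l i j.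
Proof.
split=> [H i j|H].
  have C : (fun M : 'M[R]_(p, q) => M i j) @ l --> l i j by exact: coord_continuous.
  exact: (cvg_comp _ _ H C).
apply/cvgrPdist_le => e e0; near=> z.
apply: mx_norm_le => [|i j]; first exact: ltW.
rewrite !mxE.
have : forall k : 'I_p * 'I_q, `|l k.1 k.2 - h z k.1 k.2| <= e.
  near: z.
  apply: (@filter_forall T _ (fun (k : 'I_p * 'I_q) z => `|l k.1 k.2 - h z k.1 k.2| <= e) F) => k.
  by have /cvgrPdist_le/(_ _ e0) := H k.1 k.2.
by move=> /(_ (i, j)).
Unshelve. all: by end_near. Qed.

Lemma cvg_bigsum {T : Type} (F : set_system T) {FF : Filter F} (W : normedModType R)
   (I : Type) (r : seq I) (h : I -> T -> W) (l : I -> W) :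
  (forall i, h i @ F --> l i) ->
  (fun z => \sum_(i <- r) h i z) @ F --> \sum_(i <- r) l i.
Proof.
move=> H; elim: r => [|i r IH].
  rewrite big_nil (_ : (fun _ => _) = cst 0); first exact: cvg_cst.
  by apply/funext => z; rewrite big_nil.
rewrite big_cons (_ : (fun _ => _) = h i \+ (fun z => \sum_(i <- r) h i z)).
  exact: cvgD.
by apply/funext => z; rewrite big_cons.
Qed.

Lemma cvg_mulmx {T : Type} (F : set_system T) {FF : Filter F} p q s
  (A : T -> 'M[R]_(p, q)) (B : T -> 'M[R]_(q, s))
  (a : 'M[R]_(p, q)) (b : 'M[R]_(q, s)) :
  A @ F --> a -> B @ F --> b -> (fun z => A z *m B z) @ F --> a *m b.
Proof.
move=> /cvg_mxP HA /cvg_mxP HB; apply/cvg_mxP => i j.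
rewrite (_ : (fun _ => _) = (fun z => \sum_k A z i k * B z k j)); last first.
  by apply/funext => z; rewrite mxE.
by rewrite mxE; apply: cvg_bigsum => k; apply: cvgM.
Qed.

Lemma cvg_linear_mx {T : Type} (F : set_system T) {FF : Filter F} p q p' q'
    (L : {linear 'M[R]_(p, q) -> 'M[R]_(p', q')}) (h : T -> 'M[R]_(p, q)) l :
  h @ F --> l -> (fun z => L (h z)) @ F --> L l.
Proof.
have E A : L A = \sum_i \sum_j A i j *: L (delta_mx i j).
  rewrite {1}(matrix_sum_delta A) linear_sum; apply: eq_bigr => i _.
  by rewrite linear_sum; apply: eq_bigr => j _; rewrite linearZ.
move=> /cvg_mxP H; rewrite (_ : (fun _ => _) =
   (fun z => \sum_i \sum_j h z i j *: L (delta_mx i j))); last first.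
  by apply/funext => z; rewrite E.
rewrite E; apply: cvg_bigsum => i; apply: cvg_bigsum => j.
by apply: cvgZ; [exact: H|exact: cvg_cst].
Qed.

Lemma cvg_det {T : Type} (F : set_system T) {FF : Filter F} p
   (A : T -> 'M[R]_p) (a : 'M[R]_p) :
  A @ F --> a -> (fun z => \det (A z)) @ F --> \det a.
Proof.
move=> /cvg_mxP HA; rewrite /determinant.
apply: cvg_bigsum => s; apply: cvgM; first exact: cvg_cst.
elim: (index_enum _) => [|i r IH].
  rewrite big_nil (_ : (fun _ => _) = cst 1); first exact: cvg_cst.
  by apply/funext => z; rewrite big_nil.
rewrite big_cons; under eq_fun do rewrite big_cons.
by apply: cvgM.
Qed.

Lemma cvg_invmx {T : Type} (F : set_system T) {FF : Filter F} p
   (A : T -> 'M[R]_p) (a : 'M[R]_p) :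
  a \in unitmx -> (\forall z \near F, A z \in unitmx) ->
  A @ F --> a -> (fun z => invmx (A z)) @ F --> invmx a.
Proof.
move=> ua uA HA.
have D := cvg_det HA; have {}D := D FF.
have : (fun z => (\det (A z))^-1 *: \adj (A z)) @ F --> (\det a)^-1 *: \adj a.
  apply: cvgZ; first by apply: cvgV => //; move: ua; rewrite unitmxE unitfE.
  apply/cvg_mxP => i j; rewrite (_ : (fun _ => _) = (fun z => cofactor (A z) j i)); last first.
    by apply/funext => z; rewrite mxE.
  rewrite mxE /cofactor; apply: cvgM; first exact: cvg_cst.
  apply: cvg_det; apply/cvg_mxP => k l.
  rewrite !mxE; under eq_fun do rewrite !mxE.
  by have /cvg_mxP := HA; exact.
rewrite {2}/invmx ua; apply: cvg_trans; apply: near_eq_cvg.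
by apply: filterS uA => z uz; rewrite /invmx uz.
Qed.

End MatrixLimits.

Section C1Differentiable.
Context {R : realType} {n : nat}.
Local Notation V := 'cV[R]_n.

Section LinearFromColumns.
Context {p q : nat} (D : 'I_n -> 'M[R]_(p, q)).
Definition dir_lin (w : V) : 'M[R]_(p, q) := \sum_i w i 0 *: D i.
Lemma dir_lin_linear : linear dir_lin.
Proof.
move=> a u v; rewrite /dir_lin scaler_sumr -big_split; apply: eq_bigr => i _.
by rewrite !mxE scalerDl scalerA.
Qed.
HB.instance Definition _ := GRing.isLinear.Build R V 'M[R]_(p, q) _ dir_lin dir_lin_linear.
End LinearFromColumns.

(** C^k maps are defined by directional derivatives, which alone need not be
    linear in the direction; continuity of the partial derivatives makes them so. *)
Lemma C1_differentiable p q (h : V -> 'M[R]_(p, q)) (y : V) :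
  (forall i : 'I_n, \forall z \near y, derivable h z (ebasis R i)) ->
  (forall i : 'I_n, {for y, continuous ('D_(ebasis R i) h)}) ->
  differentiable h y /\
  forall v, 'd h y v = dir_lin (fun i => 'D_(ebasis R i) h y) v.
Proof.
move=> hd hc; pose L : {linear V -> 'M[R]_(p, q)} := dir_lin (fun i => 'D_(ebasis R i) h y).
have Lc : continuous L by move=> z; exact: (@cvg_linear_mx R V (nbhs z) _ n 1 p q L id z cvg_id).
have E : forall e : R, 0 < e ->
  \forall z \near y, `|h z - h y - L (z - y)| <= e * `|z - y|.
  move=> e e0.
  have : \forall z \near y, forall k : 'I_p * 'I_q,
    `|h z k.1 k.2 - h y k.1 k.2 - L (z - y) k.1 k.2| <= e * `|z - y|.
    apply: (@filter_forall V _ (fun (k : 'I_p * 'I_q) z => `|h z k.1 k.2 - h y k.1 k.2 - L (z - y) k.1 k.2| <= e * `|z - y|) (nbhs y)) => -[a b] /=.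
    have := @C1_entry_approx R n (fun z => h z a b) y _ _ e e0.
    have hdE i z : derivable h z (ebasis R i) ->
       'D_(ebasis R i) (fun z => h z a b) z = ('D_(ebasis R i) h z) a b.
      by move=> H; rewrite derive_mx// mxE.
    have H1 : forall i : 'I_n, \forall z \near y, derivable (fun z => h z a b) z (ebasis R i).
      by move=> i; apply: filterS (hd i) => z /derivable_mxP.
    have H2 : forall i : 'I_n, {for y, continuous ('D_(ebasis R i) (fun z => h z a b))}.
      move=> i; rewrite /prop_for /continuous_at hdE; last exact: (nbhs_singleton (hd i)).
      have /cvg_mxP/(_ a b) := hc i; apply: cvg_trans; apply: (@near_eq_cvg _ _ (nbhs y)).
      by apply: filterS (hd i) => z /hdE.
    move=> /(_ H1 H2); apply: filterS => z; congr (`|_ - _| <= _).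
    rewrite /L/= /dir_lin summxE; apply: eq_bigr => i _; rewrite !mxE hdE//.
    exact: (nbhs_singleton (hd i)).
  apply: filterS => z H; apply: mx_norm_le => [|i j]; first by rewrite mulr_ge0// ltW.
  by rewrite !mxE; exact: (H (i, j)).
move: (@diff_unique R _ _ h L y Lc); set EO := (X in (X -> _) -> _) => dE.
have HEO : EO.
  apply/eqaddoP => e /E.
  rewrite (near_shift 0 y) subr0; apply: filterS => z /=.
  rewrite addrK -addrA -opprD; apply: le_trans.
  by rewrite lexx.
split; last by move=> v; rewrite (dE HEO).
by apply/diff_locallyP; rewrite (dE HEO).
Qed.

End C1Differentiable.

(** * Calculus of C^k maps *)

Section CkCalculus.
Context {R : realType} {n : nat}.
Local Notation V := 'cV[R]_n.
Implicit Types W : set V.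

Lemma near_open W (y : V) (P : V -> Prop) : open W -> W y ->
  (forall z, W z -> P z) -> \forall z \near y, P z.
Proof. by move=> oW Wy H; apply: (@filterS _ (nbhs y) _ W) => //; exact: open_nbhs_nbhs. Qed.

Lemma is_derive_add (U V' : normedModType R) (f g : U -> V') y v df dg :
  is_derive y v f df -> is_derive y v g dg ->
  is_derive y v (fun z => f z + g z) (df + dg).
Proof. exact: is_deriveD. Qed.

Lemma Ck_sub p q k W W' (h : V -> 'M[R]_(p, q)) :
  W' `<=` W -> Ck_on k W h -> Ck_on k W' h.
Proof.
move=> sW; elim: k h => [|k IH] h /=; first by move=> H y /sW; exact: H.
by move=> [H1 H2]; split=> [y v /sW|v]; [exact: H1|exact: IH].
Qed.

Lemma Ck_eq p q k W (h h' : V -> 'M[R]_(p, q)) : open W ->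
  (forall y, W y -> h y = h' y) -> Ck_on k W h -> Ck_on k W h'.
Proof.
move=> oW; elim: k h h' => [|k IH] h h' E /=.
  move=> H y Wy; rewrite /prop_for /continuous_at -E//.
  have := H y Wy; apply: cvg_trans; apply: (@near_eq_cvg _ _ (nbhs y)).
  by apply: filterS (open_nbhs_nbhs (conj oW Wy)) => z /E.
have nE y : W y -> \near y, h y = h' y.
  by move=> Wy; apply: filterS (open_nbhs_nbhs (conj oW Wy)) => z /E.
move=> [H1 H2]; split=> [y v Wy|v].
  by apply: near_eq_derivable (H1 y v Wy); exact: nE.
by apply: IH (H2 v) => y Wy; apply: near_eq_derive; exact: nE.
Qed.

Lemma Ck_is_derive p q k W (h : V -> 'M[R]_(p, q)) y v :
  Ck_on k.+1 W h -> W y -> is_derive y v h ('D_v h y).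
Proof. by move=> [H _] Wy; apply/derivableP/H. Qed.

Lemma Ck_intro p q k W (h : V -> 'M[R]_(p, q)) (dh : V -> V -> 'M[R]_(p, q)) :
  open W -> (forall y v, W y -> is_derive y v h (dh v y)) ->
  (forall v, Ck_on k W (dh v)) -> Ck_on k.+1 W h.
Proof.
move=> oW H1 H2; split=> [y v Wy|v]; first by have [] := H1 y v Wy.
by apply: Ck_eq (H2 v) => // y Wy; have [_ ->] := H1 y v Wy.
Qed.

Lemma C1_diff p q W (h : V -> 'M[R]_(p, q)) y :
  open W -> (forall z v, W z -> derivable h z v) ->
  (forall v, {for y, continuous ('D_v h)}) -> W y ->
  differentiable h y /\
  forall v, 'D_v h y = dir_lin (fun i => 'D_(ebasis R i) h y) v.
Proof.
move=> oW hd hc Wy.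
have [i|i|dh dhE] := @C1_differentiable R n p q h y.
- by apply: (near_open oW Wy) => z Wz; exact: hd.
- exact: hc.
by split=> // v; rewrite deriveE.
Qed.

Lemma Ck_pred p q k W (h : V -> 'M[R]_(p, q)) : open W ->
  Ck_on k.+1 W h -> Ck_on k W h.
Proof.
move=> oW; elim: k h => [|k IH] h; last first.
  by move=> [H1 H2]; split=> // v; apply: IH.
move=> [H1 H2] y Wy; apply: differentiable_continuous.
by have [] := C1_diff oW H1 (fun v => H2 v y Wy) Wy.
Qed.

Lemma Ck_C1 p q k W (h : V -> 'M[R]_(p, q)) : open W ->
  Ck_on k.+1 W h -> Ck_on 1 W h.
Proof. by move=> oW; elim: k => // k IH /Ck_pred-/(_ oW). Qed.

Lemma Ck_C0 p q k W (h : V -> 'M[R]_(p, q)) : open W ->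
  Ck_on k W h -> Ck_on 0 W h.
Proof. by move=> oW; elim: k => // k IH /Ck_pred-/(_ oW). Qed.

Lemma Ck_differentiable p q k W (h : V -> 'M[R]_(p, q)) y : open W ->
  Ck_on k.+1 W h -> W y -> differentiable h y.
Proof.
move=> oW /Ck_C1-/(_ oW)[H1 H2] Wy.
by have [] := C1_diff oW H1 (fun v => H2 v y Wy) Wy.
Qed.

Lemma Ck_deriveE p q k W (h : V -> 'M[R]_(p, q)) y v : open W ->
  Ck_on k.+1 W h -> W y ->
  'D_v h y = dir_lin (fun i => 'D_(ebasis R i) h y) v.
Proof.
move=> oW /Ck_C1-/(_ oW)[H1 H2] Wy.
by have [] := C1_diff oW H1 (fun v => H2 v y Wy) Wy.
Qed.

Lemma Ck_cst p q k W (a : 'M[R]_(p, q)) : open W -> Ck_on k W (fun _ => a).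
Proof.
move=> oW; elim: k a => [|k IH] a; first by move=> y _; exact: cst_continuous.
by apply: (@Ck_intro _ _ _ _ _ (fun _ _ => 0)).
Qed.

Lemma Ck_add p q k W (h h' : V -> 'M[R]_(p, q)) : open W ->
  Ck_on k W h -> Ck_on k W h' -> Ck_on k W (fun z => h z + h' z).
Proof.
move=> oW; elim: k h h' => [|k IH] h h' H H'.
  by move=> y Wy; apply: (@cvgD _ _ _ (nbhs y)); [exact: (H y Wy)|exact: (H' y Wy)].
apply: (@Ck_intro _ _ _ _ _ (fun v z => 'D_v h z + 'D_v h' z)) => //.
  by move=> y v Wy; apply: is_derive_add; [exact: (Ck_is_derive v H Wy)|exact: (Ck_is_derive v H' Wy)].
by move=> v; apply: IH; [exact: H.2|exact: H'.2].
Qed.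

Lemma Ck_lin p q p' q' (L : {linear 'M[R]_(p, q) -> 'M[R]_(p', q')}) k W
  (h : V -> 'M[R]_(p, q)) : open W ->
  Ck_on k W h -> Ck_on k W (fun z => L (h z)).
Proof.
move=> oW; elim: k h => [|k IH] h H.
  by move=> y Wy; apply: (@cvg_linear_mx _ _ (nbhs y)); exact: (H y Wy).
apply: (@Ck_intro _ _ _ _ _ (fun v z => L ('D_v h z))) => //.
  by move=> y v Wy; apply: is_derive_linear_mx; exact: (Ck_is_derive v H Wy).
by move=> v; apply: IH; exact: H.2.
Qed.

Lemma Ck_sum p q k W (I : Type) (r : seq I) (h : I -> V -> 'M[R]_(p, q)) :
  open W -> (forall i, Ck_on k W (h i)) ->
  Ck_on k W (fun z => \sum_(i <- r) h i z).
Proof.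
move=> oW H; elim: r => [|i r IH].
  by apply: (Ck_eq oW _ (Ck_cst k 0 oW)) => y _; rewrite big_nil.
by apply: (Ck_eq oW _ (Ck_add oW (H i) IH)) => y _; rewrite big_cons.
Qed.

Lemma Ck_mulmx p q s k W (A : V -> 'M[R]_(p, q)) (B : V -> 'M[R]_(q, s)) :
  open W -> Ck_on k W A -> Ck_on k W B -> Ck_on k W (fun z => A z *m B z).
Proof.
move=> oW; elim: k A B => [|k IH] A B HA HB.
  by move=> y Wy; apply: (@cvg_mulmx _ _ (nbhs y)); [exact: (HA y Wy)|exact: (HB y Wy)].
apply: (@Ck_intro _ _ _ _ _ (fun v z => 'D_v A z *m B z + A z *m 'D_v B z)) => //.
  by move=> y v Wy; apply: is_derive_mulmx; [exact: (Ck_is_derive v HA Wy)|exact: (Ck_is_derive v HB Wy)].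
move=> v; apply: Ck_add => //; apply: IH.
- exact: HA.2.
- exact: Ck_pred.
- exact: Ck_pred.
- exact: HB.2.
Qed.

Lemma Ck_scale N p q k W (a : V -> 'cV[R]_N) (i : 'I_N) (B : V -> 'M[R]_(p, q)) :
  open W -> Ck_on k W a -> Ck_on k W B -> Ck_on k W (fun z => a z i 0 *: B z).
Proof.
move=> oW Ha HB.
(* the i-th coordinate, as a scalar matrix *)
pose L := (dir_lin (fun k => (k == i)%:R *: 1%:M) : {linear 'cV[R]_N -> 'M[R]_p}).
apply: (Ck_eq oW _ (Ck_mulmx oW (Ck_lin L oW Ha) HB)) => y _.
rewrite /L/= /dir_lin (bigD1 i)//= big1 ?addr0 => [|j ji].
  by rewrite eqxx scale1r -scalemxAl mul1mx.
by rewrite (negbTE ji) scale0r scaler0.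
Qed.

Lemma is_derive_invmx (U : normedModType R) p (h : U -> 'M[R]_p) y v dh :
  {for y, continuous h} -> (\forall z \near y, h z \in unitmx) ->
  is_derive y v h dh ->
  is_derive y v (fun z => invmx (h z)) (- (invmx (h y) *m dh *m invmx (h y))).
Proof.
move=> hc hu [hd <-].
have E : (fun s : R => s^-1 *: (((fun z => invmx (h z)) \o shift y) (s *: v) - invmx (h y)))
    @ 0^' --> - (invmx (h y) *m 'D_v h y *m invmx (h y)).
  have C : (fun s : R => s *: v + y) @ 0^' --> y.
    rewrite -[X in _ --> X]add0r; apply: cvgD; last exact: cvg_cst.
    rewrite -[X in _ --> X](scale0r v); apply: cvgZ; last exact: cvg_cst.
    exact: nbhs_dnbhs.
  have Ci : (fun s : R => invmx (h (s *: v + y))) @ 0^' --> invmx (h y).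
    apply: (@cvg_invmx R R); first exact: (nbhs_singleton hu).
      exact: (C _ hu).
    exact: (cvg_comp _ _ C hc).
  have : (fun s : R => - (invmx (h (s *: v + y)) *m
       (s^-1 *: ((h \o shift y) (s *: v) - h y)) *m invmx (h y))) @ 0^'
     --> - (invmx (h y) *m 'D_v h y *m invmx (h y)).
    apply: cvgN; apply: cvg_mulmx; last exact: cvg_cst.
    exact: cvg_mulmx.
  apply: cvg_trans; apply: (@near_eq_cvg _ _ 0^').
  apply: (@filterS _ 0^' _ _ _ _ (C _ hu)) => s /= us.
  have uy := nbhs_singleton hu.
  rewrite -scalemxAr -scalemxAl -scalerN mulmxBr mulVmx// mulmxBl mul1mx.
  by rewrite -mulmxA mulmxV// mulmx1 opprB.
by split; [apply/cvg_ex; eexists; exact: E|apply: cvg_lim].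
Qed.

(** The derivative of an inverse is polynomial in the inverse itself, so the order
    of differentiability can be raised one step at a time. *)
Lemma Ck_inv p k W (h : V -> 'M[R]_p) : open W ->
  (forall y, W y -> h y \in unitmx) ->
  Ck_on k W h -> Ck_on k W (fun z => invmx (h z)).
Proof.
move=> oW hu.
have nu y : W y -> \forall z \near y, h z \in unitmx.
  by move=> Wy; apply: filterS (open_nbhs_nbhs (conj oW Wy)) => z /hu.
elim: k => [|k IH] H.
  by move=> y Wy; apply: (@cvg_invmx _ _ (nbhs y)); [exact: (hu y Wy)|exact: (nu y Wy)|exact: (H y Wy)].
apply: (@Ck_intro _ _ _ _ _ (fun v z => - (invmx (h z) *m 'D_v h z *m invmx (h z)))) => //.
  move=> y v Wy; apply: is_derive_invmx; [|exact: nu|exact: (Ck_is_derive v H Wy)].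
  exact: (Ck_C0 oW H).
have Hi := IH (Ck_pred oW H).
move=> v; apply: (Ck_lin (-%R)) => //.
by do 2![apply: Ck_mulmx => //]; exact: H.2.
Qed.

Lemma Ck_D p q k W (h : V -> 'M[R]_(p, q)) v : Ck_on k.+1 W h -> Ck_on k W ('D_v h).
Proof. by case=> _ /(_ v). Qed.

Lemma Ck_continuous p q k W (h : V -> 'M[R]_(p, q)) y : open W ->
  Ck_on k W h -> W y -> {for y, continuous h}.
Proof. by move=> oW /(Ck_C0 oW) H /H. Qed.

Lemma Ck_intro0 p q W (h : V -> 'M[R]_(p, q)) :
  (forall y, W y -> {for y, continuous h}) -> Ck_on 0 W h.
Proof. by []. Qed.

End CkCalculus.

Section ChainRule.
Context {R : realType} {n n' : nat}.

Lemma chain_rule p q k k' (W : set 'cV[R]_n) (W' : set 'cV[R]_n')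
    (h : 'cV[R]_n' -> 'M[R]_(p, q)) (t : 'cV[R]_n -> 'cV[R]_n') y v :
  open W -> open W' -> Ck_on k.+1 W t -> Ck_on k'.+1 W' h -> W y -> W' (t y) ->
  is_derive y v (h \o t) ('D_('D_v t y) h (t y)).
Proof.
move=> oW oW' Ht Hh Wy W'y.
have dt := Ck_differentiable oW Ht Wy.
have dh := Ck_differentiable oW' Hh W'y.
have dc : differentiable (h \o t) y by exact: differentiable_comp.
split; first exact: diff_derivable.
by rewrite !deriveE// diff_comp.
Qed.

Lemma Ck_comp p q k (W : set 'cV[R]_n) (W' : set 'cV[R]_n')
    (h : 'cV[R]_n' -> 'M[R]_(p, q)) (t : 'cV[R]_n -> 'cV[R]_n') :
  open W -> open W' -> (forall y, W y -> W' (t y)) ->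
  Ck_on k W t -> Ck_on k W' h -> Ck_on k W (h \o t).
Proof.
move=> oW oW' tW; elim: k h => [|k IH] h Ht Hh.
  move=> y Wy; apply: continuous_comp; first exact: Ht.
  by apply: Hh; exact: tW.
apply: (@Ck_intro _ _ _ _ _ _ _ (fun v y => \sum_i ('D_v t y) i 0 *: ('D_(ebasis R i) h \o t) y)) => //.
  move=> y v Wy; have := chain_rule v oW oW' Ht Hh Wy (tW _ Wy).
  by rewrite (Ck_deriveE _ oW' Hh (tW _ Wy)).
move=> v; apply: Ck_sum => // i; apply: Ck_scale => //; first exact: Ht.2.
by apply: IH; [exact: Ck_pred|exact: Hh.2].
Qed.

End ChainRule.

#[local] Opaque derive.

Section SymmetryOfSecondDerivatives.
Context {R : realType} {n : nat}.
Local Notation V := 'cV[R]_n.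

(** The mean value theorem, applied first along [v] and then along [u].  The
    difference on the left is symmetric in [u] and [v]; letting [s] tend to 0 then
    yields the symmetry of second derivatives. *)
Lemma second_difference p q (W : set V) (h : V -> 'M[R]_(p, q)) i j y u v (r s : R) :
  open W -> Ck_on 2 W h -> ball y r `<=` W -> 0 < s -> s * (`|u| + `|v|) < r ->
  exists2 z, ball y r z &
   h (s *: u + (s *: v + y)) i j - h (s *: v + y) i j - (h (s *: u + y) i j - h y i j)
     = s * (s * ('D_u ('D_v h) z) i j).
Proof.
move=> oW [H1 H2] bW s0 sr.
have Hb (a b : R) : 0 <= a <= 1 -> 0 <= b <= 1 ->
    ball y r (a *: (s *: u) + (b *: (s *: v) + y)).
  move=> /andP[a0 a1] /andP[b0 b1].
  rewrite mx_norm_ball /ball_/= distrC addrA addrK (le_lt_trans _ sr)//.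
  rewrite mulrDr (le_trans (ler_normD _ _))// lerD// !normrZ (gtr0_norm s0).
    by rewrite ger0_norm// ler_piMl// mulr_ge0// ltW.
  by rewrite ger0_norm// ler_piMl// mulr_ge0// ltW.
have b1 : is_true ((0 <= (1 : R)) && ((1 : R) <= 1)).
  by rewrite ler01 lexx.
have b0 : is_true ((0 <= (0 : R)) && ((0 : R) <= 1)).
  by rewrite ler01 lexx.
have D (w : V) (z : V) (a : R) : W z -> is_derive z (a *: w) (fun z => h z i j) (a * ('D_w h z) i j).
  move=> Wz; apply: is_derive_scale_dirR.
  by have /is_derive_mxP := derivableP (H1 z w Wz).
pose g z := h (s *: u + z) i j - h z i j.
have Dg (t : R) : 0 <= t <= 1 -> is_derive (t *: (s *: v) + y) (s *: v) g
   (s * ('D_v h (s *: u + (t *: (s *: v) + y))) i j - s * ('D_v h (t *: (s *: v) + y)) i j).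
  move=> t01; set z := _ + y.
  have W1 : W (s *: u + z) by apply: bW; have := Hb 1 t b1 t01; rewrite scale1r.
  have W2 : W z by apply: bW; have := Hb 0 t b0 t01; rewrite scale0r add0r.
  apply: is_deriveB; last exact: D.
  exact: (is_derive_translate (D v (s *: u + z) s W1)).
have [t t01] := @segment_MVT R V g y (s *: v) (fun t t01 => @ex_derive _ _ _ _ _ _ _ (Dg t t01)).
rewrite (@derive_val _ _ _ _ _ _ _ (Dg t t01)) /g => ->.
set z := t *: (s *: v) + y.
have D2 (a : R) : 0 <= a <= 1 -> is_derive (a *: (s *: u) + z) (s *: u)
    (fun z => ('D_v h z) i j) (s * ('D_u ('D_v h) (a *: (s *: u) + z)) i j).
  move=> a01; have [H3 _] := H2 v.
  have K := derivableP (H3 _ u (bW _ (Hb a t a01 t01))).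
  exact: (is_derive_scale_dirR s ((is_derive_mxP _ _ _ _).1 K i j)).
have [a a01] := @segment_MVT R V (fun z => ('D_v h z) i j) z (s *: u)
  (fun t t01 => @ex_derive _ _ _ _ _ _ _ (D2 t t01)).
rewrite (@derive_val _ _ _ _ _ _ _ (D2 a a01)) => E.
exists (a *: (s *: u) + z); first exact: Hb.
by rewrite -mulrBr E.
Qed.

Lemma dist_halves (a b c d e : R) : a = b ->
  `|c - a| <= e / 2 -> `|d - b| <= e / 2 -> `|c - d| <= e.
Proof.
move=> <- B1 B2; rewrite (splitr e) -(subrKA a).
by rewrite (le_trans (ler_normD _ _))// lerD// distrC.
Qed.

Lemma derive_comm p q (W : set V) (h : V -> 'M[R]_(p, q)) y u v :
  open W -> Ck_on 2 W h -> W y -> 'D_u ('D_v h) y = 'D_v ('D_u h) y.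
Proof.
move=> oW H Wy; apply/matrixP => i j; apply/eqP; rewrite -subr_eq0 -normr_le0.
apply/ler_addgt0Pr => e e0; rewrite add0r.
have e20 : 0 < e / 2 by rewrite divr_gt0.
have c a b : {for y, continuous ('D_a ('D_b h))} by case: H => _ /(_ b)[_ /(_ a)]; exact.
have : \forall z \near y, W z /\
    (`|'D_u ('D_v h) y - 'D_u ('D_v h) z| <= e/2 /\
     `|'D_v ('D_u h) y - 'D_v ('D_u h) z| <= e/2).
  apply: filterI; first exact: (open_nbhs_nbhs (conj oW Wy)).
  apply: filterI.
    by have /cvgrPdist_le/(_ _ e20) := c u v.
  by have /cvgrPdist_le/(_ _ e20) := c v u.
move=> /(nbhs_ballP y)[r /= r0 Hr].
have bW : ball y r `<=` W by move=> z /Hr[].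
have [s sE] : {s | s = r / (`|u| + `|v| + 1)} by eexists.
have p0 : 0 < `|u| + `|v| + 1 by rewrite ltr_wpDl// addr_ge0.
have s0 : 0 < s by rewrite sE divr_gt0.
have sr : s * (`|u| + `|v|) < r.
  by rewrite sE mulrAC ltr_pdivrMr// ltr_pM2l// ltrDl.
have [z /Hr[_ [Hz _]] Ez] := second_difference i j oW H bW s0 sr.
rewrite addrC in sr.
have [z' /Hr[_ [_ Hz']] Ez'] := second_difference i j oW H bW s0 sr.
have E : ('D_u ('D_v h) z) i j = ('D_v ('D_u h) z') i j.
  have sn : s != 0 by rewrite gt_eqF.
  suff /(mulfI sn)/(mulfI sn) : s * (s * ('D_u ('D_v h) z) i j) = s * (s * ('D_v ('D_u h) z') i j) by [].
  apply: etrans (esym Ez) _; apply: etrans _ Ez'.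
  have -> : s *: v + (s *: u + y) = s *: u + (s *: v + y) by rewrite addrCA.
  move: (h _ i j) (h _ i j) (h _ i j) (h _ i j) => a1 a2 a3 a4.
  by rewrite !opprB addrACA [RHS]addrACA [- a2 - a3]addrC.
have B1 : `|('D_u ('D_v h) y) i j - ('D_u ('D_v h) z) i j| <= e / 2.
  by have := le_trans (entry_le_mx_norm _ i j) Hz; rewrite mxE [X in _ + X]mxE.
have B2 : `|('D_v ('D_u h) y) i j - ('D_v ('D_u h) z') i j| <= e / 2.
  by have := le_trans (entry_le_mx_norm _ i j) Hz'; rewrite mxE [X in _ + X]mxE.
exact: dist_halves E B1 B2.
Qed.

End SymmetryOfSecondDerivatives.

(** * The Poincare lemma on a ball *)

Section MeanValueInequality.
Context {R : realType} {V : normedModType R}.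

Lemma mean_value_le p q (h : V -> 'M[R]_(p, q)) (y v : V) (K : R) : 0 <= K ->
  (forall t : R, 0 <= t <= 1 -> derivable h (t *: v + y) v /\
     `|'D_v h (t *: v + y)| <= K) ->
  `|h (v + y) - h y| <= K.
Proof.
move=> K0 H; apply: mx_norm_le => // i j.
have D (t : R) : 0 <= t <= 1 -> is_derive (t *: v + y) v (fun z => h z i j) (('D_v h (t *: v + y)) i j).
  by move=> /H[Hd _]; exact: ((is_derive_mxP _ _ _ _).1 (derivableP Hd) i j).
have [t t01] := @segment_MVT R V (fun z => h z i j) y v
  (fun t t01 => @ex_derive _ _ _ _ _ _ _ (D t t01)).
rewrite (@derive_val _ _ _ _ _ _ _ (D t t01)) => E.
rewrite mxE [X in `|_ + X|]mxE E.
by have [_] := H t t01; apply: le_trans; exact: entry_le_mx_norm.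
Qed.

Lemma is_derive_line0 (W : normedModType R) (h : V -> W) (y v : V) d :
  is_derive (0 : R) (1 : R) (fun s : R => h (s *: v + y)) d -> is_derive y v h d.
Proof.
have E : (fun s : R => s^-1 *: (((fun s : R => h (s *: v + y)) \o shift 0) (s *: (1:R)) - h ((0:R) *: v + y)))
   = (fun s => s^-1 *: ((h \o shift y) (s *: v) - h y)).
  apply/funext => s /=; rewrite scale0r add0r addr0.
  by rewrite [s *: 1]mulr1.
by move=> [Hd He]; split; [move: Hd; rewrite /derivable E|move: He; with_strategy transparent [derive] rewrite /derive E].
Qed.

End MeanValueInequality.

Section ParametricIntegral.
Context {R : realType}.
Local Notation mu := (@lebesgue_measure R).

(** Differentiation under the integral sign, then the fundamental theorem of
    calculus for the derivative at [s = 0], of which [FF] is a primitive. *)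
Lemma integral_param_derive (f g : R -> R -> R) (FF : R -> R) (d K : R) :
  0 < d ->
  (forall s t : R, `|s| < d -> 0 <= t <= 1 -> is_derive s (1 : R) (f^~ t) (g s t)) ->
  (forall s : R, `|s| < d -> {within `[0, 1], continuous (f s)}) ->
  (forall s t : R, `|s| < d -> 0 <= t <= 1 -> `|g s t| <= K) ->
  {within `[0, 1], continuous (g 0)} ->
  (forall t : R, 0 <= t <= 1 -> is_derive t (1 : R) FF (g 0 t)) ->
  is_derive (0 : R) (1 : R) (fun s => \int[mu]_(t in `[0, 1]) f s t) (FF 1 - FF 0).
Proof.
move=> d0 fg fc gK gc FFg.
have I0 : `]-d, d[%classic (0 : R) by rewrite /= in_itv/= oppr_lt0 d0.
have Id s : `]-d, d[%classic s -> `|s| < d by rewrite /= in_itv/= ltr_norml.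
have I1 (t : R) : `[0, 1]%classic t -> 0 <= t <= 1 by rewrite /= in_itv/=.
have K0 : 0 <= K.
  have b : (0 <= (0 : R)) && ((0 : R) <= 1) by rewrite ler01 lexx.
  by apply: le_trans (gK 0 0 _ b) => //; rewrite normr0.
have mI : measurable (`[0, 1]%classic : set R) by [].
have c01 : compact (`[0, 1]%classic : set R) by exact: segment_compact.
have H1 x : `]-d, d[%classic x -> mu.-integrable `[0, 1] (EFin \o f x).
  by move=> /Id xd; apply: continuous_compact_integrable => //; exact: fc.
have H2 x y : `]-d, d[%classic x -> `[0, 1]%classic y -> derivable (f^~ y) x 1.
  by move=> /Id xd /I1 y1; have [] := fg x y xd y1.
have H3 (x y : R) : `]-d, d[%classic x -> `[0, 1]%classic y -> partial1of2 f x y = g x y.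
  by move=> /Id xd /I1 y1; rewrite partial1of2E; have [_] := fg x y xd y1.
have H4 : mu.-integrable `[0, 1] (EFin \o cst K).
  by apply: continuous_compact_integrable => // x; exact: cvg_cst.
have H5 x y : `]-d, d[%classic x -> `[0, 1]%classic y -> `|partial1of2 f x y| <= cst K y.
  by move=> xd y1; rewrite H3//; apply: gK; [exact: Id|exact: I1].
have D := @derivable_under_integral R _ _ mu f _ mI 0 (- d) d I0 H1 H2 _ (fun _ => K0) H4 H5.
have := @differentiation_under_integral R _ _ mu f _ mI 0 (- d) d I0 H1 H2 _ (fun _ => K0) H4 H5.
rewrite derive1E => E; split=> //; rewrite E.
have -> : \int[mu]_(y in `[0, 1]) (partial1of2 f ^~ y) 0 = \int[mu]_(y in `[0, 1]) g 0 y.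
  by apply: eq_Rintegral => y; rewrite inE => y1; exact: H3.
have FFc (t : R) : 0 <= t <= 1 -> {for t, continuous FF}.
  by move=> /FFg[Hd _]; apply: differentiable_continuous; apply/derivable1_diffP.
rewrite /Rintegral (continuous_FTC2 ltr01 gc (F := FF)) //.
- split.
  + by move=> x; rewrite in_itv/= => /andP[/ltW a /ltW b]; have [] := FFg x; rewrite ?a.
  + by apply: cvg_at_right_filter; apply: FFc; rewrite lexx ler01.
  + by apply: cvg_at_left_filter; apply: FFc; rewrite lexx ler01.
- move=> x; rewrite in_itv/= => /andP[/ltW a /ltW b]; rewrite derive1E.
  by have [] := FFg x; rewrite ?a.
Qed.

End ParametricIntegral.

Section BallGeometry.
Context {R : realType} {n : nat}.
Local Notation V := 'cV[R]_n.

Lemma ball_normE (y0 y : V) r : ball y0 r y = (`|y - y0| < r) :> Prop.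
Proof. by rewrite mx_norm_ball /ball_/= distrC. Qed.

Lemma ball_segment (y0 y : V) (r t : R) : ball y0 r y -> 0 <= t <= 1 ->
  ball y0 r (t *: (y - y0) + y0).
Proof.
rewrite !ball_normE addrK => H /andP[t0 t1].
by apply: le_lt_trans H; rewrite normrZ ger0_norm// ler_piMl.
Qed.

End BallGeometry.

Section Poincare.
Context {R : realType} {n p q : nat}.
Local Notation V := 'cV[R]_n.
Local Notation mu := (@lebesgue_measure R).
Context (y0 : V) (r : R) (w : V -> V -> 'M[R]_(p, q)).
Let B := ball y0 r.
Hypothesis w_lin : forall y, linear (w^~ y).
Hypothesis w_C1 : forall X, Ck_on 1 B (w X).
Hypothesis w_closed : forall X Y y, B y -> 'D_Y (w X) y = 'D_X (w Y) y.

(** The homotopy operator of the Poincare lemma, for the 1-form [w]. *)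
Definition radial_primitive (z : V) : 'M[R]_(p, q) :=
  \matrix_(i, j) \int[mu]_(t in `[0, 1]) w (z - y0) (t *: (z - y0) + y0) i j.

(** Because [w] is closed, the derivative of the integrand in the direction [X] is
    the derivative in [t] of [t * w X (t u + y0)], with [u = y - y0]; its integral
    over [0, 1] is [w X y]. *)
Lemma radial_primitive_derive y X : B y -> is_derive y X radial_primitive (w X y).
Proof.
move=> By; apply/is_derive_mxP => i j; apply: is_derive_line0.
have oB : open B by exact: ball_open.
set u := y - y0.
have Ey : y = u + y0 by rewrite /u subrK.
have wD a b z : w (a + b) z = w a z + w b z.
  by have := w_lin z 1 a b; rewrite !scale1r.
have wZ a b z : w (a *: b) z = a *: w b z.
  have w0 : w 0 z = 0.
    have := w_lin z 1 0 0; rewrite !scale1r addr0 => /eqP.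
    by rewrite -subr_eq0 opprD addrA subrr sub0r oppr_eq0 => /eqP.
  by have := w_lin z a b 0; rewrite !addr0 w0 addr0.
pose P (s t : R) : V := t *: (s *: X + u) + y0.
pose f (s t : R) : R := (w u (P s t)) i j + s * (w X (P s t)) i j.
pose g (s t : R) : R := t * ('D_X (w u) (P s t)) i j +
   ((w X (P s t)) i j + s * (t * ('D_X (w X) (P s t)) i j)).
(* a small interval of s on which the segments stay in the ball *)
have [d d0 dB] : exists2 d : R, 0 < d & forall s : R, `|s| <= d -> B (s *: X + u + y0).
  have : \forall z \near y, B z by apply: (near_open oB By).
  move=> /(nbhs_ballP y)[e /= e0 He].
  exists (e / 2 / (`|X| + 1)).
    by rewrite divr_gt0// ?divr_gt0// ltr_wpDl.
  move=> s sd; apply: He; rewrite -addrA -Ey mx_norm_ball /ball_/= distrC addrK normrZ.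
  have X1 : 0 < `|X| + 1 by rewrite ltr_wpDl.
  apply: (@le_lt_trans _ _ (`|s| * (`|X| + 1))).
    by rewrite ler_wpM2l// lerDl.
  by rewrite (le_lt_trans (_ : _ <= e / 2))// -?ler_pdivlMr// ltr_pdivrMr// ltr_pMr// ltr1n.
have PB s t : `|s| <= d -> 0 <= t <= 1 -> B (P s t).
  by move=> sd t1; have := ball_segment (dB s sd) t1; rewrite addrK.
have ctsP (st : R * R) : {for st, continuous (fun st => P st.1 st.2)}.
  apply: (@cvgD _ _ _ (nbhs st)); last exact: cvg_cst.
  apply: (@cvgZ _ _ _ (nbhs st)); first exact: cvg_snd.
  apply: (@cvgD _ _ _ (nbhs st)); last exact: cvg_cst.
  by apply: (@cvgZ _ _ _ (nbhs st)); [exact: cvg_fst|exact: cvg_cst].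
have cts (h : V -> 'M[R]_(p, q)) (st : R * R) : Ck_on 0 B h -> `|st.1| <= d -> 0 <= st.2 <= 1 ->
    {for st, continuous (fun st => (h (P st.1 st.2)) i j)}.
  move=> hc s1 t1.
  apply: (@continuous_comp _ _ _ (fun st : R * R => P st.1 st.2) (fun z => h z i j)).
    exact: ctsP.
  apply: (@continuous_comp _ _ _ h (fun M : 'M[R]_(p, q) => M i j)).
    exact: (hc _ (PB _ _ s1 t1)).
  exact: coord_continuous.
have C0 X' : Ck_on 0 B (w X') by exact: Ck_pred.
have C0' X' Y : Ck_on 0 B ('D_Y (w X')) by exact: (w_C1 X').2.
have ctf (st : R * R) : `|st.1| <= d -> 0 <= st.2 <= 1 -> {for st, continuous (fun st => f st.1 st.2)}.
  move=> s1 t1; apply: (@cvgD _ _ _ (nbhs st)); first exact: cts.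
  by apply: (@cvgM _ _ (nbhs st)); [exact: cvg_fst|exact: cts].
have ctg (st : R * R) : `|st.1| <= d -> 0 <= st.2 <= 1 -> {for st, continuous (fun st => g st.1 st.2)}.
  move=> s1 t1; apply: (@cvgD _ _ _ (nbhs st)).
    by apply: (@cvgM _ _ (nbhs st)); [exact: cvg_snd|exact: (cts _ st (C0' u X) s1 t1)].
  apply: (@cvgD _ _ _ (nbhs st)); first exact: (cts _ st (C0 X) s1 t1).
  apply: (@cvgM _ _ (nbhs st)); first exact: cvg_fst.
  by apply: (@cvgM _ _ (nbhs st)); [exact: cvg_snd|exact: (cts _ st (C0' X X) s1 t1)].
have within (h : R -> R -> R) s : `|s| <= d ->
   (forall st : R * R, `|st.1| <= d -> 0 <= st.2 <= 1 -> {for st, continuous (fun st => h st.1 st.2)}) ->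
   {within `[0, 1], continuous (h s)}.
  move=> sd H; apply: continuous_in_subspaceT => t; rewrite inE/= in_itv/= => t1.
  apply: (@continuous_comp _ _ _ (fun t : R => (s, t)) (fun st => h st.1 st.2)).
    exact: (@cvg_pair _ _ _ (nbhs t) (nbhs s) (nbhs t) _ _ _ (cst s) id (cvg_cst s) cvg_id).
  exact: (H (s, t)).
have [K gK] : exists K : R, forall s t : R, `|s| < d -> 0 <= t <= 1 -> `|g s t| <= K.
  have cA : compact (`[- d, d]%classic `*` `[0, 1]%classic : set (R * R)).
    by apply: compact_setX; exact: segment_compact.
  have [||st _ H] := @compact_EVT_max _ R (fun st => `|g st.1 st.2|) _ _ cA.
  - exists (0, 0) => /=; split; rewrite in_itv/= ?lexx ?ler01//.
    by rewrite oppr_le0 ltW.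
  - apply: continuous_in_subspaceT => st; rewrite inE/= => -[]; rewrite !in_itv/= => s1 t1.
    apply: (@continuous_comp _ _ _ (fun st => g st.1 st.2) Num.norm).
      by apply: ctg => //; rewrite ler_norml.
    exact: norm_continuous.
  exists `|g st.1 st.2| => s t s1 t1; apply: (H (s, t)); rewrite inE/=.
  split; rewrite in_itv/=; last exact: t1.
  by rewrite -ler_norml ltW.
pose FF (t : R) := t * (w X (t *: u + y0)) i j.
have := @integral_param_derive R f g FF d K d0.
have P0 t : P 0 t = t *: u + y0 by rewrite /P scale0r add0r.
have n0 : `|0 : R| < d by rewrite normr0.
have -> : FF 1 - FF 0 = w X y i j.
  by rewrite /FF mul0r subr0 mul1r scale1r -Ey.
have -> : (fun s => \int[mu]_(t in `[0, 1]) f s t) =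
   (fun s : R => radial_primitive (s *: X + y) i j).
  apply/funext => s; rewrite mxE; apply: eq_Rintegral => t _.
  rewrite -[s *: X + y - y0]addrA -/u wD wZ -/(P s t) /f.
  by rewrite mxE [X in _ = X + _]mxE addrC.
apply.
- move=> s t /ltW s1 t1.
  have E s' : P s' t = s' *: (t *: X) + (t *: u + y0).
    by rewrite /P scalerDr scalerA mulrC -scalerA addrA.
  have D (h : V -> 'M[R]_(p, q)) : Ck_on 1 B h ->
     is_derive s (1 : R) (fun s => (h (P s t)) i j) (t * ('D_X h (P s t)) i j).
    move=> Hh.
    have Hd : is_derive (P s t) (t *: X) (fun z => h z i j) (t * ('D_X h (P s t)) i j).
      apply: is_derive_scale_dirR.
      exact: ((is_derive_mxP _ _ _ _).1 (Ck_is_derive X Hh (PB _ _ s1 t1)) i j).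
    rewrite E in Hd; have [dd de] := Hd; rewrite E.
    have := is_derive_line dd; rewrite de.
    by under eq_fun do rewrite -E.
  rewrite /g; apply: is_derive_add; first exact: D.
  apply: (is_derive_eq (is_derive_mulr (is_derive_id s 1) (D _ (w_C1 X)))).
  by rewrite mul1r.
- by move=> s /ltW s1; apply: within.
- exact: gK.
- by apply: within => //; exact: ltW.
- move=> t t1; have B1 : B (t *: u + y0) by rewrite -P0; apply: PB => //; exact: ltW.
  have [Hd He] := (is_derive_mxP _ _ _ _).1 (Ck_is_derive u (w_C1 X) B1) i j.
  have := is_derive_line Hd; rewrite He => Hl.
  apply: (is_derive_eq (is_derive_mulr (is_derive_id t 1) Hl)).
  by rewrite mul1r /g P0 mul0r addr0 addrC w_closed.
Qed.

End Poincare.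

(** * A linear Frobenius theorem *)

#[local] Opaque derive Ck_on.

Section BallSegments.
Context {R : realType} {n : nat}.
Local Notation V := 'cV[R]_n.

Lemma ball_mean_value p q (y0 : V) (r K : R) (h : V -> 'M[R]_(p, q)) (y : V) :
  0 <= K -> ball y0 r y ->
  (forall z, ball y0 r z -> derivable h z (y - y0) /\ `|'D_(y - y0) h z| <= K) ->
  `|h y - h y0| <= K.
Proof.
move=> K0 By H.
have := @mean_value_le R V p q h y0 (y - y0) K K0; rewrite subrK; apply.
by move=> t t01; apply: H; exact: ball_segment.
Qed.

(** Uniqueness for linear total differential systems.  On the segment from [y0] to
    [y], the maximum N of the norm of [h] satisfies [N <= K r N] by the mean value
    inequality, so it vanishes. *)
Lemma contraction_zero p q (y0 : V) (r K : R) (h : V -> 'M[R]_(p, q)) :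
  0 <= K -> K * r < 1 -> h y0 = 0 ->
  (forall y, ball y0 r y -> {for y, continuous h}) ->
  (forall y X, ball y0 r y -> derivable h y X /\ `|'D_X h y| <= K * `|X| * `|h y|) ->
  forall y, ball y0 r y -> h y = 0.
Proof.
move=> K0 Kr h0 hc hd y By; set u := y - y0.
have Bt (t : R) : 0 <= t <= 1 -> ball y0 r (t *: u + y0) by move=> ?; exact: ball_segment.
pose N (t : R) : R := `|h (t *: u + y0)|.
have I1 : (`[0, 1]%classic : set R) !=set0 by exists 0; rewrite /= in_itv/= lexx ler01.
have [|c c01 cmax] := @compact_EVT_max _ R N _ I1 (@segment_compact R 0 1).
  apply: continuous_in_subspaceT => t; rewrite inE/= in_itv/= => t1.
  apply: (@continuous_comp _ _ _ (fun t : R => h (t *: u + y0)) Num.norm); last exact: norm_continuous.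
  apply: (@continuous_comp _ _ _ (fun t : R => t *: u + y0) h); last exact: hc (Bt _ t1).
  apply: (@cvgD _ _ _ (nbhs t)); last exact: cvg_cst.
  by apply: (@cvgZ _ _ _ (nbhs t)); [exact: cvg_id|exact: cvg_cst].
move: c01; rewrite inE/= in_itv/= => c01.
have ur : `|u| < r by rewrite -ball_normE.
have Ku : K * `|u| < 1 by apply: le_lt_trans Kr; rewrite ler_wpM2l// ltW.
have Nc : N c <= K * `|u| * N c.
  have := @mean_value_le R V p q h y0 (c *: u) (K * `|u| * N c).
  rewrite h0 subr0; apply; first by apply: mulr_ge0; [exact: mulr_ge0|exact: normr_ge0].
  move=> t /andP[t0 t1]; have /andP[c0 c1] := c01.
  have tc : 0 <= t * c <= 1 by rewrite mulr_ge0//= mulr_ile1.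
  rewrite scalerA; have [Hd He] := hd _ (c *: u) (Bt _ tc); split=> //.
  apply: le_trans He _; rewrite ler_pM// ?mulr_ge0//.
    by rewrite ler_wpM2l// normrZ ger0_norm// ler_piMl.
  by apply: cmax; rewrite inE/= in_itv.
have Nc0 : N c <= 0.
  rewrite leNgt; apply/negP => Np.
  have : K * `|u| * N c < N c by rewrite gtr_pMl.
  by move=> /(le_lt_trans Nc); rewrite ltxx.
apply/eqP; rewrite -normr_le0; apply: le_trans Nc0.
have := cmax 1; rewrite /N scale1r subrK; apply.
by rewrite inE/= in_itv/= ler01 lexx.
Qed.

End BallSegments.

Section UniformLimit.
Context {R : realType} {n p q : nat}.
Local Notation V := 'cV[R]_n.

(** The mean value inequality for [h k - t dl] bounds the difference quotient of
    [h k] uniformly in [k], and the bound passes to the limit. *)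
Lemma is_derive_lim (W : set V) (h : nat -> V -> 'M[R]_(p, q)) (l : V -> 'M[R]_(p, q))
   (dh : nat -> V -> 'M[R]_(p, q)) (dl : V -> 'M[R]_(p, q)) (X : V) (e : nat -> R) :
  open W -> e @ \oo --> 0 ->
  (forall k y, W y -> is_derive y X (h k) (dh k y)) ->
  (forall k y, W y -> `|h k y - l y| <= e k) ->
  (forall k y, W y -> `|dh k y - dl y| <= e k) ->
  (forall y, W y -> {for y, continuous dl}) ->
  forall y, W y -> is_derive y X l (dl y).
Proof.
move=> oW e0 hd hl dhl dlc y Wy.
have E : (fun s : R => s^-1 *: ((l \o shift y) (s *: X) - l y)) @ 0^' --> dl y.
  apply/cvgrPdist_le => eps eps0.
  have C : (fun s : R => s *: X + y) @ (0 : R) --> y.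
    rewrite -[X in _ --> X]add0r; apply: cvgD; last exact: cvg_cst.
    by rewrite -[X in _ --> X](scale0r X); apply: cvgZ; [exact: cvg_id|exact: cvg_cst].
  have : \forall z \near y, W z /\ `|dl y - dl z| <= eps.
    apply: filterI; first exact: (near_open oW Wy).
    by have /cvgrPdist_le/(_ _ eps0) := dlc y Wy.
  move=> /C /(nbhs_ballP (0 : R))[d /= d0 Hd].
  apply/(nbhs_ballP (0 : R)); exists d => //= s sd s0.
  have Hs (t : R) : 0 <= t <= 1 -> W ((t * s) *: X + y) /\ `|dl y - dl ((t * s) *: X + y)| <= eps.
    move=> /andP[t0 t1]; apply: Hd; move: sd; rewrite /ball/= !sub0r !normrN.
    by apply: le_lt_trans; rewrite normrM ger0_norm// ler_piMl.
  have key k : `|h k (s *: X + y) - h k y - s *: dl y| <= `|s| * (e k + eps).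
    pose F (t : R) : 'M[R]_(p, q) := h k (t *: X + y) - t *: dl y.
    have ek : 0 <= e k by apply: le_trans (hl k y Wy).
    have := @mean_value_le R R p q F 0 s (`|s| * (e k + eps)).
    rewrite /F scale0r add0r scale0r subr0 addr0 addrAC; apply.
      by rewrite mulr_ge0// addr_ge0// ltW.
    move=> t t01; have [Wt dt] := Hs t t01.
    rewrite addr0 [t *: s]/(t * s).
    have D1 : is_derive (t * s) (1 : R) F (dh k ((t * s) *: X + y) - dl y).
      apply: is_deriveB.
        have [H1 H2] := hd k _ Wt.
        by have := is_derive_line H1; rewrite H2.
      apply/is_derive_mxP => i j.
      rewrite (_ : (fun _ => _) = (fun z : R => z * dl y i j)); last first.
        by apply/funext => z; rewrite mxE.
      apply: (is_derive_eq (is_derive_mulr (is_derive_id _ _) (is_derive_cst _ _ _))).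
      by rewrite mul1r mulr0 addr0.
    have D2 := is_derive_scale_dir s D1.
    rewrite [s *: 1]mulr1 in D2; have [D3 D4] := D2.
    split=> //; rewrite D4 normrZ ler_wpM2l//.
    rewrite -(subrKA (dl ((t * s) *: X + y))) (le_trans (ler_normD _ _))// lerD//.
      exact: dhl.
    by rewrite distrC.
  have W1 : W (s *: X + y) by have [|] := Hs 1; rewrite ?mul1r// ler01 lexx.
  have bound : `|l (s *: X + y) - l y - s *: dl y| <= `|s| * eps.
    apply/ler_addgt0Pr => d' d'0.
    have c3 : (fun k => e k *+ 2 + `|s| * e k) @ \oo --> 0.
      rewrite -[X in _ --> X](_ : 0 *+ 2 + `|s| * 0 = 0); last by rewrite mul0rn mulr0 addr0.
      apply: cvgD; last by apply: cvgM => //; exact: cvg_cst.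
      by rewrite -mulr_natr; under eq_fun do rewrite -mulr_natr; apply: cvgM => //; exact: cvg_cst.
    have /cvgrPdist_le/(_ _ d'0)[k _ /(_ k (leqnn k))] := c3.
    rewrite sub0r normrN => /(le_trans (ler_norm _)) Hk.
    have -> : l (s *: X + y) - l y - s *: dl y =
      (h k (s *: X + y) - h k y - s *: dl y) + ((h k y - l y) - (h k (s *: X + y) - l (s *: X + y))).
      move: (l (s *: X + y)) (l y) (h k (s *: X + y)) (h k y) (s *: dl y) => a b c d1 f.
      rewrite opprB -!addrA; apply/esym; rewrite [RHS]addrC.
      by apply/matrixP => i j; rewrite !mxE; ring.
    apply: le_trans (ler_normD _ _) _.
    apply: (@le_trans _ _ (`|s| * (e k + eps) + e k *+ 2)).
      apply: lerD; first exact: key.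
      by apply: le_trans (ler_normB _ _) _; rewrite mulr2n lerD// hl.
    by rewrite mulrDr addrAC addrC lerD2l addrC.
  have -> : dl y - s^-1 *: ((l \o shift y) (s *: X) - l y) =
     - (s^-1 *: (l (s *: X + y) - l y - s *: dl y)).
    by rewrite /= [in RHS]scalerBr scalerA mulVf// scale1r opprB.
  rewrite normrN normrZ normfV ler_pdivrMl ?normr_gt0//.
by split; [apply/cvg_ex; eexists; exact: E|with_strategy transparent [derive] apply: cvg_lim].
Qed.

Lemma continuous_lim (W : set V) (h : nat -> V -> 'M[R]_(p, q)) (l : V -> 'M[R]_(p, q))
   (e : nat -> R) :
  open W -> e @ \oo --> 0 ->
  (forall k y, W y -> {for y, continuous (h k)}) ->
  (forall k y, W y -> `|h k y - l y| <= e k) ->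
  forall y, W y -> {for y, continuous l}.
Proof.
move=> oW e0 hc hl y Wy; apply/(@cvgrPdist_le _ _ _ (nbhs y)) => eps eps0.
have e3 : 0 < eps / 3 by rewrite divr_gt0.
have /cvgrPdist_le/(_ _ e3)[k _ /(_ k (leqnn k))] := e0.
rewrite sub0r normrN => /(le_trans (ler_norm _)) Hk.
have : \forall z \near y, W z /\ `|h k y - h k z| <= eps / 3.
  apply: filterI; first exact: (near_open oW Wy).
  by have /cvgrPdist_le/(_ _ e3) := hc k y Wy.
apply: filterS => z [Wz Hz].
have -> : l y - l z = (h k y - h k z) + ((h k z - l z) - (h k y - l y)).
  by apply/matrixP => i j; rewrite !mxE; ring.
have -> : eps = eps / 3 + (eps / 3 + eps / 3) by field.
apply: le_trans (ler_normD _ _) _; apply: lerD => //.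
apply: le_trans (ler_normB _ _) _; apply: lerD.
  exact: le_trans (hl k z Wz) Hk.
exact: le_trans (hl k y Wy) Hk.
Qed.

Lemma geometric_cvg (h : nat -> 'M[R]_(p, q)) (C : R) :
  (forall k, `|h k.+1 - h k| <= C * 2^-1 ^+ k) ->
  exists l, forall k, `|h k - l| <= C * 2 * 2^-1 ^+ k.
Proof.
move=> H.
have tail k m : `|h (k + m)%N - h k| <= C * 2 * 2^-1 ^+ k * (1 - 2^-1 ^+ m).
  elim: m => [|m IH]; first by rewrite addn0 subrr normr0 expr0 subrr mulr0.
  rewrite addnS -(subrKA (h (k + m)%N)) (le_trans (ler_normD _ _))//.
  apply: le_trans (lerD (H _) IH) _; rewrite exprD exprS.
  by rewrite le_eqVlt; apply/orP; left; apply/eqP; field.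
have C0 : 0 <= C by have := H 0%N; rewrite expr0 mulr1; apply: le_trans.
have tail' k m : `|h (k + m)%N - h k| <= C * 2 * 2^-1 ^+ k.
  apply: le_trans (tail k m) _; rewrite ler_piMr// ?mulr_ge0// ?exprn_ge0//.
have z0 : (fun k => C * 2 * 2^-1 ^+ k) @ \oo --> 0.
  rewrite -(mulr0 (C * 2)); apply: cvgM; first exact: cvg_cst.
  by apply: cvg_expr; rewrite ger0_norm// invf_lt1// ltr1n.
have cv : cvg (h @ \oo).
  apply/cauchy_cvgP/cauchyP => e e0.
  have /cvgrPdist_lt/(_ _ e0)[k _ /(_ k (leqnn k))] := z0.
  rewrite sub0r normrN => /(le_lt_trans (ler_norm _)) Hk.
  exists (h k); exists k => // m /= km.
  by rewrite mx_norm_ball /ball_/= distrC -(subnKC km) (le_lt_trans (tail' _ _)).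
exists (lim (h @ \oo)) => k; apply/ler_addgt0Pr => e e0.
have /cvgrPdist_le/(_ _ e0)[N _ /(_ (k + N)%N (leq_addl _ _))] := cv.
move=> HN; rewrite -(subrKA (h (k + N)%N)) (le_trans (ler_normD _ _))// lerD//.
  by rewrite distrC.
by rewrite distrC.
Qed.

End UniformLimit.

Section Frobenius.
Context {R : realType} {n p q : nat}.
Local Notation V := 'cV[R]_n.
Context (y0 : V) (r K : R) (th : V -> V -> 'M[R]_p) (J : 'M[R]_p) (Lam : 'M[R]_q).
Let B := ball y0 r.
Let L (M : 'M[R]_(p, q)) : 'M[R]_(p, q) := J *m M - M *m Lam.
Hypothesis K0 : 0 <= K.
Hypothesis Kr : K * r <= 2^-1.
Hypothesis r0 : 0 < r.
Hypothesis th_lin : forall y, linear (th^~ y).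
Hypothesis th_smooth : forall k X, Ck_on k B (th X).
Hypothesis th_closed : forall X Y y, B y -> 'D_Y (th X) y = 'D_X (th Y) y.
Hypothesis th_comm : forall X Y y, B y -> th X y *m th Y y = th Y y *m th X y.
Hypothesis th_J : forall X y, B y -> th X y *m J = J *m th X y.
Hypothesis th_bound : forall X y M, B y -> `|th X y *m L M| <= K * `|X| * `|M|.

Let oB : open B. Proof. exact: ball_open. Qed.

Lemma frobenius_L_sub M N : L (M - N) = L M - L N.
Proof. by rewrite /L mulmxBr mulmxBl !opprD !opprK addrACA. Qed.

Lemma frobenius_L_th X y M : B y -> L (th X y *m M) = th X y *m L M.
Proof. by move=> By; rewrite /L mulmxBr !mulmxA th_J. Qed.

Lemma frobenius_L_Ck k (E : V -> 'M[R]_(p, q)) : Ck_on k B E -> Ck_on k B (fun y => L (E y)).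
Proof.
move=> H; apply: Ck_add => //; first by apply: Ck_mulmx => //; exact: Ck_cst.
apply: (Ck_lin (-%R)) => //.
by apply: Ck_mulmx => //; exact: Ck_cst.
Qed.

(** The section with value [E0] at [y0] and derivative [theta_X L(E)], as soon as
    this form is closed. *)
Definition picard_step (E0 : 'M[R]_(p, q)) (E : V -> 'M[R]_(p, q)) : V -> 'M[R]_(p, q) :=
  let prim := radial_primitive y0 (fun X y => th X y *m L (E y)) in
  fun y => prim y + (E0 - prim y0).

Definition picard_iter (E0 : 'M[R]_(p, q)) (k : nat) : V -> 'M[R]_(p, q) :=
  iter k (picard_step E0) (fun=> E0).

(** The form [theta_X L(E)] is closed: theta is, and differentiating [L(E)] produces
    [theta_Y theta_X L(G)], symmetric because theta commutes with itself and with
    L.  That the derivative of [E] has the shape [theta_X G] is essential here, and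
    it is inherited by the next iterate with [G = L(E)]. *)
Lemma picard_step_derive E0 E :
  (exists2 G, Ck_on 1 B G & forall y X, B y -> is_derive y X E (th X y *m G y)) ->
  forall y X, B y -> is_derive y X (picard_step E0 E) (th X y *m L (E y)).
Proof.
move=> [G G1 HE] y X By.
have E1 : Ck_on 1 B E.
  apply: (@Ck_intro _ _ _ _ _ _ _ (fun X y => th X y *m G y)) => // Y.
  by apply: Ck_mulmx => //; exact: Ck_pred.
have w1 Y : Ck_on 1 B (fun y => th Y y *m L (E y)).
  exact: (Ck_mulmx oB (th_smooth 1 Y) (frobenius_L_Ck E1)).
have wl z : linear (fun X => th X z *m L (E z)).
  by move=> a u v; rewrite (th_lin z) mulmxDl scalemxAl.
have DL z Y : B z -> is_derive z Y (fun z => L (E z)) (L (th Y z *m G z)).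
  move=> Bz; apply: is_derive_add.
    apply: (is_derive_eq (is_derive_mulmx (is_derive_cst J z Y) (HE z Y Bz))).
    by rewrite mul0mx add0r.
  apply: (is_derive_linear_mx (-%R)).
  apply: (is_derive_eq (is_derive_mulmx (HE z Y Bz) (is_derive_cst Lam z Y))).
  by rewrite mulmx0 addr0.
have wc Y Z z : B z -> 'D_Z (fun y => th Y y *m L (E y)) z = 'D_Y (fun y => th Z y *m L (E y)) z.
  move=> Bz.
  have D Y1 Y2 : 'D_Y2 (fun y => th Y1 y *m L (E y)) z =
     'D_Y2 (th Y1) z *m L (E z) + th Y1 z *m th Y2 z *m L (G z).
    have [_ ->] := is_derive_mulmx (Ck_is_derive Y2 (th_smooth 1 Y1) Bz) (DL z Y2 Bz).
    by rewrite frobenius_L_th// mulmxA.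
  by rewrite !D th_closed// th_comm.
have := radial_primitive_derive wl w1 wc X By.
move=> H; apply: (is_derive_eq (is_derive_add H (is_derive_cst _ _ _))).
by rewrite addr0.
Qed.

Lemma picard_step0 E0 E : picard_step E0 E y0 = E0.
Proof. by rewrite /picard_step addrC subrK. Qed.

#[local] Opaque picard_step.

Lemma picard_iter_derive E0 k y X : B y ->
  is_derive y X (picard_iter E0 k.+1) (th X y *m L (picard_iter E0 k y)).
Proof.
move=> By; rewrite /picard_iter iterS; apply: picard_step_derive => //.
elim: k => [|k [G G1 HG]].
  exists (fun=> 0); first exact: Ck_cst.
  by move=> z Y _; rewrite mulmx0; exact: is_derive_cst.
exists (fun y => L (picard_iter E0 k y)); last first.
  by move=> z Y Bz; rewrite iterS; apply: picard_step_derive => //; exists G.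
apply: frobenius_L_Ck.
apply: (@Ck_intro _ _ _ _ _ _ _ (fun X y => th X y *m G y)) => // Y.
by apply: Ck_mulmx => //; exact: Ck_pred.
Qed.

Lemma picard_iter0 E0 k : picard_iter E0 k y0 = E0.
Proof. by case: k => // k; rewrite /picard_iter iterS picard_step0. Qed.

#[local] Opaque picard_iter.

(** Consecutive iterates agree at [y0] and, on the ball, [K r <= 1/2] halves their
    distance at each step. *)
Lemma picard_contract E0 k y : B y ->
  `|picard_iter E0 k.+1 y - picard_iter E0 k y| <= `|E0| * 2^-1 ^+ k.
Proof.
have key (C : R) y' : 0 <= C -> B y' -> K * `|y' - y0| * C <= C * 2^-1.
  move=> C0; rewrite /B ball_normE => yr; rewrite mulrC ler_wpM2l//.
  by apply: le_trans Kr; rewrite ler_wpM2l// ltW.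
elim: k y => [|k IH] y By.
  have := @ball_mean_value R n p q y0 r (K * `|y - y0| * `|E0|) (picard_iter E0 1) y.
  rewrite picard_iter0 expr0 mulr1 => H; apply: le_trans (H _ By _) _.
  - by apply: mulr_ge0 => //; exact: mulr_ge0.
  - move=> z Bz; have [H1 H2] := picard_iter_derive E0 0 (y - y0) Bz.
    by split=> //; rewrite H2; exact: th_bound.
  - apply: le_trans (key _ _ _ By) _ => //.
    by rewrite ler_piMr// invf_le1// ler1n.
have C0 : 0 <= `|E0| * 2^-1 ^+ k by rewrite mulr_ge0// exprn_ge0.
have A1 : 0 <= K * `|y - y0| * (`|E0| * 2^-1 ^+ k).
  by apply: mulr_ge0 => //; exact: mulr_ge0.
have A2 z : B z ->
   derivable (picard_iter E0 k.+2 - picard_iter E0 k.+1) z (y - y0) /\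
   `|'D_(y - y0) (picard_iter E0 k.+2 - picard_iter E0 k.+1) z| <=
     K * `|y - y0| * (`|E0| * 2^-1 ^+ k).
  move=> Bz; have [H1 H2] := is_deriveB (picard_iter_derive E0 k.+1 (y - y0) Bz)
     (picard_iter_derive E0 k (y - y0) Bz).
  split; first exact: H1.
  rewrite H2 -mulmxBr -frobenius_L_sub.
  apply: (le_trans (th_bound (y - y0) (picard_iter E0 k.+1 z - picard_iter E0 k z) Bz)).
  by apply: ler_wpM2l; [exact: mulr_ge0|exact: IH].
have H := ball_mean_value A1 By A2.
have E1 : (picard_iter E0 k.+2 - picard_iter E0 k.+1) y0 = 0.
  by rewrite -[LHS]/(picard_iter E0 k.+2 y0 - picard_iter E0 k.+1 y0) !picard_iter0 subrr.
rewrite E1 subr0 in H; apply: (le_trans H).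
by apply: (le_trans (key _ _ C0 By)); rewrite exprSr mulrA.
Qed.

Lemma picard_iter_C1 E0 k : Ck_on 1 B (picard_iter E0 k).
Proof.
elim: k => [|k IH]; first exact: Ck_cst.
apply: (@Ck_intro _ _ _ _ _ _ _ (fun X y => th X y *m L (picard_iter E0 k y))) => //.
  by move=> z X Bz; exact: picard_iter_derive.
by move=> X; apply: (Ck_pred oB); exact: (Ck_mulmx oB (th_smooth 1 X) (frobenius_L_Ck IH)).
Qed.

(** The iterates and their derivatives converge geometrically, uniformly on the
    ball; smoothness of the limit then follows from the equation itself. *)
Theorem linear_frobenius (E0 : 'M[R]_(p, q)) :
  exists2 E : V -> 'M[R]_(p, q), E y0 = E0 &
    (forall k, Ck_on k B E) /\
    (forall y X, B y -> is_derive y X E (th X y *m (J *m E y - E y *m Lam))).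
Proof.
have /choice[E HE] : forall y, exists l, B y ->
   forall k, `|picard_iter E0 k y - l| <= `|E0| * 2 * 2^-1 ^+ k.
  move=> y; have [By|nB] := pselect (B y); last by exists 0.
  have [l Hl] := geometric_cvg (fun k => picard_contract E0 k By).
  by exists l.
have z0 (C : R) : (fun k => C * 2^-1 ^+ k) @ \oo --> 0.
  rewrite -(mulr0 C); apply: cvgM; first exact: cvg_cst.
  by apply: cvg_expr; rewrite ger0_norm// invf_lt1// ltr1n.
have h0 k : 0 <= 2^-1 ^+ k :> R by rewrite exprn_ge0.
have Ec : forall y, B y -> {for y, continuous E}.
  apply: (continuous_lim oB (z0 (`|E0| * 2)) (h := picard_iter E0)) => k y By.
    exact: (Ck_continuous oB (picard_iter_C1 E0 k) By).
  exact: HE.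
have ED : forall y X, B y -> is_derive y X E (th X y *m L (E y)).
  move=> y X By; set C := `|E0| * 2 * (1 + K * `|X|).
  have KX : 0 <= K * `|X| by rewrite mulr_ge0.
  have E00 : 0 <= `|E0| * 2 by rewrite mulr_ge0.
  have D1 k z : B z -> is_derive z X (picard_iter E0 k.+1) (th X z *m L (picard_iter E0 k z)).
    by move=> Bz; exact: picard_iter_derive.
  have D2 k z : B z -> `|picard_iter E0 k.+1 z - E z| <= C * 2^-1 ^+ k.
    move=> Bz; apply: (le_trans (HE z Bz k.+1)).
    have : 2^-1 ^+ k.+1 <= 2^-1 ^+ k :> R by rewrite exprS ler_piMl// invf_le1// ler1n.
    move=> /(ler_wpM2l E00) /le_trans; apply.
    by rewrite ler_wpM2r// /C ler_peMr// lerDl.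
  have D3 k z : B z -> `|th X z *m L (picard_iter E0 k z) - th X z *m L (E z)| <= C * 2^-1 ^+ k.
    move=> Bz; rewrite -mulmxBr -frobenius_L_sub.
    apply: (le_trans (th_bound X (picard_iter E0 k z - E z) Bz)).
    apply: (le_trans (ler_wpM2l KX (HE z Bz k))).
    by rewrite mulrA ler_wpM2r// /C mulrC ler_wpM2l// lerDr.
  have D4 z : B z -> {for z, continuous (fun z => th X z *m L (E z))}.
    move=> Bz; have H : Ck_on 0 B (fun z => th X z *m L (E z)).
      apply: Ck_mulmx => //; apply: frobenius_L_Ck; exact: Ck_intro0.
    exact: (Ck_continuous oB H Bz).
  exact: (is_derive_lim oB (z0 C) D1 D2 D3 D4 By).
exists E.
  apply/eqP; rewrite -subr_eq0 -normr_le0; apply/ler_addgt0Pr => e e0; rewrite add0r.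
  have /cvgrPdist_le/(_ _ e0)[k _ /(_ k (leqnn k))] := z0 (`|E0| * 2).
  rewrite sub0r normrN => /(le_trans (ler_norm _)); apply: le_trans.
  have B0 : B y0 by exact: ballxx.
  by have := HE y0 B0 k; rewrite picard_iter0 distrC.
split=> //; elim=> [|k IH]; first exact: Ck_intro0.
apply: (@Ck_intro _ _ _ _ _ _ _ (fun X y => th X y *m L (E y))) => // X.
by apply: Ck_mulmx => //; exact: frobenius_L_Ck.
Qed.

End Frobenius.

(** * The Sylvester equation and the invertibility of Omega *)

Section Sylvester.

Lemma char_poly_trmx (F : fieldType) n (A : 'M[F]_n) : char_poly A^T = char_poly A.
Proof.
rewrite /char_poly -[in RHS]det_tr; congr (\det _); apply/matrixP => i j.
by rewrite !mxE eq_sym.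
Qed.

Lemma eigenvalue_trmx (F : fieldType) n (A : 'M[F]_n) a :
  eigenvalue A^T a = eigenvalue A a.
Proof. by rewrite eigenvalue_root_char char_poly_trmx -eigenvalue_root_char. Qed.

Lemma intertwine_horner (F : fieldType) n (A B Y : 'M[F]_n.+1) (q : {poly F}) :
  Y *m A = B *m Y -> Y *m horner_mx A q = horner_mx B q *m Y.
Proof.
have Z C : horner_mx C 0 = 0 :> 'M[F]_(n.+1, n.+1) by exact: raddf0.
move=> H; elim/poly_ind: q => [|q c IH]; first by rewrite !Z mulmx0 mul0mx.
rewrite !(rmorphD, rmorphM)/= !horner_mx_X !horner_mx_C -!mulmxE mulmxDr mulmxDl.
by rewrite mulmxA IH -!mulmxA H scalar_mxC.
Qed.

(** The characteristic polynomials p of A and q of B are coprime, say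
    [u p + v q = 1].  Evaluating at B and applying to Y kills both terms: q(B) = 0,
    and p(B) Y = Y p(A) = 0. *)
Lemma intertwine_eq0 (F : closedFieldType) n (A B Y : 'M[F]_n) :
  (forall a, eigenvalue A a -> eigenvalue B a -> False) ->
  Y *m A = B *m Y -> Y = 0.
Proof.
case: n A B Y => [|n] A B Y H E; first by rewrite [Y]flatmx0.
have : coprimep (char_poly A) (char_poly B).
  apply/Pdiv.ClosedField.coprimepP => a; rewrite -!eigenvalue_root_char => Ha.
  by apply/negP => Hb; apply: (H a) => //; rewrite eigenvalue_root_char.
move=> /Bezout_eq1_coprimepP[[u v] /= uv].
have Yu : horner_mx B (char_poly A) *m Y = 0.
  by rewrite -(intertwine_horner _ E) Cayley_Hamilton mulmx0.
have := congr1 (fun q => horner_mx B q *m Y) uv.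
rewrite !(rmorphD, rmorphM)/= Cayley_Hamilton mulr0 addr0 rmorph1 mul1mx -mulmxE.
by rewrite -mulmxA Yu mulmx0.
Qed.

Lemma complexifyM (R : realType) p q s (A : 'M[R]_(p, q)) (B : 'M[R]_(q, s)) :
  complexify (A *m B) = complexify A *m complexify B.
Proof. exact: map_mxM. Qed.

Lemma complexify_eq0 (R : realType) p q (A : 'M[R]_(p, q)) : complexify A = 0 -> A = 0.
Proof.
by move=> H; apply: (map_mx_inj (f := real_complex R)); rewrite map_mx0.
Qed.

Lemma eigenvalue_opp (F : fieldType) n (A : 'M[F]_n) a :
  eigenvalue (- A) a = eigenvalue A (- a).
Proof.
apply/eigenvalueP/eigenvalueP => -[v E v0]; exists v => //.
  by rewrite scaleNr -E mulmxN opprK.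
by rewrite mulmxN E scaleNr opprK.
Qed.

(** Over the complex numbers Y intertwines P with [- P^T], and these have no common
    eigenvalue. *)
Lemma sylvester_inj (R : realType) m (P Y : 'M[R]_m) :
  spectrum_condition P -> Y *m P + P^T *m Y = 0 -> Y = 0.
Proof.
move=> sP E; apply: complexify_eq0.
apply: (@intertwine_eq0 _ _ (complexify P) (- complexify P^T)).
  move=> a Ha Hb.
  have E1 : eigenvalue (complexify P)^T a.
    exact: (etrans (eigenvalue_trmx _ _) Ha).
  have E2 : eigenvalue (complexify P)^T (- a).
    rewrite -(eigenvalue_opp (complexify P)^T).
    by move: Hb; rewrite /complexify map_trmx.
  have : (spectrum P `&` [set - b | b in spectrum P]) a.
    by split; [exact: E1|exists (- a); [exact: E2|exact: opprK]].
  by rewrite sP.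
rewrite mulNmx -!complexifyM; apply/eqP; rewrite -addr_eq0 /complexify -map_mxD E.
by rewrite map_mx0.
Qed.

(** A row u with [u P = 0] gives the solution [u^T u] of the homogeneous Sylvester
    equation. *)
Lemma spectrum_unitmx (R : realType) m (P : 'M[R]_m) :
  spectrum_condition P -> P \in unitmx.
Proof.
move=> sP; rewrite -row_free_unit -kermx_eq0; apply/eqP.
apply/row_matrixP => i; rewrite row0; set u := row i _.
have uP : u *m P = 0 by rewrite /u -row_mul mulmx_ker row0.
have : (u^T *m u) *m P + P^T *m (u^T *m u) = 0.
  by rewrite -mulmxA uP mulmx0 add0r mulmxA -trmx_mul uP trmx0 mul0mx.
move=> /(sylvester_inj sP) uu0; apply/rowP => j; rewrite mxE.
have := congr1 (fun M : 'M[R]_m => M j j) uu0; rewrite !mxE big_ord1 !mxE => /eqP.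
by rewrite mulf_eq0 orbb => /eqP.
Qed.

Definition sylvester_op (R : realType) m (P Y : 'M[R]_m) : 'M[R]_m := Y *m P + P^T *m Y.
Lemma sylvester_op_linear (R : realType) m (P : 'M[R]_m) : linear (sylvester_op P).
Proof.
move=> a u v; rewrite /sylvester_op mulmxDl mulmxDr -scalemxAl -scalemxAr.
by rewrite scalerDr addrACA.
Qed.
HB.instance Definition _ (R : realType) m (P : 'M[R]_m) :=
  GRing.isLinear.Build R 'M[R]_m 'M[R]_m _ (sylvester_op P) (sylvester_op_linear P).

(** Built from the matrix of the operator, hence linear: solutions of Sylvester
    equations depend smoothly on the right-hand side. *)
Definition sylvester_inv (R : realType) m (P A : 'M[R]_m) : 'M[R]_m :=
  vec_mx (mxvec A *m invmx (lin_mx (sylvester_op P))).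
Lemma sylvester_inv_linear (R : realType) m (P : 'M[R]_m) : linear (sylvester_inv P).
Proof.
by move=> a u v; rewrite /sylvester_inv linearP/= mulmxDl -scalemxAl linearP.
Qed.
HB.instance Definition _ (R : realType) m (P : 'M[R]_m) :=
  GRing.isLinear.Build R 'M[R]_m 'M[R]_m _ (sylvester_inv P) (sylvester_inv_linear P).

Lemma sylvester_invK (R : realType) m (P A : 'M[R]_m) :
  spectrum_condition P -> sylvester_op P (sylvester_inv P A) = A.
Proof.
move=> sP.
have u : lin_mx (sylvester_op P) \in unitmx.
  rewrite -row_free_unit -kermx_eq0; apply/eqP/row_matrixP => i; rewrite row0.
  set u := row i _.
  have : u *m lin_mx (sylvester_op P) = 0 by rewrite /u -row_mul mulmx_ker row0.
  rewrite -[u]vec_mxK mul_vec_lin => /(canRL mxvecK); rewrite linear0 => /(sylvester_inj sP) ->.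
  by rewrite linear0.
apply: (can_inj mxvecK); rewrite -mul_vec_lin /sylvester_inv vec_mxK.
by rewrite mulmxKV.
Qed.

End Sylvester.

Section OmegaInvertible.
Context {R : realType}.

(** In the sequence u, (A - a_1) u, (A - a_2) (A - a_1) u, and so on, the last
    nonzero vector is an eigenvector, and it lies in the kernel of E because it is a
    combination of the iterates of A on u. *)
Lemma eigenvector_chain (F : fieldType) p m (E : 'M[F]_(p, m)) (A : 'M[F]_m)
    (s : seq F) (u : 'cV[F]_m) : u != 0 ->
  (forall k, E *m iter k (mulmx A) u = 0) ->
  foldl (fun (w : 'cV[F]_m) a => (A - a%:M) *m w) u s = 0 ->
  exists a, exists w : 'cV[F]_m, [/\ w != 0, E *m w = 0 & (A - a%:M) *m w = 0].
Proof.
elim: s u => [|a s IH] u u0 Eu /=; first by move=> uz; rewrite uz eqxx in u0.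
have [au|au] := eqVneq ((A - a%:M) *m u) 0.
  by move=> _; exists a, u; split=> //; exact: (Eu 0%N).
apply: IH => // k.
have -> : iter k (mulmx A) ((A - a%:M) *m u) =
    iter k.+1 (mulmx A) u - a *: iter k (mulmx A) u.
  elim: k => [|k IHk]; first by rewrite /= mulmxBl mul_scalar_mx.
  by rewrite iterS IHk [in LHS]mulmxBr -scalemxAr -!iterS.
by rewrite mulmxBr Eu -scalemxAr Eu scaler0 subr0.
Qed.

Lemma horner_mx_foldl (F : fieldType) m (A : 'M[F]_m.+1) (s : seq F) (u : 'cV[F]_m.+1) :
  foldl (fun (w : 'cV[F]_m.+1) a => (A - a%:M) *m w) u s =
  horner_mx A (\prod_(a <- s) ('X - a%:P)) *m u.
Proof.
elim: s u => [|a s IH] u /=; first by rewrite big_nil rmorph1 mul1mx.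
rewrite IH big_cons mulrC rmorphM/= -mulmxE -mulmxA; congr (_ *m (_ *m _)).
by rewrite rmorphB/= horner_mx_X horner_mx_C.
Qed.

(** The characteristic polynomial splits and kills u, which provides the sequence of
    scalars for [eigenvector_chain]. *)
Lemma invariant_kernel_eigenvector (F : closedFieldType) p m (E : 'M[F]_(p, m))
    (A : 'M[F]_m) (u : 'cV[F]_m) : u != 0 ->
  (forall k, E *m iter k (mulmx A) u = 0) ->
  exists a, exists w : 'cV[F]_m, [/\ w != 0, E *m w = 0 & (A - a%:M) *m w = 0].
Proof.
case: m E A u => [|m] E A u u0 Eu; first by rewrite [u]flatmx0 eqxx in u0.
have [s Hs] := closed_field_poly_normal (char_poly A).
apply: (eigenvector_chain (s := s) u0 Eu).
rewrite horner_mx_foldl.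
have := Cayley_Hamilton A; rewrite Hs (monicP (char_poly_monic A)) scale1r => ->.
by rewrite mul0mx.
Qed.

Lemma sum_sq_eq0 p (v : 'cV[R]_p) : v^T *m v = 0 -> v = 0.
Proof.
move=> /(congr1 (fun M : 'M[R]_1 => M 0 0)); rewrite !mxE => /eqP.
rewrite psumr_eq0 => [/allP H|i _]; last by rewrite mxE -expr2 sqr_ge0.
apply/colP => i; have := H i (mem_index_enum _).
by rewrite !mxE mulf_eq0 orbb => /eqP.
Qed.

Lemma sum_sq2_eq0 p (v w : 'cV[R]_p) : v^T *m v + w^T *m w = 0 -> v = 0 /\ w = 0.
Proof.
move=> H; have := sum_sq_eq0 (v := col_mx v w).
by rewrite tr_col_mx mul_row_col H => /(_ erefl) /eqP; rewrite col_mx_eq0 => /andP[/eqP-> /eqP->].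
Qed.

Lemma complexify_iter m (A : 'M[R]_m) (u : 'cV[R]_m) k :
  complexify (iter k (mulmx A) u) = iter k (mulmx (complexify A)) (complexify u).
Proof. by elim: k => //= k <-; rewrite complexifyM. Qed.

(** If [Om v = 0], the first identity evaluated on v gives [E v = 0] and
    [E (P v) = 0], hence [Om^T v = 0]; the Sylvester equation then gives
    [Om^T (P v) = 0], and so [Om (P v) = 0] by the same argument for the transpose.
    The kernel of Om is therefore invariant under P and contained in that of E. *)
Lemma omega_unitmx p m (E : 'M[R]_(p, m)) (P Om : 'M[R]_m) :
  (forall a : complex R, spectrum P a ->
     forall v : 'cV[complex R]_m, (complexify P - a%:M) *m v = 0 ->
       complexify E *m v = 0 -> v = 0) ->
  Om + Om^T = E^T *m E + P^T *m (E^T *m E) *m P ->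
  sylvester_op P Om^T = P^T *m P^T *m (E^T *m E) *m P + (E^T *m E) *m P ->
  Om \in unitmx.
Proof.
move=> HP Hsym Hsyl.
have aux (O : 'M[R]_m) (v : 'cV[R]_m) :
   O + O^T = E^T *m E + P^T *m (E^T *m E) *m P -> O *m v = 0 ->
   [/\ E *m v = 0, E *m (P *m v) = 0 & O^T *m v = 0].
  move=> HO Ov.
  have Q : (E *m v)^T *m (E *m v) + (E *m (P *m v))^T *m (E *m (P *m v)) = 0.
    rewrite !trmx_mul !mulmxA.
    have := congr1 (fun M => v^T *m M *m v) HO.
    rewrite !(mulmxDr, mulmxDl) -mulmxA Ov mulmx0 add0r !mulmxA.
    rewrite -[v^T *m O^T]trmx_mul Ov trmx0 !mul0mx => ->.
    by [].
  have [Ev EPv] := sum_sq2_eq0 Q; split=> //.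
  have := congr1 (fun M => M *m v) HO.
  rewrite !mulmxDl Ov add0r => ->.
  by rewrite -!mulmxA Ev EPv !mulmx0 addr0.
have step (v : 'cV[R]_m) : Om *m v = 0 -> E *m v = 0 /\ Om *m (P *m v) = 0.
  move=> Ov; have [Ev EPv Otv] := aux Om v Hsym Ov; split=> //.
  have OtP : Om^T *m (P *m v) = 0.
    have := congr1 (fun M => M *m v) Hsyl; rewrite /sylvester_op !mulmxDl.
    by rewrite -!mulmxA Otv EPv !mulmx0 !addr0.
  have Hsym' : Om^T + Om^T^T = E^T *m E + P^T *m (E^T *m E) *m P.
    by rewrite trmxK addrC.
  by have [_ _] := aux _ _ Hsym' OtP; rewrite trmxK.
rewrite -unitmx_tr -row_free_unit -kermx_eq0; apply/negPn/negP => k0.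
have [i ri0] : exists i, row i (kermx Om^T) != 0.
  apply/existsP; apply: contraR k0; rewrite negb_exists => /forallP H.
  by apply/eqP/row_matrixP => i; rewrite row0; apply/eqP; rewrite -[_ == _]negbK H.
set v := (row i (kermx Om^T))^T.
have v0 : v != 0 by rewrite /v trmx_eq0.
have Ov : Om *m v = 0.
  by apply: trmx_inj; rewrite trmx_mul trmxK -row_mul mulmx_ker row0 trmx0.
have Ok k : Om *m iter k (mulmx P) v = 0.
  by elim: k => // k /step[_].
have Ek k : complexify E *m iter k (mulmx (complexify P)) (complexify v) = 0.
  rewrite -complexify_iter -complexifyM.
  by have [-> _] := step _ (Ok k); rewrite /complexify map_mx0.
have cv0 : complexify v != 0.
  by apply/eqP => /complexify_eq0 vz; rewrite vz eqxx in v0.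
have [a [w [w0 Ew Aw]]] := invariant_kernel_eigenvector cv0 Ek.
have wn0 : w <> 0 by exact/eqP.
apply: wn0; apply: (HP a) => //.
apply/eigenvalueP; exists w^T; last by rewrite trmx_eq0; exact: w0.
apply/eqP; rewrite -subr_eq0 -mul_mx_scalar -mulmxBr -[a%:M]tr_scalar_mx.
by rewrite -linearB/= -trmx_mul Aw trmx0.
Qed.

End OmegaInvertible.

(** * Tangent projection and connection of an induced metric *)

Section MatrixAlgebra.

Lemma mulmx_cV_inj (F : comNzRingType) p q (A B : 'M[F]_(p, q)) :
  (forall Z : 'cV[F]_q, A *m Z = B *m Z) -> A = B.
Proof.
move=> H; apply/matrixP => i j.
have := congr1 (fun M : 'cV[F]_p => M i 0) (H (delta_mx j 0)).
by rewrite -!colE !mxE.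
Qed.

Lemma mulmx3_cV_inj (F : comNzRingType) p q r s (A : 'M[F]_(p, q)) (B D : 'M[F]_(q, r))
  (C E : 'M[F]_(r, s)) :
  (forall Z : 'cV[F]_s, A *m (B *m (C *m Z)) = A *m (D *m (E *m Z))) ->
  A *m (B *m C) = A *m (D *m E).
Proof. by move=> H; apply: mulmx_cV_inj => Z; rewrite -!mulmxA. Qed.

Lemma idem_deriv (F : comNzRingType) p (A B : 'M[F]_p) :
  A *m A = A -> B = B *m A + A *m B -> A *m B *m A = 0.
Proof.
move=> AA E; have : A *m B *m A = A *m B *m A + A *m B *m A.
  by rewrite {1}E mulmxDr mulmxDl !mulmxA AA -[A *m B *m A *m A]mulmxA AA.
by move=> /eqP; rewrite -subr_eq subrr eq_sym => /eqP.
Qed.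

Lemma is_derive_mulmxr (R : realType) (U : normedModType R) p q s
   (C : 'M[R]_(q, s)) (A : U -> 'M[R]_(p, q)) y X dA :
  is_derive y X A dA -> is_derive y X (fun z => A z *m C) (dA *m C).
Proof. exact: (is_derive_linear_mx (mulmxr C)). Qed.

Lemma is_derive_mulmxl (R : realType) (U : normedModType R) p q s
   (C : 'M[R]_(p, q)) (A : U -> 'M[R]_(q, s)) y X dA :
  is_derive y X A dA -> is_derive y X (fun z => C *m A z) (C *m dA).
Proof. exact: (is_derive_linear_mx (mulmx C)). Qed.

Lemma mulmx_symm (F : comNzRingType) p q r (A B Q : 'M[F]_p) (d a b : 'M[F]_(p, q)) (X Y : 'M[F]_(q, r)) :
  A *m d = Q *m a -> B *m d = Q *m b -> a *m Y = b *m X ->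
  A *m (d *m Y) = B *m (d *m X).
Proof. by move=> H1 H2 H; rewrite !mulmxA H1 H2 -!mulmxA H. Qed.

Lemma idem_mulmx_dist (F : comNzRingType) p q (A B : 'M[F]_p) (U Z : 'M[F]_(p, q)) :
  A *m A = A -> A *m (B *m U + A *m Z) = A *m (B *m U) + A *m Z.
Proof. by move=> H; rewrite mulmxDr [A *m (A *m _)]mulmxA H. Qed.

Lemma koszul_alg (F : numFieldType) (I : Type) (a : I -> I -> I -> F) (c : F) i j l :
  (forall i j l, a i j l = a j i l) ->
  2^-1 * (c * (a i l j + a i j l + (a j l i + a j i l) - (a l j i + a l i j))) =
  c * a i j l.
Proof.
move=> aS; rewrite (aS j i l) (aS l i j) (aS l j i) mulrCA; congr (_ * _).
by move: (a i l j) (a j l i) (a i j l) => a1 a2 a3; field.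
Qed.

Lemma cancel_common (F : comNzRingType) p q r (d : 'M[F]_(p, q)) (a b : 'M[F]_(q, r)) (u v w x : 'M[F]_(p, r)) :
  a - b = 0 -> d *m a = u + w -> d *m b = v + x -> w = x -> u = v.
Proof. by move=> /subr0_eq -> -> + wx; rewrite wx => /addIr. Qed.

Lemma idem_comm_swap (F : comNzRingType) p q (A B C : 'M[F]_p) (d b c : 'M[F]_(p, q)) :
  B = B *m A + A *m B -> C = C *m A + A *m C ->
  B *m d = (1%:M - A) *m b -> C *m d = (1%:M - A) *m c ->
  A *m (B *m c) = A *m (C *m b) -> B *m (C *m d) = C *m (B *m d).
Proof.
move=> HB HC Hb Hc H.
have P X : X = X *m A + A *m X -> A *m X = X *m (1%:M - A).
  by move=> E; rewrite mulmxBr mulmx1 {2}E addrAC subrr add0r.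
by rewrite Hb Hc !mulmxA -(P _ HB) -(P _ HC) -!mulmxA.
Qed.

End MatrixAlgebra.

Section Jacobian.
Context {R : realType} {n p : nat}.
Local Notation V := 'cV[R]_n.
Context (W : set V) (f : V -> 'cV[R]_p).
Hypothesis oW : open W.
Hypothesis f_smooth : smooth_on W f.

Lemma jacE y X : W y -> 'D_X f y = jac f y *m X.
Proof.
move=> Wy; rewrite (Ck_deriveE X oW (f_smooth 1) Wy); apply/colP => k.
rewrite mxE /dir_lin summxE; apply: eq_bigr => i _.
by rewrite !mxE mulrC.
Qed.

Lemma jac_sum y : jac f y = \sum_i 'D_(ebasis R i) f y *m (delta_mx 0 i : 'rV[R]_n).
Proof.
apply/matrixP => k j; rewrite mxE summxE (bigD1 j)//= big1 ?addr0 => [|i ij].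
  by rewrite mxE big_ord1 !mxE !eqxx mulr1.
by rewrite mxE big_ord1 [X in _ * X]mxE [j == i]eq_sym (negbTE ij) andbF mulr0.
Qed.

Lemma jac_smooth : smooth_on W (jac f).
Proof.
move=> k; apply: (Ck_eq (h := fun y => \sum_i 'D_(ebasis R i) f y *m (delta_mx 0 i : 'rV[R]_n)) oW).
  by move=> y _; rewrite jac_sum.
apply: (Ck_sum _ oW) => i; apply: (Ck_mulmx oW); last exact: Ck_cst.
exact: Ck_D (f_smooth k.+1).
Qed.

Lemma is_derive_jac y X : W y -> is_derive y X (jac f) ('D_X (jac f) y).
Proof. exact: Ck_is_derive (jac_smooth 1). Qed.

Lemma derive_jacE y X Y : W y -> 'D_X (jac f) y *m Y = 'D_X ('D_Y f) y.
Proof.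
move=> Wy.
have [_ <-] := is_derive_mulmxr Y (is_derive_jac X Wy).
apply: near_eq_derive; apply: (near_open oW Wy) => z Wz.
by rewrite jacE.
Qed.

Lemma derive_jac_sym y X Y : W y -> 'D_X (jac f) y *m Y = 'D_Y (jac f) y *m X.
Proof.
move=> Wy; exact: (etrans (derive_jacE X Y Wy)
  (etrans (derive_comm X Y oW (f_smooth 2) Wy) (esym (derive_jacE Y X Wy)))).
Qed.

End Jacobian.

Lemma derive_dir_lin (R : realType) (n p q : nat) (W : set 'cV[R]_n)
    (h : 'cV[R]_n -> 'M[R]_(p, q)) y X : open W -> smooth_on W h -> W y ->
  'D_X h y = \sum_i X i 0 *: 'D_(ebasis R i) h y.
Proof. by move=> oW hs Wy; rewrite (Ck_deriveE X oW (hs 1) Wy). Qed.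

Section InducedMetric.
Context {R : realType} {n p : nat}.
Local Notation V := 'cV[R]_n.
Context (W : set V) (g : V -> 'M[R]_n) (f : V -> 'cV[R]_p).
Hypothesis oW : open W.
Hypothesis f_smooth : smooth_on W f.
Hypothesis gE : forall y, W y -> g y = (jac f y)^T *m jac f y.
Hypothesis g_unit : forall y, W y -> g y \in unitmx.
Local Notation df := (jac f).

Definition tangent_proj (y : V) : 'M[R]_p := df y *m invmx (g y) *m (df y)^T.
Local Notation Pi := tangent_proj.

Lemma metric_smooth_on : smooth_on W g.
Proof.
move=> k; apply: (Ck_eq (h := fun y => (df y)^T *m df y) oW) => [y Wy|]; first by rewrite gE.
apply: (Ck_mulmx oW); last exact: jac_smooth.
exact: (Ck_lin trmx oW (jac_smooth oW f_smooth k)).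
Qed.

Lemma metric_symm y : W y -> (g y)^T = g y.
Proof. by move=> Wy; rewrite gE// trmx_mul trmxK. Qed.

Lemma invmetric_symm y : W y -> (invmx (g y))^T = invmx (g y).
Proof. by move=> Wy; rewrite trmx_inv metric_symm. Qed.

Lemma invmetricK y : W y -> invmx (g y) *m (df y)^T *m df y = 1%:M.
Proof. by move=> Wy; rewrite -mulmxA -gE// mulVmx// g_unit. Qed.

Lemma tangent_projK y : W y -> Pi y *m df y = df y.
Proof. by move=> Wy; rewrite /Pi -!mulmxA [_ *m (_ *m df y)]mulmxA invmetricK// mulmx1. Qed.

Lemma tangent_proj_idem y : W y -> Pi y *m Pi y = Pi y.
Proof. by move=> Wy; rewrite {2}/Pi !mulmxA tangent_projK. Qed.

Lemma tangent_proj_tr y : W y -> (Pi y)^T = Pi y.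
Proof. by move=> Wy; rewrite /Pi !trmx_mul trmxK invmetric_symm// mulmxA. Qed.

Lemma invmetric_smooth : smooth_on W (fun y => invmx (g y)).
Proof. by move=> k; apply: (Ck_inv oW) => //; exact: metric_smooth_on. Qed.

Lemma tangent_proj_smooth : smooth_on W Pi.
Proof.
move=> k; apply: (Ck_mulmx oW); last exact: (Ck_lin trmx oW (jac_smooth oW f_smooth k)).
by apply: (Ck_mulmx oW); [exact: jac_smooth|exact: invmetric_smooth].
Qed.

Lemma is_derive_Pi y X : W y -> is_derive y X Pi ('D_X Pi y).
Proof. exact: Ck_is_derive (tangent_proj_smooth 1). Qed.

Lemma is_derive_trmx (U : normedModType R) a b (h : U -> 'M[R]_(a, b)) y X dh :
  is_derive y X h dh -> is_derive y X (fun z => (h z)^T) dh^T.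
Proof. exact: (is_derive_linear_mx trmx). Qed.

(** The Koszul formula: for [g = df^T df], each of the three derivatives of the metric
    is the sum of two terms [df^T d^2 f], and four of these six terms cancel. *)
Lemma christoffelE y i j k : W y ->
  christoffel g y i j k = (invmx (g y) *m (df y)^T *m 'D_(ebasis R i) df y) k j.
Proof.
move=> Wy; pose a i j l := ((df y)^T *m 'D_(ebasis R i) df y) l j.
have aS i' j' l : a i' j' l = a j' i' l.
  have E (A : 'M[R]_(n)) (l' j0 : 'I_n) : A l' j0 = (A *m ebasis R j0) l' 0.
    rewrite mxE (bigD1 j0)//= big1 ?addr0 => [|s sj]; first by rewrite mxE !eqxx mulr1.
    by rewrite mxE (negbTE sj) mulr0.
  rewrite /a [LHS]E [RHS]E; apply: (congr1 (fun M : V => M l 0)).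
  have H := derive_jac_sym oW f_smooth (ebasis R i') (ebasis R j') Wy.
  exact: (etrans (esym (mulmxA _ _ _)) (etrans (congr1 (mulmx (df y)^T) H) (mulmxA _ _ _))).
have dg i' j' l : ('D_(ebasis R i') g y) j' l = a i' l j' + a i' j' l.
  have Dj := is_derive_jac oW f_smooth (ebasis R i') Wy.
  have H := is_derive_mulmx (is_derive_trmx Dj) Dj.
  have -> : 'D_(ebasis R i') g y = 'D_(ebasis R i') (fun z => (df z)^T *m df z) y.
    by apply: near_eq_derive; apply: (near_open oW Wy) => z Wz; rewrite gE.
  have [_ ->] := H; rewrite mxE addrC; congr (_ + _).
  rewrite /a !mxE; apply: eq_bigr => s _.
  by rewrite !mxE mulrC.
rewrite /christoffel -mulmxA mxE mulr_sumr; apply: eq_bigr => l _.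
have E := f_equal2 (fun u v : R => u - v)
  (f_equal2 (fun u v : R => u + v) (dg i j l) (dg j i l)) (dg l i j).
exact: (etrans (congr1 (fun M => 2^-1 * (invmx (g y) k l * M)) E)
  (@koszul_alg R 'I_n a (invmx (g y) k l) i j l aS)).
Qed.

Lemma covdE q X (Y : V -> 'M[R]_(n, q)) y : W y ->
  covd g X Y y = 'D_X Y y + invmx (g y) *m (df y)^T *m 'D_X df y *m Y y.
Proof.
move=> Wy; rewrite /covd; congr (_ + _ *m _).
rewrite (derive_dir_lin X oW (jac_smooth oW f_smooth) Wy) mulmx_sumr.
apply/matrixP => k j; rewrite mxE summxE; apply: eq_bigr => i _.
by rewrite christoffelE// -scalemxAr [RHS]mxE.
Qed.

Lemma df_covd q X (Y : V -> 'M[R]_(n, q)) y dY : W y -> is_derive y X Y dY ->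
  df y *m covd g X Y y = Pi y *m 'D_X (fun z => df z *m Y z) y.
Proof.
move=> Wy DY; rewrite covdE//.
have [_ ->] := is_derive_mulmx (is_derive_jac oW f_smooth X Wy) DY.
have [_ ->] := DY.
by rewrite !mulmxDr addrC !mulmxA tangent_projK.
Qed.

Lemma sffE X Y y : W y -> sff g f X Y y = (1%:M - Pi y) *m 'D_X df y *m Y.
Proof.
move=> Wy; rewrite /sff (df_covd Wy (is_derive_cst Y y X)).
have [_ ->] := is_derive_mulmxr Y (is_derive_jac oW f_smooth X Wy).
by rewrite mulmxBl mul1mx mulmxBl mulmxA.
Qed.

(** Differentiate [Pi Pi = Pi]. *)
Lemma dPi_idem X y : W y -> 'D_X Pi y = 'D_X Pi y *m Pi y + Pi y *m 'D_X Pi y.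
Proof.
move=> Wy; have D := is_derive_Pi X Wy.
have [_ <-] := is_derive_mulmx D D.
by apply: near_eq_derive; apply: (near_open oW Wy) => z Wz; rewrite tangent_proj_idem.
Qed.

Lemma dPi_tr X y : W y -> ('D_X Pi y)^T = 'D_X Pi y.
Proof.
move=> Wy; have [_ <-] := is_derive_trmx (is_derive_Pi X Wy).
by apply: near_eq_derive; apply: (near_open oW Wy) => z Wz; rewrite tangent_proj_tr.
Qed.

(** Differentiate [Pi df = df]. *)
Lemma dPi_df X y : W y -> 'D_X Pi y *m df y = (1%:M - Pi y) *m 'D_X df y.
Proof.
move=> Wy; have [_ H] := is_derive_mulmx (is_derive_Pi X Wy) (is_derive_jac oW f_smooth X Wy).
have E : 'D_X df y = 'D_X (fun z => Pi z *m df z) y.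
  by apply: near_eq_derive; apply: (near_open oW Wy) => z Wz; rewrite tangent_projK.
rewrite mulmxBl mul1mx; apply/eqP; rewrite eq_sym subr_eq; apply/eqP.
exact: (etrans E H).
Qed.

(** On tangent vectors [D_X Pi] is the second fundamental form, which is symmetric
    because second derivatives are. *)
Lemma dPi_sym X Y y : W y -> 'D_X Pi y *m (df y *m Y) = 'D_Y Pi y *m (df y *m X).
Proof.
move=> Wy.
exact: (mulmx_symm (dPi_df X Wy) (dPi_df Y Wy) (derive_jac_sym oW f_smooth X Y Wy)).
Qed.

(** The Gauss equation: in the curvature the second derivatives of [df] cancel, and
    the tangential part of the commutator of the [D_X Pi] on tangent vectors
    remains. *)
Lemma flat_comm_df X Y y : W y ->
  (forall Z, curvature g X Y Z y = 0) ->
  'D_X Pi y *m ('D_Y Pi y *m df y) = 'D_Y Pi y *m ('D_X Pi y *m df y).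
Proof.
move=> Wy Hc.
have covdc Y' (Z : V) z : W z -> covd g Y' (fun=> Z) z = invmx (g z) *m (df z)^T *m ('D_Y' df z *m Z).
  by move=> Wz; rewrite covdE// derive_cst add0r !mulmxA.
have Dc X' Y' (Z : V) : df y *m covd g X' (covd g Y' (fun=> Z)) y =
    Pi y *m ('D_X' Pi y *m ('D_Y' df y *m Z)) + Pi y *m ('D_X' ('D_Y' df) y *m Z).
  have D0 : is_derive y X' ('D_Y' df) ('D_X' ('D_Y' df) y).
    exact: (Ck_is_derive X' (Ck_D Y' (jac_smooth oW f_smooth 2)) Wy).
  have DZ := is_derive_mulmxr Z D0.
  have sm : is_derive y X' (covd g Y' (fun=> Z)) ('D_X' (covd g Y' (fun=> Z)) y).
    apply: derivableP; apply: (near_eq_derivable (f := fun z => invmx (g z) *m (df z)^T *m ('D_Y' df z *m Z))).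
      by apply: (near_open oW Wy) => z Wz; rewrite covdc.
    have DI := Ck_is_derive X' (invmetric_smooth 1) Wy.
    by have [] := is_derive_mulmx (is_derive_mulmx DI (is_derive_trmx (is_derive_jac oW f_smooth X' Wy))) DZ.
  rewrite (df_covd Wy sm).
  have -> : 'D_X' (fun z => df z *m covd g Y' (fun=> Z) z) y =
     'D_X' (fun z => Pi z *m ('D_Y' df z *m Z)) y.
    apply: near_eq_derive; apply: (near_open oW Wy) => z Wz.
    by rewrite covdc// /Pi !mulmxA.
  have [_ ->] := is_derive_mulmx (is_derive_Pi X' Wy) DZ.
  exact: (idem_mulmx_dist _ _ _ (tangent_proj_idem Wy)).
have sym : 'D_X ('D_Y df) y = 'D_Y ('D_X df) y.
  exact: derive_comm oW (jac_smooth oW f_smooth 2) Wy.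
have key (Z : V) : Pi y *m ('D_X Pi y *m ('D_Y df y *m Z)) = Pi y *m ('D_Y Pi y *m ('D_X df y *m Z)).
  exact: (cancel_common (Hc Z) (Dc X Y Z) (Dc Y X Z)
    (congr1 (fun M => Pi y *m (M *m Z)) sym)).
have key2 : Pi y *m ('D_X Pi y *m 'D_Y df y) = Pi y *m ('D_Y Pi y *m 'D_X df y).
  exact: mulmx3_cV_inj key.
exact: (idem_comm_swap (dPi_idem X Wy) (dPi_idem Y Wy) (dPi_df X Wy) (dPi_df Y Wy) key2).
Qed.

End InducedMetric.

(** * Algebra of Lagrangian projections *)

Section LagrangianAlgebra.
Context {F : comNzRingType} {p : nat}.
Implicit Types D : 'M[F]_p.
Variables (J Pi : 'M[F]_p).
Hypothesis JJ : J *m J = - 1%:M.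
Hypothesis Pi_idem : Pi *m Pi = Pi.
Hypothesis J_Pi : J *m Pi = (1%:M - Pi) *m J.

(** The two identities are the derivatives of [Pi Pi = Pi] and of
    [J Pi = (1 - Pi) J]. *)
Definition proj_variation D := D = D *m Pi + Pi *m D /\ J *m D = - (D *m J).

Definition refl : 'M[F]_p := Pi + Pi - 1%:M.
(** The operator for which the Codazzi equation of a tangent [E] becomes
    [E' = theta (J E - E L)], see [theta_tangent]. *)
Definition theta_mx D : 'M[F]_p := - (J *m D *m refl).

Lemma JJl q (A : 'M[F]_(p, q)) : J *m (J *m A) = - A.
Proof. by rewrite mulmxA JJ mulNmx mul1mx. Qed.

Lemma Pi_J : Pi *m J = J *m (1%:M - Pi).
Proof. by rewrite mulmxBr mulmx1 J_Pi mulmxBl mul1mx opprB addrC subrK. Qed.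

Lemma refl_J : refl *m J = - (J *m refl).
Proof.
rewrite /refl !(mulmxBl, mulmxDl) mul1mx Pi_J -[X in _ - X](mulmx1 J) -mulmxDr -mulmxBr -mulmxN.
by congr (_ *m _); apply/matrixP => i j; rewrite !mxE; ring.
Qed.

Lemma D_refl D : proj_variation D -> D *m refl = - (refl *m D).
Proof.
move=> [E _]; apply/eqP; rewrite -addr_eq0 /refl !(mulmxBl, mulmxBr, mulmxDl, mulmxDr).
rewrite mulmx1 mul1mx addrACA [X in X + _]addrACA -E.
by rewrite -opprD subrr.
Qed.

Lemma refl_refl : refl *m refl = 1%:M.
Proof.
rewrite {1}/refl mulmxBl mulmxDl mul1mx.
have -> : Pi *m refl = Pi.
  by rewrite /refl mulmxBr mulmxDr mulmx1 Pi_idem addrK.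
by rewrite /refl opprB addrC subrK.
Qed.

Lemma D_J D : proj_variation D -> D *m J = - (J *m D).
Proof. by move=> [_ ->]; rewrite opprK. Qed.

Lemma theta_J D : proj_variation D -> theta_mx D *m J = J *m theta_mx D.
Proof.
move=> vD; rewrite /theta_mx mulNmx mulmxN; congr (- _).
rewrite -[LHS]mulmxA refl_J mulmxN -!mulmxA -mulmxN; congr (J *m _).
by rewrite !mulmxA (D_J vD) mulNmx opprK.
Qed.

(** Consequently the operators theta commute as soon as the variations do. *)
Lemma theta_mul D1 D2 : proj_variation D1 -> proj_variation D2 ->
  theta_mx D1 *m theta_mx D2 = D1 *m D2.
Proof.
move=> v1 v2; rewrite /theta_mx mulNmx mulmxN opprK.
have -> : J *m D1 *m refl *m (J *m D2 *m refl) = J *m D1 *m (refl *m J) *m (D2 *m refl).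
  by rewrite !mulmxA.
rewrite refl_J (D_refl v2) mulmxN mulmxN mulNmx opprK -!mulmxA.
rewrite [refl *m (refl *m D2)]mulmxA refl_refl mul1mx.
by rewrite [D1 *m (J *m D2)]mulmxA (D_J v1) mulNmx mulmxN -mulmxA JJl opprK.
Qed.

(** On tangent values the reflection is the identity, and theta commutes with J. *)
Lemma theta_tangent q D (L : 'M[F]_q) (E : 'M[F]_(p, q)) : proj_variation D ->
  Pi *m E = E -> theta_mx D *m (J *m E - E *m L) = D *m E + J *m D *m E *m L.
Proof.
move=> vD PE.
have RE : refl *m E = E by rewrite /refl mulmxBl mulmxDl PE mul1mx addrK.
have -> : theta_mx D *m (J *m E - E *m L) = theta_mx D *m J *m E - theta_mx D *m E *m L.
  by rewrite mulmxBr !mulmxA.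
have TE : theta_mx D *m E = - (J *m D *m E) by rewrite /theta_mx mulNmx -!mulmxA RE.
rewrite (theta_J vD) -[J *m _ *m E]mulmxA TE mulmxN mulNmx opprK -[J *m D *m E]mulmxA JJl.
by rewrite opprK mulmxA.
Qed.

Lemma theta_Pi D : proj_variation D -> theta_mx D *m Pi = Pi *m theta_mx D.
Proof.
move=> vD; rewrite /theta_mx mulNmx mulmxN; congr (- _).
have -> : Pi *m (J *m D *m refl) = J *m ((1%:M - Pi) *m D) *m refl.
  by rewrite !mulmxA Pi_J -!mulmxA.
have -> : (1%:M - Pi) *m D = D *m Pi.
  by rewrite mulmxBl mul1mx {1}(proj1 vD) addrK.
rewrite -!mulmxA; congr (_ *m (_ *m _)).
by rewrite /refl mulmxBl mulmxBr mulmxDl mulmxDr mul1mx mulmx1.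
Qed.

(** With [E' = theta (J E - E L)], the left-hand side is the derivative of the normal
    part of E.  It depends on that normal part only, because theta preserves the
    splitting into tangent and normal parts. *)
Lemma normal_part_deriv q D (L : 'M[F]_q) (E : 'M[F]_(p, q)) : proj_variation D ->
  - D *m E + (1%:M - Pi) *m (theta_mx D *m (J *m E - E *m L)) =
  - (D *m ((1%:M - Pi) *m E) + theta_mx D *m ((1%:M - Pi) *m E) *m L).
Proof.
move=> vD; set q' := (1%:M - Pi) *m E.
have tPi : (1%:M - Pi) *m theta_mx D = theta_mx D *m (1%:M - Pi).
  by rewrite mulmxBl mulmxBr mul1mx mulmx1 (theta_Pi vD).
rewrite mulmxA tPi -mulmxA mulmxBr.
rewrite [(1%:M - Pi) *m (J *m E)]mulmxA -J_Pi -[J *m Pi *m E]mulmxA.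
rewrite [(1%:M - Pi) *m (E *m L)]mulmxA -/q'.
have PE : Pi *m (Pi *m E) = Pi *m E by rewrite mulmxA Pi_idem.
have := theta_tangent 0 vD PE; rewrite !mulmx0 subr0 addr0 => H.
rewrite mulmxBr H mulmxA opprD /q' mulmxBl mul1mx mulmxBr.
rewrite mulNmx -[D *m Pi *m E]mulmxA [_ *m (_ *m L)]mulmxA.
by rewrite opprB addrA [- _ + _]addrC.
Qed.

(** The normal part of [E'] is [D E], since E is tangent; the Codazzi equation then
    reads [D E + J Pi E' P = 0], which determines the tangential part of [E']. *)
Lemma cod_variation q D (P L : 'M[F]_q) (E E' : 'M[F]_(p, q)) : proj_variation D ->
  P *m L = 1%:M -> E' = D *m E + Pi *m E' ->
  (1%:M - Pi) *m (E' + J *m E' *m P) = 0 ->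
  E' = D *m E + J *m D *m E *m L.
Proof.
move=> vD PL HE H; rewrite {1}HE; congr (_ + _).
have E1 : (1%:M - Pi) *m E' = D *m E by rewrite mulmxBl mul1mx {1}HE addrK.
move: H; rewrite mulmxDr E1 !mulmxA -J_Pi => /(congr1 (fun M => J *m M *m L)).
rewrite mulmx0 mul0mx mulmxDr mulmxDl -!mulmxA PL mulmx1 JJl => /eqP.
by rewrite subr_eq0 => /eqP <-; rewrite !mulmxA.
Qed.

Lemma variation_cod q D (P L : 'M[F]_q) (E E' : 'M[F]_(p, q)) : proj_variation D ->
  L *m P = 1%:M -> Pi *m E = E -> E' = D *m E + J *m D *m E *m L ->
  E' + J *m E' *m P = J *m D *m E *m (L + P).
Proof.
move=> vD LP PE ->.
rewrite mulmxDr mulmxDl mulmxDr.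
have -> : J *m (J *m D *m E *m L) *m P = - (D *m E).
  by rewrite -!mulmxA LP mulmx1 JJl.
by rewrite [X in _ + X]addrC addrA [D *m E + _]addrC addrK !mulmxA.
Qed.

Lemma Pi_D_tangent q D (E : 'M[F]_(p, q)) : proj_variation D -> Pi *m E = E ->
  Pi *m (D *m E) = 0.
Proof.
move=> [vD _] PE; rewrite -{1}PE !mulmxA.
by rewrite (idem_deriv Pi_idem vD) mul0mx.
Qed.

Lemma normal_J_D_tangent q D (E : 'M[F]_(p, q)) : proj_variation D -> Pi *m E = E ->
  (1%:M - Pi) *m (J *m D *m E) = 0.
Proof.
by move=> vD PE; rewrite !mulmxA -J_Pi -!mulmxA (Pi_D_tangent vD PE) mulmx0.
Qed.

(** The commutator vanishes on tangent vectors and commutes with J, which exchanges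
    tangent and normal vectors. *)
Lemma variation_comm D1 D2 q (d : 'M[F]_(p, q)) (d' : 'M[F]_(q, p)) :
  proj_variation D1 -> proj_variation D2 -> Pi = d *m d' ->
  D1 *m (D2 *m d) = D2 *m (D1 *m d) -> D1 *m D2 = D2 *m D1.
Proof.
move=> v1 v2 Pd H; apply/eqP; rewrite -subr_eq0; apply/eqP; set C := _ - _.
have CPi : C *m Pi = 0.
  by rewrite Pd mulmxA /C mulmxBl -!mulmxA H subrr mul0mx.
have CJ : C *m J = J *m C.
  rewrite /C mulmxBl mulmxBr -!mulmxA (D_J v1) (D_J v2) !mulmxN !mulmxA.
  by rewrite (D_J v1) (D_J v2) !mulNmx !opprK.
have N : 1%:M - Pi = - (J *m Pi *m J).
  by rewrite J_Pi -mulmxA JJ mulmxN mulmx1 opprK.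
rewrite -[C]mulmx1 -(subrK Pi 1%:M) mulmxDr CPi addr0 N mulmxN !mulmxA CJ.
by rewrite -[J *m C *m Pi]mulmxA CPi mulmx0 mul0mx oppr0.
Qed.

End LagrangianAlgebra.

(** * Flat Lagrangian immersions in a chart *)

Section ComplexStructure.
Context {R : realType} {n : nat}.

Lemma Jmx_sq : Jmx R n *m Jmx R n = - 1%:M.
Proof.
rewrite /Jmx mulmx_block !mul0mx !mulmx0 !mulmxN !mulNmx !mulmx1 !add0r !addr0.
by rewrite scalar_mx_block opp_block_mx !oppr0.
Qed.

Lemma Jmx_tr : (Jmx R n)^T = - Jmx R n.
Proof.
by rewrite /Jmx tr_block_mx !trmx0 linearN/= trmx1 opp_block_mx !oppr0 opprK.
Qed.

End ComplexStructure.

Record lagrangian_chart (R : realType) (n : nat) (W : set 'cV[R]_n)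
    (g : 'cV[R]_n -> 'M[R]_n) (f : 'cV[R]_n -> 'cV[R]_(n + n)) : Prop := {
  lc_open : open W;
  lc_smooth : smooth_on W f;
  lc_metric : forall y, W y -> g y = (jac f y)^T *m jac f y;
  lc_unit : forall y, W y -> g y \in unitmx;
  lc_lag : forall y, W y -> forall xi : 'cV[R]_(n + n),
    (exists X : 'cV[R]_n, xi = Jmx R n *m (jac f y *m X)) <-> (jac f y)^T *m xi = 0;
  lc_flat : forall y X Y Z, W y -> curvature g X Y Z y = 0 }.

Section LagrangianChart.
Context {R : realType} {n : nat}.
Local Notation V := 'cV[R]_n.
Context (W : set V) (g : V -> 'M[R]_n) (f : V -> 'cV[R]_(n + n)).
Hypothesis H : lagrangian_chart W g f.
Local Notation df := (jac f).
Local Notation J := (Jmx R n).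
Local Notation Pi := (tangent_proj g f).
Let oW := lc_open H.
Let fs := lc_smooth H.
Let gE := lc_metric H.
Let gu := lc_unit H.

Lemma df_J_df y : W y -> (df y)^T *m (J *m df y) = 0.
Proof.
move=> Wy; apply: mulmx_cV_inj => X; rewrite mul0mx -!mulmxA.
by apply/(lc_lag H Wy); exists X.
Qed.

Lemma df_normal y q (M : 'M[R]_(n + n, q)) : W y ->
  (df y)^T *m ((1%:M - Pi y) *m M) = 0.
Proof.
move=> Wy; rewrite mulmxBl mul1mx mulmxBr mulmxA.
have -> : (df y)^T *m Pi y = (df y)^T.
  by apply: trmx_inj; rewrite trmx_mul trmxK (tangent_proj_tr gE Wy) (tangent_projK gE gu Wy).
by rewrite subrr.
Qed.

(** Split a vector into its tangent part and a normal part, which has the form [J w]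
    with [w] tangent. *)
Lemma normal_projE y : W y -> 1%:M - Pi y = - (J *m Pi y *m J).
Proof.
move=> Wy; apply: mulmx_cV_inj => v.
have /(lc_lag H Wy)[X HX] : (df y)^T *m ((1%:M - Pi y) *m v) = 0 by exact: df_normal.
have v1 : v = Pi y *m v + J *m (df y *m X).
  by rewrite -HX mulmxBl mul1mx addrC subrK.
have z0 : Pi y *m (J *m (Pi y *m v)) = 0.
  rewrite {1 2}/tangent_proj -!mulmxA [(df y)^T *m (J *m _)]mulmxA.
  by rewrite [(df y)^T *m J *m _]mulmxA -[(df y)^T *m J *m df y]mulmxA df_J_df// mul0mx !mulmx0.
have := tangent_projK gE gu Wy; move: z0 HX v1; move: (Pi y) => PP z0 HX v1 Pd.
have -> : - (J *m PP *m J) *m v = - (J *m (PP *m (J *m v))) by rewrite mulNmx !mulmxA.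
rewrite HX [in RHS]v1 !mulmxDr z0 mulmx0 add0r (JJl Jmx_sq) !mulmxN opprK.
by rewrite [PP *m _]mulmxA Pd.
Qed.

Lemma lag_J_Pi y : W y -> J *m Pi y = (1%:M - Pi y) *m J.
Proof.
move=> /normal_projE ->; move: (Pi y) => PP.
by rewrite mulNmx -!mulmxA Jmx_sq !mulmxN mulmx1 opprK.
Qed.

Lemma lag_variation X y : W y -> proj_variation J (Pi y) ('D_X Pi y).
Proof.
move=> Wy; split; first exact: (dPi_idem oW fs gE gu X Wy).
have D := is_derive_Pi oW fs gE gu X Wy.
have [_ E1] := is_derive_mulmxl J D.
have [_ E2] := is_derive_mulmxr J (is_deriveB (is_derive_cst (1%:M : 'M[R]_(n + n)) y X) D).
rewrite -E1 -mulNmx -sub0r -E2; apply: near_eq_derive.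
by apply: (near_open oW Wy) => z Wz; exact: lag_J_Pi.
Qed.

Lemma lag_comm X Y y : W y -> 'D_X Pi y *m 'D_Y Pi y = 'D_Y Pi y *m 'D_X Pi y.
Proof.
move=> Wy.
have HF := flat_comm_df oW fs gE gu Wy (fun Z => lc_flat H X Y Z Wy).
exact: (variation_comm Jmx_sq (lag_J_Pi Wy) (lag_variation X Wy) (lag_variation Y Wy)
  (esym (mulmxA _ _ _)) HF).
Qed.

(** Written with partial derivatives so as to be linear in [X] at every point, even
    where the projection is not differentiable. *)
Definition theta_form (X y : V) : 'M[R]_(n + n) :=
  theta_mx J (Pi y) (dir_lin (fun i => 'D_(ebasis R i) Pi y) X).

Lemma theta_formE X y : W y -> theta_form X y = theta_mx J (Pi y) ('D_X Pi y).
Proof.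
move=> Wy; rewrite /theta_form; congr (theta_mx J _ _); apply: esym.
exact: (Ck_deriveE X oW (tangent_proj_smooth oW fs gE gu 1) Wy).
Qed.

Lemma theta_form_linear y : linear (theta_form^~ y).
Proof.
move=> a u v; rewrite /theta_form dir_lin_linear /theta_mx [J *m (_ + _)]mulmxDr mulmxDl opprD.
by rewrite -scalemxAr -scalemxAl -scalerN.
Qed.

Lemma Pi_refl_smooth : smooth_on W (fun y => refl (Pi y)).
Proof.
move=> k; have Ps := tangent_proj_smooth oW fs gE gu k.
exact: (Ck_add oW (Ck_add oW Ps Ps) (Ck_cst k (- 1%:M) oW)).
Qed.

Lemma theta_form_smooth X : smooth_on W (theta_form X).
Proof.
move=> k; apply: (Ck_eq (h := fun y => theta_mx J (Pi y) ('D_X Pi y)) oW).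
  by move=> y Wy; rewrite theta_formE.
apply: (Ck_lin (-%R) oW); apply: (Ck_mulmx oW); last exact: Pi_refl_smooth.
apply: (Ck_mulmx oW); first exact: Ck_cst.
exact: (Ck_D X (tangent_proj_smooth oW fs gE gu k.+1)).
Qed.

Lemma closed_alg p (A B C S S' D1 D2 : 'M[R]_p) : S = S' -> D1 *m D2 = D2 *m D1 ->
  - (A *m S *m B + C *m D1 *m (D2 + D2)) = - (A *m S' *m B + C *m D2 *m (D1 + D1)).
Proof. by move=> -> E; rewrite !mulmxDr -!mulmxA E. Qed.

(** The terms with second derivatives of [Pi] are symmetric; the others are, up to
    constants, [J (D_X Pi) (D_Y Pi)], symmetric by [lag_comm]. *)
Lemma theta_form_closed X Y y : W y -> 'D_Y (theta_form X) y = 'D_X (theta_form Y) y.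
Proof.
move=> Wy.
have Ps := tangent_proj_smooth oW fs gE gu.
have D X' Y' : 'D_Y' (theta_form X') y = - (J *m 'D_Y' ('D_X' Pi) y *m refl (Pi y)
    + J *m 'D_X' Pi y *m ('D_Y' Pi y + 'D_Y' Pi y)).
  have D1 := is_derive_Pi oW fs gE gu Y' Wy.
  have D2 : is_derive y Y' (fun z => refl (Pi z)) ('D_Y' Pi y + 'D_Y' Pi y).
    apply: (is_derive_eq (is_derive_add (is_derive_add D1 D1) (is_derive_cst (- 1%:M : 'M[R]_(n + n)) y Y'))).
    by rewrite addr0.
  have D3 := Ck_is_derive Y' (Ck_D X' (Ps 2)) Wy.
  have [_ <-] := is_derive_linear_mx (-%R) (is_derive_mulmx (is_derive_mulmxl J D3) D2).
  by apply: near_eq_derive; apply: (near_open oW Wy) => z Wz; rewrite theta_formE.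
have S := derive_comm X Y oW (Ps 2) Wy.
have CA := closed_alg J (refl (Pi y)) J (esym S) (lag_comm X Y Wy).
exact: (etrans (D X Y) (etrans CA (esym (D Y X)))).
Qed.

Lemma theta_form_comm X Y y : W y ->
  theta_form X y *m theta_form Y y = theta_form Y y *m theta_form X y.
Proof.
move=> Wy; rewrite (theta_formE X Wy) (theta_formE Y Wy).
have vX := lag_variation X Wy; have vY := lag_variation Y Wy.
have id := tangent_proj_idem gE gu Wy.
exact: (etrans (theta_mul Jmx_sq id (lag_J_Pi Wy) vX vY)
  (etrans (lag_comm X Y Wy) (esym (theta_mul Jmx_sq id (lag_J_Pi Wy) vY vX)))).
Qed.

Lemma theta_form_J X y : W y -> theta_form X y *m J = J *m theta_form X y.
Proof.
move=> Wy; rewrite (theta_formE X Wy).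
exact: (theta_J (lag_J_Pi Wy) (lag_variation X Wy)).
Qed.

End LagrangianChart.

Section LocalBounds.
Context {R : realType} {n : nat}.
Local Notation V := 'cV[R]_n.

Lemma dir_lin_bound p q (h : 'I_n -> V -> 'M[R]_(p, q)) (y0 : V) :
  (forall i, {for y0, continuous (h i)}) ->
  exists2 k : R, 0 <= k & \forall y \near y0, forall X : V,
    `|dir_lin (fun i => h i y) X| <= k * `|X|.
Proof.
move=> hc; exists (\sum_i (`|h i y0| + 1)).
  by apply: sumr_ge0 => i _; rewrite addr_ge0.
have : \forall y \near y0, forall i, `|h i y0 - h i y| <= 1.
  apply: (@filter_forall V _ (fun i y => `|h i y0 - h i y| <= 1) (nbhs y0)) => i.
  by have /cvgrPdist_le/(_ _ ltr01) := hc i.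
apply: filterS => y Hy X; rewrite /dir_lin (le_trans (ler_norm_sum _ _ _))//.
rewrite mulr_suml; apply: ler_sum => i _; rewrite normrZ mulrC ler_pM//.
  rewrite -(subrK (h i y0) (h i y)) (le_trans (ler_normD _ _))// addrC lerD2l.
  by rewrite distrC.
exact: entry_le_mx_norm.
Qed.

Lemma mulmx_bound p q s (A : 'M[R]_(p, q)) (B : 'M[R]_(q, s)) a b :
  `|A| <= a -> `|B| <= b -> `|A *m B| <= q%:R * a * b.
Proof.
move=> Ha Hb; apply: le_trans (mx_norm_mulmx A B) _.
by apply: ler_pM => //; rewrite ler_wpM2l.
Qed.

(** One constant for the three right-hand sides of interest: the integrable system,
    the Codazzi system that it becomes on tangent sections, and the system for the
    normal part of a solution. *)
Lemma operator_bounds p m (J th D : 'M[R]_p) (Lam : 'M[R]_m) (k : R) (M : 'M[R]_(p, m)) :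
  let C := p%:R * (p%:R * `|J| + m%:R * `|Lam|) +
     (p%:R + m%:R * (p%:R * `|J| * p%:R) * `|Lam|) + (p%:R + m%:R * p%:R * `|Lam|) in
  `|th| <= k -> `|D| <= k ->
  [/\ `|th *m (J *m M - M *m Lam)| <= k * C * `|M|,
      `|D *m M + J *m D *m M *m Lam| <= k * C * `|M| &
      `|D *m M + th *m M *m Lam| <= k * C * `|M| ].
Proof.
move=> C Ht HD.
have k0 : 0 <= k by apply: le_trans HD.
set c1 := p%:R * (p%:R * `|J| + m%:R * `|Lam|).
set c2 := p%:R + m%:R * (p%:R * `|J| * p%:R) * `|Lam|.
set c3 := p%:R + m%:R * p%:R * `|Lam|.
have c10 : 0 <= c1 by rewrite !(mulr_ge0, addr_ge0).
have c20 : 0 <= c2 by rewrite !(mulr_ge0, addr_ge0).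
have c30 : 0 <= c3 by rewrite !(mulr_ge0, addr_ge0).
have CE : C = c1 + c2 + c3 by [].
have kM : 0 <= k * `|M| by rewrite mulr_ge0.
have fin (x c : R) : 0 <= c <= C -> x <= c * (k * `|M|) -> x <= k * C * `|M|.
  move=> /andP[_ cC] /le_trans; apply.
  by rewrite [k * C]mulrC -mulrA ler_wpM2r.
have DM := mulmx_bound HD (lexx `|M|).
have tM := mulmx_bound Ht (lexx `|M|).
split.
- apply: (fin _ c1); first by rewrite c10 CE; lra.
  have H1 : `|J *m M - M *m Lam| <= p%:R * `|J| * `|M| + m%:R * `|M| * `|Lam|.
    by apply: le_trans (ler_normB _ _) _; apply: lerD; exact: mx_norm_mulmx.
  apply: le_trans (mulmx_bound Ht H1) _; rewrite le_eqVlt; apply/orP; left; apply/eqP.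
  by rewrite /c1; ring.
- apply: (fin _ c2); first by rewrite c20 CE; lra.
  apply: le_trans (ler_normD _ _) _.
  have H1 := mulmx_bound (mulmx_bound (lexx `|J|) HD) (lexx `|M|).
  have H2 := mulmx_bound H1 (lexx `|Lam|).
  apply: le_trans (lerD DM H2) _; rewrite le_eqVlt; apply/orP; left; apply/eqP.
  by rewrite /c2; ring.
- apply: (fin _ c3); first by rewrite c30 CE; lra.
  apply: le_trans (ler_normD _ _) _.
  have H2 := mulmx_bound tM (lexx `|Lam|).
  apply: le_trans (lerD DM H2) _; rewrite le_eqVlt; apply/orP; left; apply/eqP.
  by rewrite /c3; ring.
Qed.

End LocalBounds.

(** * The system for the tangent section E *)

Lemma eq_le_norm (R : realType) p q (A B : 'M[R]_(p, q)) : A = B -> `|A| <= `|B|.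
Proof. by move=> ->. Qed.

Section LocalSolution.
Context {R : realType} {n m : nat}.
Local Notation V := 'cV[R]_n.
Context (W : set V) (g : V -> 'M[R]_n) (f : V -> 'cV[R]_(n + n)) (Lam : 'M[R]_m).
Hypothesis H : lagrangian_chart W g f.
Local Notation df := (jac f).
Local Notation J := (Jmx R n).
Local Notation Pi := (tangent_proj g f).
Local Notation th := (theta_form g f).
Let oW := lc_open H.
Let fs := lc_smooth H.
Let gE := lc_metric H.
Let gu := lc_unit H.

(** The Codazzi equation of [E], solved for the derivative; [Lam] stands for the
    inverse of [P]. *)
Definition solves (B : set V) (E : V -> 'M[R]_(n + n, m)) : Prop :=
  forall y X, B y -> is_derive y X E ('D_X Pi y *m E y + J *m 'D_X Pi y *m E y *m Lam).

(** A ball on which the Picard iteration converges and on which the solutions of the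
    three linear systems of [operator_bounds] are determined by their value at the
    centre. *)
Definition good_ball (y0 : V) (K r : R) : Prop :=
  [/\ 0 <= K, 0 < r, K * r <= 2^-1, ball y0 r `<=` W &
   forall y X (M : 'M[R]_(n + n, m)), ball y0 r y ->
     [/\ `|th X y *m (J *m M - M *m Lam)| <= K * `|X| * `|M|,
         `|'D_X Pi y *m M + J *m 'D_X Pi y *m M *m Lam| <= K * `|X| * `|M| &
         `|'D_X Pi y *m M + th X y *m M *m Lam| <= K * `|X| * `|M| ] ].

Lemma good_ball_exists y0 : W y0 -> exists K r, good_ball y0 K r.
Proof.
move=> Wy0.
have Ps := tangent_proj_smooth oW fs gE gu.
have [k1 k10 B1] := dir_lin_bound (fun i =>
  Ck_continuous oW (Ck_D (ebasis R i) (Ps 1)) Wy0).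
have [k2 k20 B2] := dir_lin_bound (fun i =>
  Ck_continuous oW (theta_form_smooth H (ebasis R i) 0) Wy0).
have NW : \forall y \near y0, W y by apply: (near_open oW Wy0).
have [r1 /= r10 Hr1] := iffLR (nbhs_ballP y0 _) (@filterI _ (nbhs y0) _ _ _ NW (filterI B1 B2)).
(* the constant of [operator_bounds]; k1 + k2 bounds both theta and the
   derivative of the projection *)
pose C := (n + n)%:R * ((n + n)%:R * `|J| + m%:R * `|Lam|) +
     ((n + n)%:R + m%:R * ((n + n)%:R * `|J| * (n + n)%:R) * `|Lam|) + ((n + n)%:R + m%:R * (n + n)%:R * `|Lam|).
have C0 : 0 <= C by rewrite /C !(mulr_ge0, addr_ge0).
pose K := (k1 + k2) * C.
have K0 : 0 <= K by rewrite mulr_ge0// addr_ge0.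
(* K + 1 because K may be 0 *)
pose r := Num.min r1 (2^-1 / (K + 1)).
have K1 : 0 < K + 1 by rewrite ltr_wpDl.
have r0 : 0 < r by rewrite lt_min r10 divr_gt0// invr_gt0.
exists K, r; split=> //.
- apply: (@le_trans _ _ (K * (2^-1 / (K + 1)))).
    by rewrite ler_wpM2l// ge_min lexx orbT.
  rewrite mulrA ler_pdivrMr// mulrC ler_wpM2l ?invr_ge0//.
  by rewrite lerDl.
- move=> y Hy; have [] := Hr1 y => //.
  by apply: le_ball Hy; rewrite ge_min lexx.
- move=> y X M Hy.
  have [|Wy [D1 D2]] := Hr1 y; first by apply: le_ball Hy; rewrite ge_min lexx.
  have HD : `|'D_X Pi y| <= (k1 + k2) * `|X|.
    rewrite (Ck_deriveE X oW (Ps 1) Wy); apply: le_trans (D1 X) _.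
    by rewrite ler_wpM2r// lerDl.
  have Ht : `|th X y| <= (k1 + k2) * `|X|.
    have -> : th X y = dir_lin (fun i => th (ebasis R i) y) X.
      have XE : X = \sum_i X i 0 *: ebasis R i.
        apply/colP => i; rewrite summxE (bigD1 i)//= big1 ?addr0 => [|j ji].
          by rewrite !mxE !eqxx mulr1.
        by rewrite !mxE eq_sym (negbTE ji) mulr0.
      have tl := theta_form_linear g f y.
      have t0 : th 0 y = 0.
        have := tl 1 0 0; rewrite !scale1r addr0 => /eqP.
        by rewrite -subr_eq0 opprD addrA subrr sub0r oppr_eq0 => /eqP.
      rewrite {1}XE /dir_lin; elim: (index_enum _) => [|i s IH]; first by rewrite !big_nil.
      by rewrite !big_cons tl IH.
    by apply: le_trans (D2 X) _; rewrite ler_wpM2r// lerDr.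
  have := operator_bounds J Lam M Ht HD; rewrite -/C.
  by rewrite (_ : (k1 + k2) * `|X| * C = K * `|X|)// /K mulrAC.
Qed.

Lemma good_ball_shrink y0 K r r' : good_ball y0 K r -> 0 < r' -> r' <= r -> good_ball y0 K r'.
Proof.
move=> [K0 r0 Kr BW Hb] r'0 rr; split=> //.
- by apply: le_trans Kr; rewrite ler_wpM2l.
- by move=> y /(le_ball rr); exact: BW.
- by move=> y X M /(le_ball rr); exact: Hb.
Qed.

Lemma solve_unique y0 K r E1 E2 : good_ball y0 K r ->
  Ck_on 1 (ball y0 r) E1 -> Ck_on 1 (ball y0 r) E2 ->
  solves (ball y0 r) E1 -> solves (ball y0 r) E2 -> E1 y0 = E2 y0 ->
  forall y, ball y0 r y -> E1 y = E2 y.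
Proof.
move=> [K0 r0 Kr BW Hb] C1 C2 S1 S2 E0 y By.
have oB : open (ball y0 r) by exact: ball_open.
apply/eqP; rewrite -subr_eq0; apply/eqP.
have Kr1 : K * r < 1 by apply: le_lt_trans Kr _; rewrite invf_lt1// ltr1n.
apply: (contraction_zero (h := fun y => E1 y - E2 y) K0 Kr1 _ _ _ By).
- by rewrite E0 subrr.
- move=> z Bz; apply: (@cvgB _ _ _ (nbhs z)); [exact: (Ck_continuous oB C1 Bz)|exact: (Ck_continuous oB C2 Bz)].
- move=> z X Bz; have [D1 D2] := is_deriveB (S1 z X Bz) (S2 z X Bz).
  split; first exact: D1.
  have [_ Hz _] := Hb z X (E1 z - E2 z) Bz.
  have A (D : 'M[R]_(n + n)) (M N : 'M[R]_(n + n, m)) :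
     D *m M + J *m D *m M *m Lam - (D *m N + J *m D *m N *m Lam) =
     D *m (M - N) + J *m D *m (M - N) *m Lam.
    by rewrite !mulmxBr mulmxBl opprD addrACA.
  by apply: le_trans Hz; apply: eq_le_norm; exact: (etrans D2 (A _ _ _)).
Qed.

(** The solution of the integrable system starting from a tangent [E0].  Its normal
    part vanishes at [y0] and solves a homogeneous system, hence is zero; on tangent
    sections the integrable system is the Codazzi system. *)
Lemma solve_exists y0 K r (E0 : 'M[R]_(n + n, m)) : good_ball y0 K r ->
  Pi y0 *m E0 = E0 ->
  exists E : V -> 'M[R]_(n + n, m),
    [/\ E y0 = E0, smooth_on (ball y0 r) E,
       (forall y, ball y0 r y -> Pi y *m E y = E y) & solves (ball y0 r) E].
Proof.
move=> [K0 r0 Kr BW Hb] PE0.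
have oB : open (ball y0 r) by exact: ball_open.
have [E Ey0 [Es ED]] := @linear_frobenius R n (n + n) m y0 r K th J Lam K0 Kr r0
  (theta_form_linear g f) (fun k X => Ck_sub BW (theta_form_smooth H X k))
  (fun X Y y By => theta_form_closed H X Y (BW _ By))
  (fun X Y y By => theta_form_comm H X Y (BW _ By))
  (fun X y By => theta_form_J H X (BW _ By))
  (fun X y M By => let: And3 h _ _ := Hb y X M By in h) E0.
have Kr1 : K * r < 1 by apply: le_lt_trans Kr _; rewrite invf_lt1// ltr1n.
have Ptan y : ball y0 r y -> Pi y *m E y = E y.
  move=> By; apply/eqP; rewrite eq_sym -subr_eq0; apply/eqP.
  rewrite -[X in X - _]mul1mx -mulmxBl.
  pose q y := (1%:M - Pi y) *m E y.
  have qs k : Ck_on k (ball y0 r) q.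
    apply: (Ck_mulmx oB); last exact: Es.
    apply: (Ck_add oB (Ck_cst k (1%:M : 'M[R]_(n + n)) oB)).
    exact: (Ck_lin (-%R) oB (Ck_sub BW (tangent_proj_smooth oW fs gE gu k))).
  apply: (contraction_zero (h := q) K0 Kr1 _ _ _ By).
  - by rewrite /q Ey0 mulmxBl mul1mx PE0 subrr.
  - by move=> z Bz; exact: (Ck_continuous oB (qs 0) Bz).
  - move=> z X Bz; have Wz := BW _ Bz.
    have DN : is_derive z X (fun z => 1%:M - Pi z) (- 'D_X Pi z).
      apply: (is_derive_eq (is_deriveB (is_derive_cst (1%:M : 'M[R]_(n + n)) z X)
        (is_derive_Pi oW fs gE gu X Wz))).
      by rewrite sub0r.
    have [D1 D2] := is_derive_mulmx DN (ED z X Bz).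
    split; first exact: D1.
    have [_ _ Hz] := Hb z X (q z) Bz.
    apply: le_trans Hz; rewrite -normrN; apply: eq_le_norm.
    apply: (etrans (congr1 (-%R) D2)).
    have tE := theta_formE H X Wz.
    have N := normal_part_deriv Jmx_sq (tangent_proj_idem gE gu Wz) (lag_J_Pi H Wz)
        Lam (E z) (lag_variation H X Wz).
    rewrite -tE in N; exact: (etrans (congr1 (-%R) N) (opprK _)).
exists E; split=> // y X By.
apply: (is_derive_eq (ED y X By)).
rewrite (theta_formE H X (BW _ By)).
exact: (theta_tangent Jmx_sq (lag_J_Pi H (BW _ By)) Lam (lag_variation H X (BW _ By)) (Ptan _ By)).
Qed.

End LocalSolution.

(** * From a solution E to the data of a P-transform *)

Section OmegaAlgebra.
Context {R : realType} {m : nat}.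
Variable P : 'M[R]_m.
Hypothesis sP : spectrum_condition P.

(** For [S = E^T E], the equation of a P-transform relating P and Omega, solved for
    Omega. *)
Definition omega_sol (S : 'M[R]_m) : 'M[R]_m :=
  (sylvester_inv P (P^T *m P^T *m S *m P + S *m P))^T.

Lemma omega_sol_linear : linear omega_sol.
Proof.
move=> a u v; rewrite /omega_sol -linearP/= -linearP/=; congr (_ _ _)^T.
by rewrite !(mulmxDr, mulmxDl) -!(scalemxAr, scalemxAl) scalerDr addrACA.
Qed.
HB.instance Definition _ := GRing.isLinear.Build R 'M[R]_m 'M[R]_m _ omega_sol omega_sol_linear.

Lemma omega_solE S : sylvester_op P (omega_sol S)^T = P^T *m P^T *m S *m P + S *m P.
Proof. by rewrite /omega_sol trmxK sylvester_invK. Qed.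

Lemma omega_sol_uniq S Om :
  sylvester_op P Om^T = P^T *m P^T *m S *m P + S *m P -> Om = omega_sol S.
Proof.
rewrite -omega_solE => E; apply: trmx_inj; apply/eqP; rewrite -subr_eq0; apply/eqP.
apply: (sylvester_inj sP); move: E; rewrite /sylvester_op mulmxBl mulmxBr => E.
by rewrite addrACA E -opprD subrr.
Qed.

(** Both sides solve the Sylvester equation whose right-hand side is the sum of
    [P^T P^T S P + S P] and its transpose. *)
Lemma omega_sol_sym S : S^T = S -> omega_sol S + (omega_sol S)^T = S + P^T *m S *m P.
Proof.
move=> SS; apply/eqP; rewrite -subr_eq0; apply/eqP; apply: (sylvester_inj sP).
rewrite -/(sylvester_op P _) linearB linearD/= omega_solE.
have -> : sylvester_op P (omega_sol S) = (P^T *m P^T *m S *m P + S *m P)^T.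
  by rewrite -omega_solE /sylvester_op linearD/= !trmx_mul !trmxK addrC.
rewrite /sylvester_op linearD/= !trmx_mul !trmxK SS !(mulmxDl, mulmxDr) !mulmxA.
apply/eqP; rewrite subr_eq0; apply/eqP/matrixP => i j; rewrite !mxE; ring.
Qed.

(** For the given argument, [(P + P^-1)^T K'] solves the Sylvester equation. *)
Lemma omega_sol_derive K' : K'^T = K' ->
  omega_sol (K' *m invmx P + (invmx P)^T *m K') = K' *m (invmx P + P).
Proof.
move=> KK; have uP := spectrum_unitmx sP; apply: esym; apply: omega_sol_uniq.
have PL : P^T *m (invmx P)^T = 1%:M by rewrite -trmx_mul mulVmx// trmx1.
rewrite trmx_mul KK linearD/= /sylvester_op !(mulmxDl, mulmxDr) !mulmxA.
rewrite PL mul1mx -[_ *m invmx P *m P]mulmxA -[K' *m invmx P *m P]mulmxA mulVmx// !mulmx1.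
rewrite -[P^T *m P^T *m (invmx P)^T]mulmxA PL mulmx1.
apply/matrixP => i j; rewrite !mxE; ring.
Qed.

End OmegaAlgebra.

Section PointwiseTransform.
Context {R : realType} {p m : nat}.
Variables (J Pi D : 'M[R]_p) (P L : 'M[R]_m) (E : 'M[R]_(p, m)).
Hypothesis JJ : J *m J = - 1%:M.
Hypothesis Jtr : J^T = - J.
Hypothesis Pi_idem : Pi *m Pi = Pi.
Hypothesis Pi_tr : Pi^T = Pi.
Hypothesis J_Pi : J *m Pi = (1%:M - Pi) *m J.
Hypothesis vD : proj_variation J Pi D.
Hypothesis D_tr : D^T = D.
Hypothesis PE : Pi *m E = E.

Lemma tangent_tr : E^T *m Pi = E^T.
Proof. by apply: trmx_inj; rewrite trmx_mul trmxK Pi_tr. Qed.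

Lemma tangent_J : E^T *m (J *m E) = 0.
Proof.
have -> : J *m E = (1%:M - Pi) *m (J *m E) by rewrite mulmxA -J_Pi -mulmxA PE.
rewrite -tangent_tr -mulmxA [Pi *m ((1%:M - Pi) *m _)]mulmxA mulmxBr mulmx1.
by rewrite Pi_idem subrr mul0mx mulmx0.
Qed.

Lemma tangent_D : E^T *m (D *m E) = 0.
Proof. by rewrite -tangent_tr -mulmxA (Pi_D_tangent Pi_idem vD PE) mulmx0. Qed.

(** For [D = D_X Pi] this is, up to sign, the form (v, w) |-> <alpha(E v, X), J E w>;
    the derivatives of the Gram matrix of E and of Omega are expressed by it. *)
Definition second_form := E^T *m (J *m D *m E).

Lemma second_form_tr : second_form^T = second_form.
Proof.
rewrite /second_form !trmx_mul trmxK D_tr Jtr mulmxN mulmxN mulNmx.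
by rewrite (proj2 vD) mulNmx mulmxN -!mulmxA.
Qed.

(** As E is tangent and [D E] normal, only the second term of [E'] contributes. *)
Lemma gram_derive E' : E' = D *m E + J *m D *m E *m L ->
  E'^T *m E + E^T *m E' = second_form *m L + L^T *m second_form.
Proof.
move=> EQ; have A : E^T *m E' = second_form *m L.
  by rewrite EQ mulmxDr tangent_D add0r mulmxA.
rewrite A -[E'^T *m E]trmxK trmx_mul trmxK A trmx_mul second_form_tr addrC.
by [].
Qed.

(** The two summands of F have orthogonal ranges, one tangent and the other normal. *)
Lemma calF_gram : (E + J *m E *m P)^T *m (E + J *m E *m P) =
  E^T *m E + P^T *m (E^T *m E) *m P.
Proof.
rewrite [(_ + _)^T]linearD/= !trmx_mul Jtr mulmxDl !mulmxDr.
have -> : E^T *m (J *m E *m P) = 0 by rewrite mulmxA tangent_J mul0mx.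
have -> : P^T *m (E^T *m - J) *m E = 0.
  by rewrite mulmxN mulmxN mulNmx -!mulmxA tangent_J mulmx0 oppr0.
rewrite add0r addr0; congr (_ + _).
rewrite mulmxN mulmxN mulNmx -!mulmxA -mulmxN.
by rewrite [J *m (J *m _)]mulmxA JJ mulNmx mul1mx !mulmxN opprK.
Qed.

Lemma calF_second : (E + J *m E *m P)^T *m (J *m D *m E) = second_form.
Proof.
rewrite linearD/= !trmx_mul Jtr mulmxDl -/second_form.
rewrite mulmxN mulmxN mulNmx -!mulmxA [J *m (J *m _)]mulmxA JJ mulNmx mul1mx.
by rewrite !mulmxN tangent_D mulmx0 !oppr0 addr0.
Qed.

End PointwiseTransform.

Section ChartTransform.
Context {R : realType} {n m : nat}.
Local Notation V := 'cV[R]_n.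
Context (W : set V) (g : V -> 'M[R]_n) (f : V -> 'cV[R]_(n + n)) (P : 'M[R]_m).
Hypothesis H : lagrangian_chart W g f.
Hypothesis sP : spectrum_condition P.
Local Notation df := (jac f).
Local Notation J := (Jmx R n).
Local Notation Pi := (tangent_proj g f).
Local Notation L := (invmx P).
Let oW := lc_open H.
Let fs := lc_smooth H.
Let gE := lc_metric H.
Let gu := lc_unit H.
Let PL : P *m L = 1%:M. Proof. by rewrite mulmxV// spectrum_unitmx. Qed.
Let LP : L *m P = 1%:M. Proof. by rewrite mulVmx// spectrum_unitmx. Qed.

(** [E] stands for [df omega^t], and [cs_codazzi] is the Codazzi equation of
    [beta = J E P]: the derivatives of [E + beta] are tangent. *)
Record chart_solution (E : V -> 'M[R]_(n + n, m)) (phi : V -> 'cV[R]_m) : Prop := {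
  cs_smooth : smooth_on W E;
  cs_phi_smooth : smooth_on W phi;
  cs_tangent : forall y, W y -> Pi y *m E y = E y;
  cs_codazzi : forall y X, W y ->
    (1%:M - Pi y) *m ('D_X E y + J *m 'D_X E y *m P) = 0;
  cs_phi : forall y, W y -> jac phi y = (E y)^T *m df y }.

Section Solution.
Context (E : V -> 'M[R]_(n + n, m)) (phi : V -> 'cV[R]_m).
Hypothesis S : chart_solution E phi.
Local Notation beta := (fun y => J *m E y *m P).
Local Notation Om := (fun y => omega_sol P ((E y)^T *m E y)).

Lemma cs_is_derive y X : W y -> is_derive y X E ('D_X E y).
Proof. exact: Ck_is_derive (cs_smooth S 1). Qed.

Lemma cs_derive_tangent y X : W y -> 'D_X E y = 'D_X Pi y *m E y + Pi y *m 'D_X E y.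
Proof.
move=> Wy.
have [_ E1] := is_derive_mulmx (is_derive_Pi oW fs gE gu X Wy) (cs_is_derive X Wy).
have E2 : 'D_X E y = 'D_X (fun z => Pi z *m E z) y.
  by apply: near_eq_derive; apply: (near_open oW Wy) => z Wz; rewrite (cs_tangent S Wz).
exact: (etrans E2 E1).
Qed.

Lemma cs_solves y X : W y ->
  'D_X E y = 'D_X Pi y *m E y + J *m 'D_X Pi y *m E y *m L.
Proof.
move=> Wy.
exact: (cod_variation Jmx_sq (lag_J_Pi H Wy) (lag_variation H X Wy) PL
  (cs_derive_tangent X Wy) (cs_codazzi S X Wy)).
Qed.

Lemma cs_omegat y : W y -> df y *m omegat g phi y = E y.
Proof.
move=> Wy; rewrite /omegat /adjoint_mx (cs_phi S Wy) trmx_mul trmxK.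
by rewrite -{2}(cs_tangent S Wy) /tangent_proj !mulmxA.
Qed.

Lemma cs_omegat_smooth : smooth_on W (omegat g phi).
Proof.
move=> k; apply: (Ck_mulmx oW); first exact: (invmetric_smooth oW fs gE gu).
exact: (Ck_lin trmx oW (jac_smooth oW (cs_phi_smooth S) k)).
Qed.

Lemma cs_calF y : W y -> calF g f phi beta y = E y + J *m E y *m P.
Proof. by move=> Wy; rewrite /calF cs_omegat. Qed.

Lemma cs_beta_derive y X : W y -> is_derive y X beta (J *m 'D_X E y *m P).
Proof. move=> Wy; exact: (is_derive_mulmxr P (is_derive_mulmxl J (cs_is_derive X Wy))). Qed.

Lemma cs_calF_derive y X : W y ->
  'D_X (calF g f phi beta) y = J *m 'D_X Pi y *m E y *m (L + P).
Proof.
move=> Wy.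
have E1 : 'D_X (calF g f phi beta) y = 'D_X (fun z => E z + beta z) y.
  by apply: near_eq_derive; apply: (near_open oW Wy) => z Wz; rewrite cs_calF.
have [_ E2] := is_derive_add (cs_is_derive X Wy) (cs_beta_derive X Wy).
have E3 := variation_cod Jmx_sq (lag_variation H X Wy) LP (cs_tangent S Wy) (cs_solves X Wy).
exact: (etrans E1 (etrans E2 E3)).
Qed.

(** By [gram_derive] and [omega_sol_derive] the derivative of Omega is [K' (P^-1 + P)]
    with K' the second form; [calF_second] and the formula for [dF] give the same
    value for the right-hand side. *)
Lemma cs_Om_derive y X : W y ->
  'D_X Om y = (calF g f phi beta y)^T *m 'D_X (calF g f phi beta) y.
Proof.
move=> Wy.
have D1 := cs_is_derive X Wy.
have [_ E1] := is_derive_linear_mx (omega_sol P) (is_derive_mulmx (is_derive_trmx D1) D1).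
have vD := lag_variation H X Wy.
have iP := tangent_proj_idem gE gu Wy.
have tP := tangent_proj_tr gE Wy.
have tD := dPi_tr oW fs gE gu X Wy.
have TE := cs_tangent S Wy.
have E2 := gram_derive Jmx_tr iP tP vD tD TE (cs_solves X Wy).
have E3 := omega_sol_derive sP (second_form_tr (E y) Jmx_tr vD tD).
have E4 := calF_second P Jmx_sq Jmx_tr iP tP vD TE.
have E5 := congr1 (fun M => M *m (L + P)) (esym E4).
have E6 : (calF g f phi beta y)^T *m 'D_X (calF g f phi beta) y =
   (E y + J *m E y *m P)^T *m (J *m 'D_X Pi y *m E y) *m (L + P).
  by rewrite (cs_calF Wy) (cs_calF_derive X Wy) !mulmxA.
exact: (etrans E1 (etrans (congr1 (omega_sol P) E2) (etrans E3 (etrans E5 (esym E6))))).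
Qed.

Lemma cs_normal y : W y -> (df y)^T *m (J *m E y *m P) = 0.
Proof.
move=> Wy; rewrite -(cs_omegat Wy) !mulmxA -[(df y)^T *m J *m df y]mulmxA (df_J_df H Wy).
by rewrite !mul0mx.
Qed.

(** The normal parts of [D_X E] and of [(D_X df) omega^t] agree, since
    [df D_X omega^t] is tangent. *)
Lemma cs_gauss_codazzi y X v : W y ->
  sff g f X (omegat g phi y *m v) y + normal_covd g f X beta y *m v = 0.
Proof.
move=> Wy; rewrite (sffE oW fs gE gu _ _ Wy) /normal_covd.
have [_ E1] := cs_beta_derive X Wy.
have [_ E2] := is_derive_mulmx (is_derive_jac oW fs X Wy)
  (Ck_is_derive X (cs_omegat_smooth 1) Wy).
have E3 : 'D_X E y = 'D_X df y *m omegat g phi y + df y *m 'D_X (omegat g phi) y.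
  rewrite addrC; have <- : 'D_X (fun z => df z *m omegat g phi z) y = 'D_X E y.
    by apply: near_eq_derive; apply: (near_open oW Wy) => z Wz; rewrite cs_omegat.
  exact: (etrans E2 (addrC _ _)).
have := cs_codazzi S X Wy; rewrite -[normal_proj g f y]/(1%:M - Pi y).
have Pd := tangent_projK gE gu Wy.
rewrite [X in _ *m X *m v]E1.
move: E3; move: ('D_X E y) ('D_X df y) ('D_X (omegat g phi) y) => DE Ddf DO -> {E1 E2}.
rewrite addrAC [(1%:M - Pi y) *m (_ + df y *m DO)]mulmxDr.
have -> : (1%:M - Pi y) *m (df y *m DO) = 0.
  by rewrite mulmxA mulmxBl mul1mx Pd subrr mul0mx.
by rewrite addr0 mulmxDr => /(congr1 (fun M => M *m v)); rewrite /= mul0mx mulmxDl !mulmxA.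
Qed.

(** The Gauss formula: against a normal vector, alpha(X, Y) may be replaced by the
    full derivative [(D_X df) Y]. *)
Lemma shape_op_normal y X (xi : 'cV[R]_(n + n)) : W y -> (df y)^T *m xi = 0 ->
  shape_op g f y xi *m X = invmx (g y) *m (('D_X df y)^T *m xi).
Proof.
move=> Wy nxi; rewrite /shape_op -[LHS]mulmxA; apply: (congr1 (mulmx (invmx (g y)))).
have Pxi : Pi y *m xi = 0 by rewrite /tangent_proj -mulmxA nxi mulmx0.
have sE i j : (sff g f (ebasis R i) (ebasis R j) y)^T *m xi =
    ('D_(ebasis R j) df y *m ebasis R i)^T *m xi.
  have E1 := derive_jac_sym oW fs (ebasis R i) (ebasis R j) Wy.
  have E2 := sffE oW fs gE gu (ebasis R i) (ebasis R j) Wy.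
  have E3 : (1%:M - Pi y)^T *m xi = xi.
    by rewrite linearB/= trmx1 (tangent_proj_tr gE Wy) mulmxBl mul1mx Pxi subr0.
  have A (q : nat) (Q : 'M[R]_(n + n)) (B : 'M[R]_(n + n, q)) (v : 'cV[R]_q) :
    Q^T *m xi = xi -> (Q *m B *m v)^T *m xi = (B *m v)^T *m xi.
    by move=> E'; rewrite -mulmxA trmx_mul -mulmxA E'.
  exact: (etrans (congr1 (fun M => M^T *m xi) E2) (etrans (A _ _ _ _ E3)
    (congr1 (fun M => M^T *m xi) E1))).
have E4 : 'D_X df y = \sum_j X j 0 *: 'D_(ebasis R j) df y.
  exact: (derive_dir_lin X oW (jac_smooth oW fs) Wy).
have A (B : 'I_n -> 'M[R]_(n + n, n)) :
  (\matrix_(i, j) ((B j *m ebasis R i)^T *m xi) 0 0) *m X = (\sum_j X j 0 *: B j)^T *m xi.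
  rewrite linear_sum mulmx_suml; apply/colP => i; rewrite mxE summxE.
  apply: eq_bigr => j _; rewrite linearZ/= -scalemxAl !mxE mulrC; congr (_ * _).
  apply: eq_bigr => k _; congr (_ * _); rewrite !mxE (bigD1 i)//= big1 ?addr0 => [|l li].
    by rewrite !mxE !eqxx mulr1.
  by rewrite !mxE (negbTE li) mulr0.
have E5 : (\matrix_(i, j) ((sff g f (ebasis R i) (ebasis R j) y)^T *m xi) 0 0) =
   \matrix_(i, j) (('D_(ebasis R j) df y *m ebasis R i)^T *m xi) 0 0.
  by apply/matrixP => i j; rewrite !mxE; have := congr1 (fun M : 'M[R]_1 => M 0 0) (sE i j); rewrite !mxE.
exact: (etrans (congr1 (mulmx^~ X) E5) (etrans (A _) (congr1 (fun M => M^T *m xi) (esym E4)))).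
Qed.

(** The Weingarten formula, from the derivative of [df^T beta = 0]. *)
Lemma cs_shape_op y X v : W y ->
  shape_op g f y (J *m E y *m P *m v) *m X =
  - (invmx (g y) *m (df y)^T *m (J *m 'D_X E y *m P *m v)).
Proof.
move=> Wy.
have nb : (df y)^T *m (J *m E y *m P *m v) = 0 by rewrite mulmxA cs_normal// mul0mx.
have [_ E1] := is_derive_mulmx (is_derive_trmx (is_derive_jac oW fs X Wy)) (cs_beta_derive X Wy).
have E2 : 'D_X (fun z => (df z)^T *m beta z) y = 0.
  have <- : 'D_X (fun _ : V => 0 : 'M[R]_(n, m)) y = 0 by exact: derive_cst.
  by apply: near_eq_derive; apply: (near_open oW Wy) => z Wz; exact: cs_normal.
have E3 := etrans (esym E2) E1.
have A (a b : nat) (G : 'M[R]_a) (D F : 'M[R]_(a, b)) (B C : 'M[R]_(b, m)) :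
    0 = D *m B + F *m C -> G *m (D *m (B *m v)) = - (G *m F *m (C *m v)).
  move=> E'; have -> : D *m (B *m v) = - (F *m (C *m v)).
    by apply/eqP; rewrite -addr_eq0 !mulmxA -mulmxDl -E' mul0mx.
  by rewrite mulmxN !mulmxA.
exact: (etrans (shape_op_normal X Wy nb) (A _ _ _ _ _ _ _ E3)).
Qed.

(** The image of [Phi_v X] under [df] is the tangential part of [(D_X F) v], that is
    [J (D_X Pi) E (P^-1 + P) v]; as [E (P^-1 + P) v] is tangent, symmetry of the second
    fundamental form exchanges it with [X]. *)
Lemma cs_Phi y X v : W y ->
  Phi_op g f phi beta y v X =
  invmx (g y) *m (df y)^T *m (J *m ('D_(omegat g phi y *m (L + P) *m v) Pi y *m (df y *m X))).
Proof.
move=> Wy; rewrite /Phi_op (cs_shape_op X v Wy) opprK.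
have E1 : covd g X (omegat g phi) y = invmx (g y) *m (df y)^T *m 'D_X E y.
  have E0 := df_covd oW fs gE gu Wy (Ck_is_derive X (cs_omegat_smooth 1) Wy).
  have E2 : 'D_X (fun z => df z *m omegat g phi z) y = 'D_X E y.
    by apply: near_eq_derive; apply: (near_open oW Wy) => z Wz; rewrite cs_omegat.
  have A (C : 'M[R]_(n, m)) (B : 'M[R]_(n + n, m)) : df y *m C = Pi y *m B ->
     C = invmx (g y) *m (df y)^T *m B.
    move=> E'; rewrite -[C]mul1mx -(invmetricK gE gu Wy) -[LHS]mulmxA E'.
    by rewrite /tangent_proj !mulmxA (invmetricK gE gu Wy) mul1mx.
  by apply: A; exact: (etrans E0 (congr1 (mulmx (Pi y)) E2)).
have E3 := variation_cod Jmx_sq (lag_variation H X Wy) LP (cs_tangent S Wy) (cs_solves X Wy).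
have E4 := dPi_sym oW fs gE gu X (omegat g phi y *m (L + P) *m v) Wy.
have E5 : df y *m (omegat g phi y *m (L + P) *m v) = E y *m (L + P) *m v.
  by rewrite -[in RHS](cs_omegat Wy) !mulmxA.
have A (G : 'M[R]_(n, n + n)) (C : 'M[R]_(n, m)) (B DE D : 'M[R]_(n + n, m)) (DP : 'M[R]_(n + n))
   (z : 'cV[R]_(n + n)) : C = G *m DE -> DE + B = J *m DP *m D *m (L + P) ->
   DP *m (D *m (L + P) *m v) = z ->
   C *m v + G *m (B *m v) = G *m (J *m z).
  by move=> -> E' <-; rewrite -mulmxA -mulmxDr -mulmxDl E' !mulmxA.
apply: (A _ _ _ _ _ _ _ E1 E3).
exact: (etrans (congr1 (mulmx ('D_X Pi y)) (esym E5)) E4).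
Qed.

(** By [cs_Phi], [df Phi_u = J (D_a Pi) df] for a vector [a] depending on [u] only.  As
    J anticommutes with these derivatives, [df Phi_u Phi_v] becomes
    [(D_a Pi) (D_b Pi) df], and the two derivatives commute. *)
Lemma cs_Phi_comm y X u v : W y ->
  Phi_op g f phi beta y u (Phi_op g f phi beta y v X) =
  Phi_op g f phi beta y v (Phi_op g f phi beta y u X).
Proof.
move=> Wy; rewrite !(cs_Phi _ _ Wy).
move: (_ *m u) (_ *m v) => a b.
have A c (d : V) : df y *m (invmx (g y) *m (df y)^T *m (J *m ('D_c Pi y *m (df y *m d)))) =
     J *m ('D_c Pi y *m (df y *m d)).
  have vD := lag_variation H c Wy.
  have := normal_J_D_tangent (tangent_proj_idem gE gu Wy) (lag_J_Pi H Wy) vD (tangent_projK gE gu Wy).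
  move: ('D_c Pi y) => D E0; rewrite !mulmxA -/(tangent_proj g f y).
  move: E0; rewrite mulmxBl mul1mx => /eqP; rewrite subr_eq0 => /eqP E0.
  by rewrite [in RHS]E0 !mulmxA.
have B c d : J *m ('D_c Pi y *m (J *m ('D_d Pi y *m (df y *m X)))) =
   'D_c Pi y *m ('D_d Pi y *m (df y *m X)).
  have [_ vD] := lag_variation H c Wy.
  have C (D : 'M[R]_(n + n)) (w : 'cV[R]_(n + n)) : J *m D = - (D *m J) ->
      J *m (D *m (J *m w)) = D *m w.
    by move=> E'; rewrite [J *m (D *m _)]mulmxA E' mulNmx -mulmxA [J *m (J *m w)]mulmxA Jmx_sq mulNmx mul1mx mulmxN opprK.
  exact: (C _ _ vD).
have C (G : 'M[R]_(n, n + n)) (Da Db : 'M[R]_(n + n)) (w : 'cV[R]_(n + n)) :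
    Da *m Db = Db *m Da -> G *m (Da *m (Db *m w)) = G *m (Db *m (Da *m w)).
  by move=> E'; rewrite [Da *m (Db *m _)]mulmxA E' -[Db *m Da *m _]mulmxA.
have D c d : invmx (g y) *m (df y)^T *m (J *m ('D_c Pi y *m (df y *m
   (invmx (g y) *m (df y)^T *m (J *m ('D_d Pi y *m (df y *m X))))))) =
   invmx (g y) *m (df y)^T *m ('D_c Pi y *m ('D_d Pi y *m (df y *m X))).
  have E1 := congr1 (fun M => invmx (g y) *m (df y)^T *m (J *m ('D_c Pi y *m M))) (A d X).
  exact: (etrans E1 (congr1 (mulmx (invmx (g y) *m (df y)^T)) (B c d))).
exact: (etrans (D a b) (etrans (C _ _ _ _ (lag_comm H a b Wy)) (esym (D b a)))).
Qed.

Lemma cs_ribaucour y : W y -> omega_sol P ((E y)^T *m E y) \in unitmx ->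
  ribaucour_data_at g f phi beta Om y.
Proof.
move=> Wy uO; split.
- exact: cs_normal.
- by move=> X v; exact: cs_gauss_codazzi.
- by move=> u v X; exact: cs_Phi_comm.
- exact: uO.
- by move=> X; exact: cs_Om_derive.
- rewrite (cs_calF Wy) omega_sol_sym//; last by rewrite trmx_mul trmxK.
  by rewrite (calF_gram P Jmx_sq Jmx_tr (tangent_proj_idem gE gu Wy) (tangent_proj_tr gE Wy) (lag_J_Pi H Wy) (cs_tangent S Wy)).
Qed.

Lemma T_rho (Gm : 'M[R]_m) :
  (- P^T - invmx P^T) *m (P^T *m Gm *m P) = - (P^T *m P^T *m Gm *m P + Gm *m P).
Proof.
have uP : P^T \in unitmx by rewrite unitmx_tr spectrum_unitmx.
by rewrite mulmxBl mulNmx !mulmxA mulVmx// mul1mx opprD.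
Qed.

Lemma cs_gram y : W y -> jac phi y *m omegat g phi y = (E y)^T *m E y.
Proof. by move=> Wy; rewrite {1}(cs_phi S Wy) -mulmxA cs_omegat. Qed.

Lemma cs_P_condition y : W y -> P_condition_at g f P phi beta Om y.
Proof.
move=> Wy; split; first by rewrite -(cs_omegat Wy) !mulmxA.
rewrite -[P^T *m jac phi y *m _]mulmxA cs_gram// T_rho -omega_solE// /sylvester_op.
exact: subrr.
Qed.

End Solution.
End ChartTransform.

(** * From the data of a P-transform to a solution E, and change of chart *)

Lemma lagrangian_chart_sub (R : realType) n (W W' : set 'cV[R]_n) g f :
  open W' -> W' `<=` W -> lagrangian_chart W g f -> lagrangian_chart W' g f.
Proof.
move=> oW' sW H; split=> //.
- by move=> k; exact: (Ck_sub sW (lc_smooth H k)).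
- by move=> y /sW; exact: (lc_metric H).
- by move=> y /sW; exact: (lc_unit H).
- by move=> y /sW; exact: (lc_lag H).
- by move=> y X Y Z /sW; exact: (lc_flat H).
Qed.

Section Converse.
Context {R : realType} {n m : nat}.
Local Notation V := 'cV[R]_n.
Context (W : set V) (g : V -> 'M[R]_n) (f : V -> 'cV[R]_(n + n)) (P : 'M[R]_m).
Hypothesis H : lagrangian_chart W g f.
Hypothesis sP : spectrum_condition P.
Local Notation df := (jac f).
Local Notation J := (Jmx R n).
Local Notation Pi := (tangent_proj g f).
Let oW := lc_open H.
Let fs := lc_smooth H.
Let gE := lc_metric H.
Let gu := lc_unit H.
Context (phi : V -> 'cV[R]_m) (beta : V -> 'M[R]_(n + n, m)) (Om : V -> 'M[R]_m).
Hypothesis phi_smooth : smooth_on W phi.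
Hypothesis data : forall y, W y -> ribaucour_data_at g f phi beta Om y.
Hypothesis cond : forall y, W y -> P_condition_at g f P phi beta Om y.
Local Notation E := (fun y => df y *m omegat g phi y).

Lemma data_omegat_smooth : smooth_on W (omegat g phi).
Proof.
move=> k; apply: (Ck_mulmx oW); first exact: (invmetric_smooth oW fs gE gu).
exact: (Ck_lin trmx oW (jac_smooth oW phi_smooth k)).
Qed.

Lemma data_E_smooth : smooth_on W E.
Proof.
move=> k; exact: (Ck_mulmx oW (jac_smooth oW fs k) (data_omegat_smooth k)).
Qed.

Lemma data_beta y : W y -> beta y = J *m E y *m P.
Proof. by move=> Wy; have [-> _] := cond Wy; rewrite !mulmxA. Qed.

(** The Codazzi condition for [beta = J E P] is the vanishing of the normal part of
    [D_X (E + beta)], by the same identity as in [cs_gauss_codazzi]. *)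
Lemma data_chart_solution : chart_solution W g f P E phi.
Proof.
split.
- exact: data_E_smooth.
- exact: phi_smooth.
- by move=> y Wy; rewrite mulmxA (tangent_projK gE gu Wy).
- move=> y X Wy; apply: mulmx_cV_inj => v; rewrite mul0mx.
  have := rib_codazzi (data Wy) X v.
  have [_ E2] := is_derive_mulmx (is_derive_jac oW fs X Wy)
    (Ck_is_derive X (data_omegat_smooth 1) Wy).
  have E1 : 'D_X beta y = J *m 'D_X E y *m P.
    have [_ <-] := is_derive_mulmxr P (is_derive_mulmxl J (Ck_is_derive X (data_E_smooth 1) Wy)).
    by apply: near_eq_derive; apply: (near_open oW Wy) => z Wz; rewrite data_beta.
  have Pd : (1%:M - Pi y) *m df y = 0 by rewrite mulmxBl mul1mx (tangent_projK gE gu Wy) subrr.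
  have A (a b : nat) (N : 'M[R]_a) (s : 'M[R]_(a, 1)) (F D : 'M[R]_(a, b))
      (O DO : 'M[R]_(b, m)) (E' B K : 'M[R]_(a, m)) (w : 'cV[R]_m) :
      N *m F = 0 -> E' = F *m DO + D *m O -> B = K -> s = N *m D *m (O *m w) ->
      s + N *m B *m w = 0 -> N *m (E' + K) *m w = 0.
    by move=> NF -> -> ->; rewrite !mulmxDr [N *m (F *m _)]mulmxA NF mul0mx add0r mulmxDl !mulmxA.
  apply: (A _ _ _ _ _ _ _ _ _ _ _ _ Pd (etrans E2 (addrC _ _)) E1 (sffE oW fs gE gu _ _ Wy)).
- move=> y Wy; rewrite trmx_mul -mulmxA -(gE Wy) /omegat /adjoint_mx trmx_mul trmxK.
  by rewrite (invmetric_symm gE Wy) mulmxKV// gu.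
Qed.

Lemma data_Om y : W y -> Om y = omega_sol P ((E y)^T *m E y).
Proof.
move=> Wy; apply: (omega_sol_uniq sP); have [_] := cond Wy.
have -> : P^T *m jac phi y *m omegat g phi y *m P = P^T *m ((E y)^T *m E y) *m P.
  congr (_ *m _); rewrite -mulmxA; congr (_ *m _).
  rewrite {1}(cs_phi data_chart_solution Wy) -mulmxA.
  by [].
by rewrite (T_rho sP) => /eqP; rewrite subr_eq0 => /eqP.
Qed.

End Converse.

Section Transport.
Context {R : realType} {n m : nat}.
Local Notation V := 'cV[R]_n.
Context (W W' : set V) (g g' : V -> 'M[R]_n) (f f' : V -> 'cV[R]_(n + n)) (P : 'M[R]_m).
Context (tau : V -> V).
Hypothesis H : lagrangian_chart W g f.
Hypothesis H' : lagrangian_chart W' g' f'.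
Hypothesis tau_smooth : smooth_on W' tau.
Hypothesis tauW : forall y, W' y -> W (tau y).
Hypothesis ff' : forall y, W' y -> f' y = f (tau y).
Let oW := lc_open H.
Let oW' := lc_open H'.

Lemma transport_derive p q (h : V -> 'M[R]_(p, q)) y X : smooth_on W h -> W' y ->
  'D_X (h \o tau) y = 'D_('D_X tau y) h (tau y).
Proof.
move=> hs Wy; have [_ E] := chain_rule X oW' oW (tau_smooth 1) (hs 1) Wy (tauW Wy).
exact: E.
Qed.

Lemma transport_jac p (h : V -> 'cV[R]_p) y : smooth_on W h -> W' y ->
  jac (h \o tau) y = jac h (tau y) *m jac tau y.
Proof.
move=> hs Wy; apply: mulmx_cV_inj => X.
have hts : smooth_on W' (h \o tau).
  by move=> k; exact: (Ck_comp oW' oW tauW (tau_smooth k) (hs k)).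
have E1 := jacE oW' hts X Wy.
have E2 := jacE oW hs ('D_X tau y) (tauW Wy).
have E3 := congr1 (mulmx (jac h (tau y))) (jacE oW' tau_smooth X Wy).
exact: (etrans (esym E1) (etrans (transport_derive X hs Wy) (etrans E2 (etrans E3 (mulmxA _ _ _))))).
Qed.

Lemma transport_jac_f y : W' y -> jac f' y = jac f (tau y) *m jac tau y.
Proof.
move=> Wy; rewrite -(transport_jac (lc_smooth H) Wy).
apply/matrixP => i j; rewrite !mxE; congr ((_ : 'cV[R]_(n + n)) _ _).
by apply: near_eq_derive; apply: (near_open oW' Wy) => z Wz; exact: ff'.
Qed.

(** Both projections have the same range, spanned by [df] and by [df A] with A
    invertible. *)
Lemma transport_Pi y : W' y -> tangent_proj g' f' y = tangent_proj g f (tau y).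
Proof.
move=> Wy; have Wty := tauW Wy.
have dE := transport_jac_f Wy; set A := jac tau y in dE.
have g'E : g' y = A^T *m g (tau y) *m A.
  by rewrite (lc_metric H' Wy) (lc_metric H Wty) dE trmx_mul !mulmxA.
have u' := lc_unit H' Wy.
have uA : A \in unitmx.
  by move: u'; rewrite g'E unitmx_mul => /andP[].
have uAT : A^T *m g (tau y) \in unitmx by rewrite unitmx_mul unitmx_tr uA (lc_unit H Wty).
have K : A *m invmx (g' y) *m A^T = invmx (g (tau y)).
  apply: (can_inj (mulKmx uAT)); rewrite -[RHS]mulmxA mulmxV ?(lc_unit H Wty)// mulmx1.
  by rewrite !mulmxA -g'E mulmxV// mul1mx.
by rewrite /tangent_proj dE trmx_mul -K !mulmxA.
Qed.

Lemma transport_chart_solution (E : V -> 'M[R]_(n + n, m)) (phi : V -> 'cV[R]_m) :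
  chart_solution W g f P E phi -> chart_solution W' g' f' P (E \o tau) (phi \o tau).
Proof.
move=> S; split.
- by move=> k; exact: (Ck_comp oW' oW tauW (tau_smooth k) (cs_smooth S k)).
- by move=> k; exact: (Ck_comp oW' oW tauW (tau_smooth k) (cs_phi_smooth S k)).
- by move=> y Wy; rewrite (transport_Pi Wy); exact: (cs_tangent S (tauW Wy)).
- move=> y X Wy; rewrite (transport_Pi Wy).
  rewrite (transport_derive X (cs_smooth S) Wy).
  exact: (cs_codazzi S _ (tauW Wy)).
- move=> y Wy; rewrite (transport_jac (cs_phi_smooth S) Wy) (transport_jac_f Wy).
  by rewrite (cs_phi S (tauW Wy)) mulmxA.
Qed.

End Transport.

(** * Existence and uniqueness in one chart *)

Section ChartExistence.
Context {R : realType} {n m : nat}.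
Local Notation V := 'cV[R]_n.
Context (W : set V) (g : V -> 'M[R]_n) (f : V -> 'cV[R]_(n + n)) (P : 'M[R]_m).
Hypothesis H : lagrangian_chart W g f.
Hypothesis sP : spectrum_condition P.
Local Notation df := (jac f).
Local Notation J := (Jmx R n).
Local Notation Pi := (tangent_proj g f).
Local Notation L := (invmx P).
Let oW := lc_open H.
Let fs := lc_smooth H.
Let gE := lc_metric H.
Let gu := lc_unit H.

(** The transpose of the Codazzi system applied to tangent vectors; its first term
    drops out because [D_X Pi] maps tangent vectors to normal ones. *)
Lemma tangent_derive_form y X (E : 'M[R]_(n + n, m)) : W y -> Pi y *m E = E ->
  ('D_X Pi y *m E + J *m 'D_X Pi y *m E *m L)^T *m df y =
  L^T *m E^T *m (J *m ('D_X Pi y *m df y)).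
Proof.
move=> Wy PE.
have A (D : 'M[R]_(n + n)) : D^T = D -> E^T *m (D *m df y) = 0 -> J *m D = - (D *m J) ->
   (D *m E + J *m D *m E *m L)^T *m df y = L^T *m E^T *m (J *m (D *m df y)).
  move=> Dt z0 JD; rewrite [(_ + _)^T]linearD/= mulmxDl !trmx_mul Dt Jmx_tr -[E^T *m D *m df y]mulmxA z0 add0r.
  by rewrite [J *m (D *m _)]mulmxA JD !mulmxN !mulNmx !mulmxN !mulmxA.
have z0 : E^T *m ('D_X Pi y *m df y) = 0.
  have h := Pi_D_tangent (tangent_proj_idem gE gu Wy) (lag_variation H X Wy) (tangent_projK gE gu Wy).
  rewrite -PE trmx_mul (tangent_proj_tr gE Wy) -mulmxA.
  exact: (etrans (congr1 (mulmx E^T) h) (mulmx0 _ _)).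
exact: (A _ (dPi_tr oW fs gE gu X Wy) z0 (proj2 (lag_variation H X Wy))).
Qed.

Section Potential.
Context (y0 : V) (r : R) (E : V -> 'M[R]_(n + n, m)).
Hypothesis BW : ball y0 r `<=` W.
Hypothesis E_smooth : smooth_on (ball y0 r) E.
Hypothesis E_tangent : forall y, ball y0 r y -> Pi y *m E y = E y.
Hypothesis E_solves : solves g f L (ball y0 r) E.
Let oB : open (ball y0 r). Proof. exact: ball_open. Qed.

(** The differential of phi, recovered from [E = df omega^t]. *)
Definition potential_form (X y : V) : 'cV[R]_m := (E y)^T *m (df y *m X).

Lemma potential_form_smooth X : smooth_on (ball y0 r) (potential_form X).
Proof.
move=> k; apply: (Ck_mulmx oB (Ck_lin trmx oB (E_smooth k))).
exact: (Ck_mulmx oB (Ck_sub BW (jac_smooth oW fs k)) (Ck_cst k X oB)).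
Qed.

(** Differentiating produces [L^T E^T J (D_Y Pi) df X] and [E^T (D_Y df) X], both
    symmetric in X and Y. *)
Lemma potential_form_closed X Y y : ball y0 r y ->
  'D_Y (potential_form X) y = 'D_X (potential_form Y) y.
Proof.
move=> By; have Wy := BW By.
have D X' Y' : 'D_Y' (potential_form X') y =
   L^T *m (E y)^T *m (J *m ('D_Y' Pi y *m (df y *m X'))) + (E y)^T *m ('D_Y' df y *m X').
  have [_ E1] := is_derive_mulmx (is_derive_trmx (E_solves Y' By))
    (is_derive_mulmxr X' (is_derive_jac oW fs Y' Wy)).
  have A (a b c d e : nat) (G : 'M[R]_(a, b)) (K : 'M[R]_(b, d)) (F : 'M[R]_(a, c))
     (N : 'M[R]_(e, e)) (D : 'M[R]_(e, d)) (Q : 'M[R]_(c, e)) (x : 'M[R]_(d, 1)) :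
     G *m K = F *m (Q *m (N *m D)) -> G *m (K *m x) = F *m (Q *m (N *m (D *m x))).
    by move=> E'; rewrite mulmxA E' !mulmxA.
  have E2 := A _ _ _ _ _ _ _ _ _ _ _ X' (tangent_derive_form Y' Wy (E_tangent By)).
  exact: (etrans E1 (congr1 (fun M => M + _) E2)).
have E1 := dPi_sym oW fs gE gu X Y Wy.
have E2 := derive_jac_sym oW fs X Y Wy.
apply: (etrans (D X Y)); apply: esym; apply: (etrans (D Y X)).
exact: (f_equal2 (fun a b => L^T *m (E y)^T *m (J *m a) + (E y)^T *m b) E1 E2).
Qed.

Lemma potential_exists (phi0 : 'cV[R]_m) : 0 < r ->
  exists phi : V -> 'cV[R]_m, [/\ smooth_on (ball y0 r) phi, phi y0 = phi0 &
    forall y, ball y0 r y -> jac phi y = (E y)^T *m df y].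
Proof.
move=> r0.
have wl z : linear (potential_form^~ z).
  by move=> a u v; rewrite /potential_form !mulmxDr -!scalemxAr.
have D y X : ball y0 r y -> is_derive y X (radial_primitive y0 potential_form) (potential_form X y).
  exact: (radial_primitive_derive wl (fun X => potential_form_smooth X 1) potential_form_closed).
pose phi y := radial_primitive y0 potential_form y + (phi0 - radial_primitive y0 potential_form y0).
have Dphi y X : ball y0 r y -> is_derive y X phi (potential_form X y).
  move=> By; apply: (is_derive_eq (is_derive_add (D y X By)
    (is_derive_cst (phi0 - radial_primitive y0 potential_form y0) y X))).
  by rewrite addr0.
have ps k : Ck_on k (ball y0 r) phi.
  apply: (Ck_pred oB); apply: (Ck_intro oB Dphi) => v; exact: potential_form_smooth.
exists phi; split=> //.
  by rewrite /phi addrC subrK.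
move=> y By; apply: mulmx_cV_inj => X.
have [_ E1] := Dphi y X By.
exact: (etrans (esym (jacE oB ps X By)) (etrans E1 (mulmxA _ _ _))).
Qed.

End Potential.

Lemma initial_Om_unit y (Z : 'M[R]_(n, m)) : W y ->
  (forall a : complex R, spectrum P a ->
     forall v : 'cV[complex R]_m, (complexify P - a%:M) *m v = 0 ->
       complexify Z *m v = 0 -> v = 0) ->
  omega_sol P ((df y *m Z)^T *m (df y *m Z)) \in unitmx.
Proof.
move=> Wy HZ; have uP := spectrum_unitmx sP.
apply: (@omega_unitmx R _ _ (df y *m Z) P).
- move=> a Pa v Pv Ev; apply: (HZ a Pa v Pv).
  rewrite -[Z]mul1mx -(invmetricK gE gu Wy) -[_ *m _ *m Z]mulmxA [complexify (_ *m (df y *m Z))]complexifyM.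
  by rewrite -mulmxA Ev mulmx0.
- by rewrite omega_sol_sym// trmx_mul trmxK.
- exact: omega_solE.
Qed.

(** The initial value of E is [df omega_0^t].  Omega is invertible at [y0], hence nearby
    since its determinant is continuous.  For uniqueness, [E] is determined by
    [solve_unique], and then two functions phi have the same differential. *)
Theorem chart_solution_exists (y0 : V) (phi0 : 'cV[R]_m) (omega0 : 'M[R]_(m, n)) :
  W y0 ->
  (forall a : complex R, spectrum P a ->
     forall v : 'cV[complex R]_m, (complexify P - a%:M) *m v = 0 ->
       complexify (adjoint_mx (g y0) omega0) *m v = 0 -> v = 0) ->
  exists (r : R) (E : V -> 'M[R]_(n + n, m)) (phi : V -> 'cV[R]_m),
  [/\ 0 < r, ball y0 r `<=` W,
      [/\ chart_solution (ball y0 r) g f P E phi, phi y0 = phi0 & jac phi y0 = omega0],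
      (forall y, ball y0 r y -> omega_sol P ((E y)^T *m E y) \in unitmx) &
      forall E' phi', chart_solution (ball y0 r) g f P E' phi' ->
        phi' y0 = phi0 -> jac phi' y0 = omega0 ->
        forall y, ball y0 r y -> E' y = E y /\ phi' y = phi y].
Proof.
move=> Wy0 HZ.
have [K [r1 G1]] := good_ball_exists L H Wy0.
set Z := adjoint_mx (g y0) omega0 in HZ.
have PZ : Pi y0 *m (df y0 *m Z) = df y0 *m Z by rewrite mulmxA (tangent_projK gE gu Wy0).
have [E [Ey0 Es Et ES]] := solve_exists H G1 PZ.
have [_ r10 _ BW1 _] := G1.
have oB1 : open (ball y0 r1) by exact: ball_open.
have By01 : ball y0 r1 y0 by exact: ballxx.
have Omc : (fun y => \det (omega_sol P ((E y)^T *m E y))) @ y0 -->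
    \det (omega_sol P ((E y0)^T *m E y0)).
  have OC : Ck_on 0 (ball y0 r1) (fun y => omega_sol P ((E y)^T *m E y)).
    exact: (Ck_lin (omega_sol P) oB1 (Ck_mulmx oB1 (Ck_lin trmx oB1 (Es 0)) (Es 0))).
  exact: (cvg_det (Ck_continuous oB1 OC By01)).
have u0 : \det (omega_sol P ((E y0)^T *m E y0)) != 0.
  by rewrite Ey0 -unitfE -unitmxE; exact: initial_Om_unit.
have near_u : \forall y \near y0, omega_sol P ((E y)^T *m E y) \in unitmx.
  have N0 : nbhs (\det (omega_sol P ((E y0)^T *m E y0))) [set x : R | x != 0].
    by apply: open_nbhs_nbhs; split=> //; exact: open_neq.
  have := Omc _ N0; apply: (@filterS _ (nbhs y0)) => y /= Hy.
  by rewrite unitmxE unitfE.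
have [r2 /= r20 Hr2] := iffLR (nbhs_ballP y0 _) near_u.
pose r := Num.min r1 r2.
have r0 : 0 < r by rewrite lt_min r10 r20.
have rr1 : r <= r1 by rewrite ge_min lexx.
have rr2 : r <= r2 by rewrite ge_min lexx orbT.
have G := good_ball_shrink G1 r0 rr1.
have [K0 _ Kr BW _] := G.
have oB : open (ball y0 r) by exact: ball_open.
have By0 : ball y0 r y0 by exact: ballxx.
have sB : ball y0 r `<=` ball y0 r1 by exact: le_ball.
have HB := lagrangian_chart_sub oB BW H.
have Es' : smooth_on (ball y0 r) E by move=> k; exact: (Ck_sub sB (Es k)).
have Et' y : ball y0 r y -> Pi y *m E y = E y by move/sB; exact: Et.
have ES' : solves g f L (ball y0 r) E by move=> y X /sB; exact: ES.
have [phi [ps p0 pd]] := potential_exists BW Es' Et' ES' phi0 r0.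
have CS : chart_solution (ball y0 r) g f P E phi.
  split=> //.
  move=> y X By; have Wy := BW _ By.
  have [_ E1] := ES' y X By.
  have LP : L *m P = 1%:M by rewrite mulVmx// spectrum_unitmx.
  have vD := lag_variation H X Wy.
  have E2 := variation_cod Jmx_sq vD LP (Et' y By) E1.
  have E3 := normal_J_D_tangent (tangent_proj_idem gE gu Wy) (lag_J_Pi H Wy) vD (Et' y By).
  have A (N : 'M[R]_(n + n)) (a b : 'M[R]_(n + n, m)) (c : 'M[R]_m) :
    a = b *m c -> N *m b = 0 -> N *m a = 0.
    by move=> -> E'; rewrite mulmxA E' mul0mx.
  exact: (A _ _ _ _ E2 E3).
have jp0 : jac phi y0 = omega0.
  rewrite pd// Ey0 trmx_mul -mulmxA -(gE Wy0) /Z /adjoint_mx trmx_mul trmxK.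
  by rewrite (invmetric_symm gE Wy0) mulmxKV// gu.
exists r, E, phi; split=> //.
- by move=> y By; apply: Hr2; exact: (le_ball rr2).
- move=> E' phi' CS' p'0 jp'0.
  have E0 : E' y0 = E y0.
    by rewrite -(cs_omegat CS' By0) -(cs_omegat CS By0) /omegat jp'0 jp0.
  have ES'' : solves g f L (ball y0 r) E'.
    move=> z X Bz.
    exact: (is_derive_eq (cs_is_derive CS' X Bz) (cs_solves HB sP CS' X Bz)).
  have EE := solve_unique G (cs_smooth CS' 1) (cs_smooth CS 1) ES'' ES' E0.
  move=> y By; split; first exact: EE.
  apply/eqP; rewrite -subr_eq0; apply/eqP.
  apply: (contraction_zero (h := fun y => phi' y - phi y) (K := 0) (lexx _) _ _ _ _ By).
  + by rewrite mul0r.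
  + by rewrite p'0 p0 subrr.
  + move=> z Bz; apply: (@cvgB _ _ _ (nbhs z)).
      exact: (Ck_continuous oB (cs_phi_smooth CS' 1) Bz).
    exact: (Ck_continuous oB (cs_phi_smooth CS 1) Bz).
  + move=> z X Bz.
    have D1 := Ck_is_derive X (cs_phi_smooth CS' 1) Bz.
    have D2 := Ck_is_derive X (cs_phi_smooth CS 1) Bz.
    have [D3 D4] := is_deriveB D1 D2; split; first exact: D3.
    have E3 : 'D_X phi' z = 'D_X phi z.
      have J1 := jacE oB (cs_phi_smooth CS') X Bz.
      have J2 := jacE oB (cs_phi_smooth CS) X Bz.
      have J3 : jac phi' z = jac phi z by rewrite (cs_phi CS' Bz) (cs_phi CS Bz) EE.
      exact: (etrans J1 (etrans (congr1 (mulmx^~ X) J3) (esym J2))).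
    have E4 := etrans D4 (etrans (congr1 (fun M => M - 'D_X phi z) E3) (subrr _)).
    by rewrite !mul0r; apply: (le_trans (eq_le_norm E4)); rewrite normr0.
Qed.

End ChartExistence.

(** * The P-transform on the manifold *)

Lemma eq_jac (R : realType) n p (W : set 'cV[R]_n) (h h' : 'cV[R]_n -> 'cV[R]_p) y :
  open W -> W y -> (forall z, W z -> h z = h' z) -> jac h y = jac h' y.
Proof.
move=> oW Wy E; apply/matrixP => i j; rewrite !mxE; congr ((_ : 'cV[R]_p) _ _).
by apply: near_eq_derive; apply: (near_open oW Wy).
Qed.

Section Charts.
Context {R : realType} {n : nat} (M : smooth_manifold R n).
Implicit Types c : chart R n M.

Lemma chart_invK c x : atlas c -> chart_dom c x -> chart_inv c (c x) = x.
Proof. by move=> /atlas_chart[_ _ + _ _]; apply. Qed.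

Lemma open_chart_preimage c (B : set 'cV[R]_n) : atlas c -> open B ->
  open (chart_dom c `&` c @^-1` B).
Proof.
move=> /atlas_chart[oD _ _ cc _] oB; rewrite openE => x [Dx Bx].
have N1 : nbhs x (chart_dom c) by exact: open_nbhs_nbhs.
have N2 : nbhs x (c @^-1` B) by apply: (cc x Dx); exact: open_nbhs_nbhs.
exact: (filterI N1 N2).
Qed.

Lemma open_chart_image c (U : set M) : atlas c -> open U ->
  open (c @` (chart_dom c `&` U)).
Proof.
move=> Ac oU; have [_ oI cK _ ic] := atlas_chart Ac; rewrite openE => y [x [Dx Ux] <-].
have N1 : nbhs (c x) (c @` chart_dom c) by apply: open_nbhs_nbhs; split=> //; exists x.
have N2 : nbhs (c x) (chart_inv c @^-1` U).
  by apply: (ic x Dx); rewrite (cK x Dx); exact: open_nbhs_nbhs.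
apply: filterS (filterI N1 N2) => z [[t Dt <-]]; rewrite /preimage/= (cK t Dt) => Ut.
by exists t.
Qed.

(** A positive definite form has trivial kernel. *)
Lemma metric_unitmx (g : riemannian_metric M) c x : atlas c -> chart_dom c x ->
  metric_mx g c x \in unitmx.
Proof.
move=> Ac Dx; rewrite -row_free_unit -kermx_eq0; apply/eqP/row_matrixP => i; rewrite row0.
set u := row i _; have uG : u *m metric_mx g c x = 0 by rewrite -row_mul mulmx_ker row0.
apply: contrapT => /eqP u0.
have := @metric_pos _ _ _ g c x Ac Dx u^T; rewrite trmx_eq0 => /(_ u0).
by rewrite trmxK uG mul0mx mxE ltxx.
Qed.

End Charts.

Section Manifold.
Context {R : realType} {n : nat} (M : smooth_manifold R n) (g : riemannian_metric M).
Context (f : M -> 'cV[R]_(n + n)).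
Hypothesis flat : flat_metric g.
Hypothesis iso : isometric_immersion g f.
Hypothesis lag : lagrangian f.
Implicit Types c : chart R n M.

Lemma lagrangian_chart_of c : atlas c ->
  lagrangian_chart (c @` chart_dom c) (local_metric g c) (local_expr c f).
Proof.
move=> Ac; have [fs fi] := iso; have [_ oI cK _ _] := atlas_chart Ac; split=> //.
- by have := fs c Ac; rewrite setIT.
- move=> _ [x Dx <-]; have [_ ->] := fi c x Ac Dx.
  by rewrite /local_metric /local_expr /= cK.
- move=> _ [x Dx <-]; rewrite /local_metric /local_expr /= cK//.
  exact: metric_unitmx.
- by move=> _ [x Dx <-]; exact: lag.
- by move=> _ X Y Z [x Dx <-]; exact: flat.
Qed.

End Manifold.

Section Globalise.
Context {R : realType} {n m : nat} (M : smooth_manifold R n) (g : riemannian_metric M).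
Context (f : M -> 'cV[R]_(n + n)) (P : 'M[R]_m).
Hypothesis flat : flat_metric g.
Hypothesis iso : isometric_immersion g f.
Hypothesis lag : lagrangian f.
Hypothesis sP : spectrum_condition P.
Context (c0 : chart R n M) (B : set 'cV[R]_n).
Hypothesis Ac0 : atlas c0.
Hypothesis oB : open B.
Hypothesis B_sub : B `<=` c0 @` chart_dom c0.
Local Notation J := (Jmx R n).

(** The neighbourhood on which the transform is constructed, for [B] a ball of the chart. *)
Definition chart_region : set M := chart_dom c0 `&` c0 @^-1` B.
Local Notation U := chart_region.

Let oU : open U. Proof. exact: open_chart_preimage. Qed.

Let overlap_open c : atlas c -> open (c @` (chart_dom c `&` U)).
Proof. by move=> Ac; exact: open_chart_image. Qed.

Let H0 : lagrangian_chart B (local_metric g c0) (local_expr c0 f).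
Proof. exact: (lagrangian_chart_sub oB B_sub (lagrangian_chart_of flat iso lag Ac0)). Qed.

Let Hc c : atlas c ->
  lagrangian_chart (c @` (chart_dom c `&` U)) (local_metric g c) (local_expr c f).
Proof.
move=> Ac; apply: (lagrangian_chart_sub (overlap_open Ac) _ (lagrangian_chart_of flat iso lag Ac)).
by apply: image_subset => x [].
Qed.

Lemma region_image : c0 @` (chart_dom c0 `&` U) = B.
Proof.
apply/seteqP; split=> [_ [x [_ [_ Bx]] <-] //|y By].
by have [x Dx xy] := B_sub By; exists x => //; split=> //; split=> //; rewrite /preimage/= xy.
Qed.

Section Solution.
Context (E : 'cV[R]_n -> 'M[R]_(n + n, m)) (phi : 'cV[R]_n -> 'cV[R]_m).
Hypothesis S : chart_solution B (local_metric g c0) (local_expr c0 f) P E phi.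
Hypothesis Ou : forall y, B y -> omega_sol P ((E y)^T *m E y) \in unitmx.

Definition sol_phi (x : M) : 'cV[R]_m := phi (c0 x).
Definition sol_beta (x : M) : 'M[R]_(n + n, m) := J *m E (c0 x) *m P.
Definition sol_Omega (x : M) : 'M[R]_m := omega_sol P ((E (c0 x))^T *m E (c0 x)).
Definition sol_domain : set M := [set x | U x /\
    forall c : chart R n M, atlas c -> chart_dom c x ->
    \rank (jac (ribaucour_map (local_metric g c) (local_expr c f)
      (local_expr c sol_phi) (local_expr c sol_beta) (local_expr c sol_Omega)) (c x)) = n].
(** The Ribaucour formula, written without reference to a chart: F is a function on the
    region. *)
Definition sol_map (x : M) : 'cV[R]_(n + n) :=
  f x - (E (c0 x) + sol_beta x) *m invmx (sol_Omega x) *m sol_phi x.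

Let In (c : chart R n M) x : chart_dom c x -> U x -> (c @` (chart_dom c `&` U)) (c x).
Proof. by move=> Dx Ux; exists x. Qed.

(** The functions [E o c0] and [phi o c0] on the region, read in another chart, differ
    from [E] and [phi] by a transition map. *)
Lemma overlap_solution c : atlas c ->
  chart_solution (c @` (chart_dom c `&` U)) (local_metric g c) (local_expr c f) P
    (E \o (c0 \o chart_inv c)) (phi \o (c0 \o chart_inv c)).
Proof.
move=> Ac; apply: (transport_chart_solution H0 (Hc Ac) _ _ _ S).
- move=> k; apply: Ck_sub (atlas_smooth Ac Ac0 k).
  by apply: image_subset => x [Dx [D0 _]].
- by move=> _ [x [Dx [D0 Bx]] <-] /=; rewrite chart_invK.
- by move=> _ [x [Dx [D0 Bx]] <-]; rewrite /local_expr/= !chart_invK.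
Qed.

Lemma sol_P_transform : P_transform g f U P sol_phi sol_beta sol_Omega sol_domain sol_map.
Proof.
split; [|exact: sP|]; last first.
  move=> c x Ac Dx Ux.
  have PC := cs_P_condition sP (overlap_solution Ac) (In Dx Ux).
  exact: PC.
split; [| | | |by []|].
- by move=> c Ac; exact: (cs_phi_smooth (overlap_solution Ac)).
- move=> c Ac k; have oO := overlap_open Ac.
  exact: (Ck_mulmx oO (Ck_mulmx oO (Ck_cst k J oO) (cs_smooth (overlap_solution Ac) k)) (Ck_cst k P oO)).
- move=> c Ac k; have oO := overlap_open Ac; have Es := cs_smooth (overlap_solution Ac) k.
  exact: (Ck_lin (omega_sol P) oO (Ck_mulmx oO (Ck_lin trmx oO Es) Es)).
- move=> c x Ac Dx Ux.
  apply: (cs_ribaucour (Hc Ac) sP (overlap_solution Ac) (In Dx Ux)).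
  by rewrite /= chart_invK//; apply: Ou; have [] := Ux.
- move=> c x Ac Dx [Ux _].
  rewrite /ribaucour_map.
  have CF := cs_calF (overlap_solution Ac) (In Dx Ux).
  have A (F F' : 'M[R]_(n + n, m)) (O O' : 'M[R]_m) (u u' : 'cV[R]_(n + n)) (v v' : 'cV[R]_m) :
    F = F' -> O = O' -> u = u' -> v = v' -> u - F' *m invmx O' *m v' = u' - F *m invmx O *m v.
    by move=> -> -> -> ->.
  rewrite /sol_map; apply: A.
  + apply: (etrans CF).
    by rewrite /= chart_invK.
  + by rewrite /local_expr/= chart_invK.
  + by rewrite /local_expr/= chart_invK.
  + by rewrite /local_expr/= chart_invK.
Qed.

Lemma sol_local y : B y -> local_expr c0 sol_phi y = phi y.
Proof. by move=> /B_sub[x Dx <-]; rewrite /local_expr/= /sol_phi chart_invK. Qed.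

(** In the chart [c0] the given data come from a chart solution, so they have the same
    [phi] and [E], and [E] determines [beta] and [Omega].  In any other chart the two
    Ribaucour maps then agree on an open set, so they have the same regular points. *)
Lemma sol_unique phi' beta' Omega' D' ft' :
  (forall E1 phi1, chart_solution B (local_metric g c0) (local_expr c0 f) P E1 phi1 ->
     phi1 = local_expr c0 phi' -> forall y, B y -> E1 y = E y /\ phi1 y = phi y) ->
  P_transform g f U P phi' beta' Omega' D' ft' ->
  [/\ forall x, U x -> [/\ phi' x = sol_phi x, beta' x = sol_beta x & Omega' x = sol_Omega x],
      D' = sol_domain & forall x, sol_domain x -> ft' x = sol_map x].
Proof.
move=> uniq T; have [Rb _ Pc] := T.
have [ps _ _ dat reg map] := Rb.
have ps' : smooth_on B (local_expr c0 phi') by have := ps c0 Ac0; rewrite region_image.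
have onB (Q : 'cV[R]_n -> Prop) : (forall x, chart_dom c0 x -> U x -> Q (c0 x)) -> forall y, B y -> Q y.
  by move=> HQ y By; have [x Dx xy] := B_sub By; rewrite -xy; apply: HQ => //; split=> //; rewrite /preimage/= xy.
have dat' := onB _ (fun x => dat c0 x Ac0).
have Pc' := onB _ (fun x => Pc c0 x Ac0).
have CS := data_chart_solution H0 ps' dat' Pc'.
have EE := uniq _ _ CS erefl.
have val x : U x -> [/\ phi' x = sol_phi x, beta' x = sol_beta x & Omega' x = sol_Omega x].
  move=> [Dx Bx]; have [E1 E2] := EE _ Bx.
  have E3 := data_beta Pc' Bx.
  have E4 := data_Om H0 sP ps' dat' Pc' Bx.
  have F1 : phi' x = sol_phi x by apply: etrans E2; rewrite /local_expr/= chart_invK.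
  have F2 : beta' x = sol_beta x.
    apply: etrans (etrans E3 (congr1 (fun N => J *m N *m P) E1)).
    by rewrite /local_expr/= chart_invK.
  have F3 : Omega' x = sol_Omega x.
    apply: etrans (etrans E4 (congr1 (fun N : 'M[R]_(n + n, m) => omega_sol P (N^T *m N)) E1)).
    by rewrite /local_expr/= chart_invK.
  exact: (And3 F1 F2 F3).
have loc c y : atlas c -> (c @` (chart_dom c `&` U)) y ->
   [/\ local_expr c phi' y = local_expr c sol_phi y,
       local_expr c beta' y = local_expr c sol_beta y &
       local_expr c Omega' y = local_expr c sol_Omega y].
  by move=> Ac [x [Dx Ux] <-]; rewrite /local_expr/= chart_invK//; exact: val.
have rm c y : atlas c -> (c @` (chart_dom c `&` U)) y ->
  ribaucour_map (local_metric g c) (local_expr c f)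
      (local_expr c phi') (local_expr c beta') (local_expr c Omega') y =
  ribaucour_map (local_metric g c) (local_expr c f)
      (local_expr c sol_phi) (local_expr c sol_beta) (local_expr c sol_Omega) y.
  move=> Ac Oy; have [E1 E2 E3] := loc c y Ac Oy.
  have E4 : jac (local_expr c phi') y = jac (local_expr c sol_phi) y.
    by apply: (eq_jac (overlap_open Ac) Oy) => z Oz; have [] := loc c z Ac Oz.
  by rewrite /ribaucour_map /calF /omegat E1 E2 E3 E4.
have DD : D' = sol_domain.
  rewrite reg; apply/seteqP; split=> x [Ux HD]; (split; first exact: Ux) => c Ac Dx.
  - apply: etrans (HD c Ac Dx); apply: (congr1 (fun A : 'M[R]_(n + n, n) => \rank A)); apply: esym.
    exact: (eq_jac (overlap_open Ac) (In Dx Ux) (fun z Oz => rm c z Ac Oz)).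
  - apply: etrans (HD c Ac Dx); apply: (congr1 (fun A : 'M[R]_(n + n, n) => \rank A)).
    exact: (eq_jac (overlap_open Ac) (In Dx Ux) (fun z Oz => rm c z Ac Oz)).
split=> // x Dx; have [[D0x B0x] _] := Dx.
have Dx' : D' x by rewrite DD.
rewrite (map c0 x Ac0 D0x Dx') rm//; last by exists x.
by rewrite -(vr_map (pt_ribaucour sol_P_transform) Ac0 D0x Dx).
Qed.

End Solution.
End Globalise.

Theorem theorem46 (R : realType) (n m : nat) (M : smooth_manifold R n)
    (g : riemannian_metric M) (f : M -> 'cV[R]_(n + n)) (P : 'M[R]_m)
    (x0 : M) (c0 : chart R n M) (phi0 : 'cV[R]_m) (omega0 : 'M[R]_(m, n)) :
  flat_metric g ->
  isometric_immersion g f ->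
  lagrangian f ->
  zero_relative_nullity g f ->
  spectrum_condition P ->
  atlas c0 -> chart_dom c0 x0 ->
  (forall a : complex R, spectrum P a ->
     forall v : 'cV[complex R]_m,
       (complexify P - a%:M) *m v = 0 ->
       complexify (adjoint_mx (metric_mx g c0 x0) omega0) *m v = 0 ->
       v = 0) ->
  exists U : set M, [/\ open U, U x0 &
    exists (phi : M -> 'cV[R]_m) (beta : M -> 'M[R]_(n + n, m))
      (Omega : M -> 'M[R]_m) (D : set M) (ft : M -> 'cV[R]_(n + n)),
    [/\ P_transform g f U P phi beta Omega D ft,
        phi x0 = phi0,
        jac (local_expr c0 phi) (c0 x0) = omega0 &
        forall (phi' : M -> 'cV[R]_m) (beta' : M -> 'M[R]_(n + n, m))
          (Omega' : M -> 'M[R]_m) (D' : set M) (ft' : M -> 'cV[R]_(n + n)),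
        P_transform g f U P phi' beta' Omega' D' ft' ->
        phi' x0 = phi0 ->
        jac (local_expr c0 phi') (c0 x0) = omega0 ->
        [/\ forall x, U x ->
              [/\ phi' x = phi x, beta' x = beta x & Omega' x = Omega x],
            D' = D &
            forall x, D x -> ft' x = ft x]]].
Proof.
move=> flat iso lag _ sP Ac0 D0 HZ.
have H := lagrangian_chart_of flat iso lag Ac0.
have W0 : (c0 @` chart_dom c0) (c0 x0) by exists x0.
have gE : local_metric g c0 (c0 x0) = metric_mx g c0 x0.
  by rewrite /local_metric /local_expr/= chart_invK.
rewrite -gE in HZ.
have [r [E [phi [r0 BW [S p0 jp0] Ou uniq]]]] := chart_solution_exists H sP phi0 W0 HZ.
set B := ball (c0 x0) r in BW S Ou uniq.
have oB : open B by exact: ball_open.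
have B0 : B (c0 x0) by exact: ballxx.
exists (chart_region c0 B); split.
- exact: open_chart_preimage.
- by split.
exists (sol_phi c0 phi), (sol_beta P c0 E), (sol_Omega P c0 E).
exists (sol_domain g f P c0 B E phi), (sol_map f P c0 E phi); split.
- exact: sol_P_transform.
- exact: p0.
- by rewrite -jp0; apply: (eq_jac oB B0) => y By; exact: (sol_local Ac0 BW).
- move=> phi' beta' Omega' D' ft' T p0' jp0'.
  apply: (sol_unique flat iso lag sP Ac0 oB BW S Ou _ T) => E1 phi1 S1 p1E y By.
  apply: (uniq E1 phi1 S1 _ _ y By); rewrite p1E//.
  by rewrite /local_expr/= chart_invK.
Qed.
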